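(* Let $\mathbb{F}=\mathbb{C}$ or $\mathbb{R}$, let $\mathbf{x}\mapsto\mathbf{f}(\mathbf{x})$ be a smooth mapping from an open domain $\Omega\subset\mathbb{F}^m$ to $\mathbb{F}^n$ with a semiregular zero $\mathbf{x}_*$, and let $r=\mathrm{rank}(\mathbf{f}_{\mathbf{x}}(\mathbf{x}_* ))$. Then there is an open neighborhood $\Omega_*$ of $\mathbf{x}_*$ such that, for any $\hat{\mathbf{x}}\in\Omega_*$, the equality $$\mathbf{f}_{\mathbf{x}}(\hat{\mathbf{x}})_{\mathrm{rank}\text{-}r}^\dagger\,\mathbf{f}(\hat{\mathbf{x}})=\mathbf{0}$$ holds if and only if $\hat{\mathbf{x}}$ is a semiregular zero of $\mathbf{f}$ in the same branch of $\mathbf{x}_*$.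
   Context: Smooth mapping: $\mathbf{f}:\Omega\to\mathbb{F}^n$ with $\Omega\subset\mathbb{F}^m$ open is smooth if it has continuous derivatives of second order (case $\mathbb{F}=\mathbb{R}$) or is holomorphic (case $\mathbb{F}=\mathbb{C}$). Its Jacobian is denoted $\mathbf{f}_{\mathbf{x}}$. Rank-$r$ projection: for a matrix $A$ with singular values $\sigma_1(A)\ge\sigma_2(A)\ge\cdots$ and corresponding left and right singular vectors $\mathbf{u}_j,\mathbf{v}_j$, $A_{\mathrm{rank}\text{-}r}:=\sum_{j=1}^r\sigma_j(A)\,\mathbf{u}_j\mathbf{v}_j^{\mathsf H}$ (it does not depend on the choice of singular vectors when $\sigma_r(A)>\sigma_{r+1}(A)$). $\dagger$ denotes the Moore-Penrose inverse and $A_{\mathrm{rank}\text{-}r}^\dagger:=(A_{\mathrm{rank}\text{-}r})^\dagger$. Zero: $\mathbf{x}_*$ is a zero of $\mathbf{f}$ if $\mathbf{f}(\mathbf{x}_* )=\mathbf{0}$; $\mathbf{f}^{-1}(\mathbf{0})$ is the set of all zeros. A zero is isolated if it is the only zero in some open neighborhood of it. Dimension of a zero: let $\mathbf{x}_*$ be a zero of $\mathbf{f}$. If there is an open neighborhood $\Delta\subset\Omega$ of $\mathbf{x}_*$ in $\mathbb{F}^m$ such that $\Delta\cap\mathbf{f}^{-1}(\mathbf{0})=\phi(\Lambda)$, where $\phi$ is a differentiable injective mapping defined on a connected open set $\Lambda$ in $\mathbb{F}^k$ for a certain $k>0$, with $\phi(\mathbf{z}_* )=\mathbf{x}_*$ for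 some $\mathbf{z}_*\in\Lambda$ and Jacobian $\phi_{\mathbf{z}}(\mathbf{z}_* )$ of rank $k$, then the dimension of $\mathbf{x}_*$ as a zero of $\mathbf{f}$ is $\dim_{\mathbf{f}}(\mathbf{x}_* ):=k$. An isolated zero has dimension $0$. Otherwise the dimension is not defined. Semiregular zero: a zero $\mathbf{x}_*$ is semiregular if $\dim_{\mathbf{f}}(\mathbf{x}_* )$ is well-defined and equal to the nullity of $\mathbf{f}_{\mathbf{x}}(\mathbf{x}_* )$, i.e. $\dim_{\mathbf{f}}(\mathbf{x}_* )+\mathrm{rank}(\mathbf{f}_{\mathbf{x}}(\mathbf{x}_* ))=m$. Same branch: with $\phi,\Lambda,\mathbf{z}_*,k$ as in the definition of the dimension of $\mathbf{x}_*$ and $\Lambda_*\subset\Lambda$ an open neighborhood of $\mathbf{z}_*$ on which $\mathrm{rank}(\phi_{\mathbf{z}}(\mathbf{z}))\equiv k$, every $\mathbf{x}\in\phi(\Lambda_* )$ is in the same branch of zeros as $\mathbf{x}_*$; and if $\tilde{\mathbf{x}}$ is in the same branch as $\mathbf{x}_*$, then every zero in the same branch as $\tilde{\mathbf{x}}$ is in the same branch as $\mathbf{x}_*$. An isolated zero is in the same branch only as itself. *)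

(* Defs.v *)
From HB Require Import structures.
From mathcomp Require Import all_boot all_order all_algebra complex.
From mathcomp Require Import all_classical all_reals.
From mathcomp Require Import topology normedtype derive.

Set Implicit Arguments.
Unset Strict Implicit.
Unset Printing Implicit Defensive.

Import Order.TTheory GRing.Theory Num.Theory.
Import numFieldNormedType.Exports.

Local Open Scope classical_set_scope.
Local Open Scope ring_scope.

Variant rc_kind := RealScalars | ComplexScalars.

Definition rc_scalar (R : realType) (K : rc_kind) : numFieldType :=
  match K with
  | RealScalars => (R : numFieldType)
  | ComplexScalars => (R[i] : numFieldType)
  end.

Definition rc_conj (R : realType) (K : rc_kind) :
    rc_scalar R K -> rc_scalar R K :=
  match K as K0 return rc_scalar R K0 -> rc_scalar R K0 with
  | RealScalars => id
  | ComplexScalars => fun z : R[i] => Num.conj z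
  end.

(* Points of F^m are row vectors. The library's ['J f x] acts on row vectors
   from the right; its transpose is the usual n x m Jacobian f_x(x). *)
Definition jac (F : numFieldType) (m n : nat) (f : 'rV[F]_m -> 'rV[F]_n)
  (x : 'rV[F]_m) : 'M[F]_(n, m) := ('J f x)^T.

Definition differentiable_on (F : numFieldType) (m n : nat)
    (D : set 'rV[F]_m) (f : 'rV[F]_m -> 'rV[F]_n) : Prop :=
  forall x, D x -> differentiable f x.

(* For functions on F^m, continuity of the second derivative amounts to
   continuity of the derivative of the Jacobian in every fixed direction. *)
Definition twice_continuously_differentiable_on (F : numFieldType) (m n : nat)
    (D : set 'rV[F]_m) (f : 'rV[F]_m -> 'rV[F]_n) : Prop :=
  [/\ differentiable_on D f,
      (forall x, D x -> differentiable (jac f) x)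
    & (forall v x, D x -> {for x, continuous ('D_v (jac f))})].

(* [D] is meant to be open. Over [R[i]], [differentiable] is complex
   differentiability, so [differentiable_on] is holomorphy. *)
Definition smooth (R : realType) (K : rc_kind) (m n : nat)
    (D : set 'rV[rc_scalar R K]_m)
    (f : 'rV[rc_scalar R K]_m -> 'rV[rc_scalar R K]_n) : Prop :=
  match K with
  | RealScalars => twice_continuously_differentiable_on D f
  | ComplexScalars => differentiable_on D f
  end.

Section MatrixDecompositions.
Variables (R : realType) (K : rc_kind).
Local Notation F := (rc_scalar R K).

Definition ctrmx (p q : nat) (A : 'M[F]_(p, q)) : 'M[F]_(q, p) :=
  map_mx (@rc_conj R K) A^T.

(* Singular values and vectors are indexed from 0; [s j] is extended by 0 and
   [u j], [v j] are arbitrary for [j >= minn p q]. The order of [F] makes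
   [0 <= s j] imply that [s j] is real, also over [R[i]]. *)
Record is_svd (p q : nat) (A : 'M[F]_(p, q))
    (s : nat -> F) (u : nat -> 'cV[F]_p) (v : nat -> 'cV[F]_q) : Prop := {
  svd_ge0 : forall j, 0 <= s j;
  svd_nonincreasing : forall i j, (i <= j)%N -> s j <= s i;
  svd_eq0 : forall j, (minn p q <= j)%N -> s j = 0;
  svd_left_orthonormal : forall i j, (i < minn p q)%N -> (j < minn p q)%N ->
    ctrmx (u i) *m u j = ((i == j)%:R)%:M;
  svd_right_orthonormal : forall i j, (i < minn p q)%N -> (j < minn p q)%N ->
    ctrmx (v i) *m v j = ((i == j)%:R)%:M;
  svd_sum : A = \sum_(j < minn p q) s j *: (u j *m ctrmx (v j))
}.

Definition is_rank_proj (p q r : nat) (A B : 'M[F]_(p, q)) : Prop :=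
  exists s u v, is_svd A s u v /\
    B = \sum_(j < r) s j *: (u j *m ctrmx (v j)).

(* A singular value decomposition always exists, so the default 0 is never
   used; the choice of decomposition is immaterial if s (r - 1) > s r. *)
Definition rank_proj (p q r : nat) (A : 'M[F]_(p, q)) : 'M[F]_(p, q) :=
  xget 0 [set B | is_rank_proj r A B].

Definition is_mp_inverse (p q : nat) (A : 'M[F]_(p, q)) (X : 'M[F]_(q, p)) :
    Prop :=
  [/\ A *m X *m A = A,
      X *m A *m X = X,
      ctrmx (A *m X) = A *m X
    & ctrmx (X *m A) = X *m A].

(* The Moore-Penrose inverse exists and is unique, so the default 0 is never
   used. *)
Definition mp_inverse (p q : nat) (A : 'M[F]_(p, q)) : 'M[F]_(q, p) :=
  xget 0 [set X | is_mp_inverse A X].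

End MatrixDecompositions.

Section Zeros.
Variables (F : numFieldType) (m n : nat).
Variables (D : set 'rV[F]_m) (f : 'rV[F]_m -> 'rV[F]_n).

Definition zeros : set 'rV[F]_m := [set x | D x /\ f x = 0].

Record local_param (x : 'rV[F]_m) (k : nat) (L : set 'rV[F]_k)
    (phi : 'rV[F]_k -> 'rV[F]_m) (z : 'rV[F]_k) : Prop := {
  local_param_gt0 : (0 < k)%N;
  local_param_open : open L;
  local_param_connected : connected L;
  local_param_differentiable : differentiable_on L phi;
  local_param_inj : {in L &, injective phi};
  local_param_base : L z;
  local_param_val : phi z = x;
  local_param_rank : \rank (jac phi z) = k;
  local_param_image : exists U : set 'rV[F]_m,
    [/\ open U, U x, U `<=` D & U `&` zeros = phi @` L]
}.

(* The dimension is only partially defined, hence a relation. *)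
Definition zero_dim (x : 'rV[F]_m) (k : nat) : Prop :=
  (k = 0%N /\ isolated zeros x) \/ exists L phi z, @local_param x k L phi z.

Definition semiregular_zero (x : 'rV[F]_m) : Prop :=
  zeros x /\ exists2 k, zero_dim x k & (k + \rank (jac f x))%N = m.

Inductive same_branch : 'rV[F]_m -> 'rV[F]_m -> Prop :=
| same_branch_local x y k (L L0 : set 'rV[F]_k) phi z :
    local_param x L phi z ->
    open L0 -> L0 z -> L0 `<=` L ->
    (forall w, L0 w -> \rank (jac phi w) = k) ->
    (phi @` L0) y -> same_branch x y
| same_branch_isolated x : isolated zeros x -> same_branch x x
| same_branch_trans x y w :
    same_branch x y -> same_branch y w -> same_branch x w.

End Zeros.

(* Main.v *)
(* Write J for the Jacobian at the zero a = x_* and P for a generalized inverse of it. The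
   map G x = x - a + (f x - (x - a) J) P is invertible near a, since f is strictly
   differentiable at a, and it sends zeros of f into ker J. If a is semiregular, its branch is
   parametrized by an open set of the same dimension as ker J, so G sends the branch onto
   a neighborhood of 0 in ker J: near a the zeros of f are exactly the points G^-1 y with y
   in ker J. For x near a, comparing x with the zero w = G^-1 (G x (1 - J P)) gives an h = x - w
   controlled by its image under J, while the truncation of the Jacobian at x is close to
   J; so if the truncated Newton step at x vanishes, then h = 0.

   Strict differentiability comes from the mean value inequality over R, and from Cauchy's
   estimate, hence Goursat's theorem, over C. A local parametrization is only assumed
   differentiable; over R, that it covers a neighborhood is a topological fact
   (Poincare-Miranda), proved by counting mod 2 on a cubical grid. *)
From HB Require Import structures.
Require Import Defs.
From mathcomp Require Import all_boot all_order all_algebra.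
From mathcomp Require Import all_classical all_reals.
From mathcomp Require Import topology normedtype derive.
From mathcomp Require Import complex spectral interval_inference landau.
From mathcomp Require Import sequences measure lebesgue_measure lebesgue_integral ftc.
From mathcomp Require Import exp trigo ring lra.

Set Implicit Arguments.
Unset Strict Implicit.
Unset Printing Implicit Defensive.

Import Order.TTheory GRing.Theory Num.Theory.
Import numFieldNormedType.Exports.

Local Open Scope classical_set_scope.
Local Open Scope ring_scope.

(** * Scalars, norms and derivatives *)

Section Scalars.
Variables (R : realType) (K : rc_kind).
Local Notation F := (rc_scalar R K).

(** One direction of the equivalence is immediate, since [f] vanishes at a zero. The work lies in
    the other one, and in showing that every zero near [a] is semiregular and on the branch of [a].
    The given parametrization is known to have full rank only at its base point, so it serves a
    single purpose: its straightened image covers a neighborhood of 0 in ker J. A second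
    parametrization, the restriction of G^-1 to ker J, has full rank at every point; it is the chart
    for all nearby zeros at once. The truncation A_r of a Jacobian A depends on a choice of singular
    vectors, and no continuity of it in [x] is available. It enters only through the orthogonal
    projector Q = A_r A_r^+ onto its range: A_r^+ f = 0 gives Q f = 0, while Q A = A_r, the entries
    of Q are bounded, and A - A_r is bounded by a multiple of A - J because J has rank r. All
    estimates are made with real-valued norms, so that one argument covers both fields. *)

Definition rc_emb : R -> F :=
  match K as K0 return R -> rc_scalar R K0 with
  | RealScalars => id
  | ComplexScalars => fun x => (x%:C)%C
  end.

(** The norm of a complex number is again an element of [R[i]]; [rn] is the same modulus with values
    in [R], where linear arithmetic applies. *)
Definition rn : F -> R :=
  match K as K0 return rc_scalar R K0 -> R with
  | RealScalars => fun x => `|x|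
  | ComplexScalars => fun x : R[i] => complex.Re `|x|
  end.

Lemma rc_emb_zmod : zmod_morphism rc_emb.
Proof. by rewrite /rc_emb; case: K => x y //=; rewrite rmorphB. Qed.

Lemma rc_emb_monoid : monoid_morphism rc_emb.
Proof.
rewrite /rc_emb; case: K; split=> //= x y; exact: rmorphM.
Qed.

HB.instance Definition _ := GRing.isZmodMorphism.Build R F rc_emb rc_emb_zmod.
HB.instance Definition _ := GRing.isMonoidMorphism.Build R F rc_emb rc_emb_monoid.

Lemma rc_conj_zmod : zmod_morphism (@rc_conj R K).
Proof. by rewrite /rc_conj; case: K => x y //=; rewrite rmorphB. Qed.

Lemma rc_conj_monoid : monoid_morphism (@rc_conj R K).
Proof.
rewrite /rc_conj; case: K; split=> //= [|x y]; [exact: rmorph1|exact: rmorphM].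
Qed.

HB.instance Definition _ :=
  GRing.isZmodMorphism.Build F F (@rc_conj R K) rc_conj_zmod.
HB.instance Definition _ :=
  GRing.isMonoidMorphism.Build F F (@rc_conj R K) rc_conj_monoid.

Lemma normr_emb (x : F) : `|x| = rc_emb (rn x).
Proof. by move: x; rewrite /rc_emb /rn; case: K. Qed.

Lemma ler_emb (a b : R) : (rc_emb a <= rc_emb b) = (a <= b).
Proof. by rewrite /rc_emb; case: K => //=; rewrite lecR. Qed.

Lemma ltr_emb (a b : R) : (rc_emb a < rc_emb b) = (a < b).
Proof. by rewrite /rc_emb; case: K => //=; rewrite ltcR. Qed.

Lemma rc_emb_inj : injective rc_emb.
Proof. by rewrite /rc_emb; case: K => // x y []. Qed.

Lemma rn_ge0 (x : F) : 0 <= rn x.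
Proof. by rewrite -ler_emb -normr_emb rmorph0. Qed.

Lemma rnM (x y : F) : rn (x * y) = rn x * rn y.
Proof. by apply: rc_emb_inj; rewrite -normr_emb normrM rmorphM /= -!normr_emb. Qed.

Lemma rnD (x y : F) : rn (x + y) <= rn x + rn y.
Proof. by rewrite -ler_emb rmorphD /= -!normr_emb ler_normD. Qed.

Lemma rnN (x : F) : rn (- x) = rn x.
Proof. by apply: rc_emb_inj; rewrite -!normr_emb normrN. Qed.

Lemma rn0 : rn 0 = 0.
Proof. by apply: rc_emb_inj; rewrite -!normr_emb normr0 rmorph0. Qed.

Lemma rn1 : rn 1 = 1.
Proof. by apply: rc_emb_inj; rewrite -!normr_emb normr1 rmorph1. Qed.

Lemma rn_eq0 (x : F) : (rn x == 0) = (x == 0).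
Proof. by rewrite -(inj_eq rc_emb_inj) -normr_emb rmorph0 normr_eq0. Qed.

Lemma rn_emb (a : R) : rn (rc_emb a) = `|a|.
Proof.
apply: rc_emb_inj; rewrite -normr_emb; move: a; rewrite /rc_emb; case: K => //= a.
by rewrite normc_def /= expr0n addr0 sqrtr_sqr.
Qed.

Lemma ge0_emb (x : F) : 0 <= x -> x = rc_emb (rn x).
Proof. by move=> x0; rewrite -normr_emb ger0_norm. Qed.

Lemma gt0_emb (x : F) : 0 < x -> exists2 a : R, 0 < a & x = rc_emb a.
Proof.
move=> x0; exists (rn x); last exact: ge0_emb (ltW x0).
by rewrite -ltr_emb -(ge0_emb (ltW x0)) rmorph0.
Qed.

Lemma rc_conjK : involutive (@rc_conj R K).
Proof. by rewrite /rc_conj; case: K => //= x; rewrite conjCK. Qed.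

Lemma rc_conj_emb (a : R) : rc_conj (rc_emb a) = rc_emb a.
Proof.
rewrite /rc_conj /rc_emb; case: K => //=.
by rewrite conj_Creal // complex_real.
Qed.

Lemma mul_rc_conj (x : F) : x * rc_conj x = rc_emb (rn x ^+ 2).
Proof.
rewrite rmorphXn /= -normr_emb; move: x; rewrite /rc_conj; case: K => //= x.
  by rewrite real_normK ?num_real.
by rewrite normCK.
Qed.

Lemma rn_conj (x : F) : rn (rc_conj x) = rn x.
Proof.
apply/eqP; rewrite -(eqrXn2 (n := 2)) ?rn_ge0 //; apply/eqP/rc_emb_inj.
by rewrite -!mul_rc_conj rc_conjK mulrC.
Qed.

(* The entrywise l1 norm: unlike the library's sup norm, it is submultiplicative, and it
   has real values also over [R[i]]. *)
Definition vn (p q : nat) (A : 'M[F]_(p, q)) : R := \sum_i \sum_j rn (A i j).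

Lemma vn_ge0 p q (A : 'M[F]_(p, q)) : 0 <= vn A.
Proof. by do 2![apply: sumr_ge0 => ? _]; exact: rn_ge0. Qed.

Lemma rn_le_vn p q (A : 'M[F]_(p, q)) i j : rn (A i j) <= vn A.
Proof.
rewrite /vn (bigD1 i) //= (bigD1 j) //= -addrA lerDl.
by apply: addr_ge0; do ?[apply: sumr_ge0 => ? _]; exact: rn_ge0.
Qed.

Lemma vn_le p q (A : 'M[F]_(p, q)) (e : R) : (forall i j, rn (A i j) <= e) ->
  vn A <= (p * q)%:R * e.
Proof.
move=> Ae; apply: (@le_trans _ _ (\sum_(i < p) \sum_(j < q) e)).
  by do 2![apply: ler_sum => ? _].
by rewrite !sumr_const !card_ord -mulrnA mulnC mulr_natl.
Qed.

Lemma vn0 p q : vn (0 : 'M[F]_(p, q)) = 0.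
Proof. by rewrite /vn big1 // => i _; rewrite big1 // => j _; rewrite mxE rn0. Qed.

Lemma vn0_eq0 p q (A : 'M[F]_(p, q)) : vn A <= 0 -> A = 0.
Proof.
move=> A0; apply/matrixP => i j; rewrite mxE; apply/eqP; rewrite -rn_eq0.
by rewrite eq_le rn_ge0 andbT (le_trans (rn_le_vn _ _ _)).
Qed.

Lemma vnD p q (A B : 'M[F]_(p, q)) : vn (A + B) <= vn A + vn B.
Proof.
rewrite /vn -big_split /=; apply: ler_sum => i _.
by rewrite -big_split /=; apply: ler_sum => j _; rewrite mxE rnD.
Qed.

Lemma vnN p q (A : 'M[F]_(p, q)) : vn (- A) = vn A.
Proof. by apply: eq_bigr => i _; apply: eq_bigr => j _; rewrite mxE rnN. Qed.

Lemma vnB p q (A B : 'M[F]_(p, q)) : vn (A - B) <= vn A + vn B.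
Proof. by rewrite -(vnN B) vnD. Qed.

Lemma vn_distC p q (A B : 'M[F]_(p, q)) : vn (A - B) = vn (B - A).
Proof. by rewrite -vnN opprB. Qed.

Lemma vn_dist_trans p q (B A C : 'M[F]_(p, q)) :
  vn (A - C) <= vn (A - B) + vn (B - C).
Proof. by rewrite -{1}(subrK B A) -addrA vnD. Qed.

Lemma vnZ p q a (A : 'M[F]_(p, q)) : vn (a *: A) = rn a * vn A.
Proof.
rewrite /vn mulr_sumr; apply: eq_bigr => i _; rewrite mulr_sumr.
by apply: eq_bigr => j _; rewrite mxE rnM.
Qed.

Lemma rn_sum (I : Type) (r : seq I) (P : pred I) (E : I -> F) :
  rn (\sum_(i <- r | P i) E i) <= \sum_(i <- r | P i) rn (E i).
Proof.
elim/big_rec2: _ => [|i y x _ xy]; first by rewrite rn0.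
by rewrite (le_trans (rnD _ _)) // lerD2l.
Qed.

Lemma vn_sum p q (I : Type) (r : seq I) (P : pred I) (E : I -> 'M[F]_(p, q)) :
  vn (\sum_(i <- r | P i) E i) <= \sum_(i <- r | P i) vn (E i).
Proof.
elim/big_rec2: _ => [|i y x _ xy]; first by rewrite vn0.
by rewrite (le_trans (vnD _ _)) // lerD2l.
Qed.

Lemma vnM p q l (A : 'M[F]_(p, q)) (B : 'M[F]_(q, l)) :
  vn (A *m B) <= vn A * vn B.
Proof.
rewrite /vn mulr_suml; apply: ler_sum => i _.
apply: (@le_trans _ _ (\sum_j \sum_t rn (A i t) * rn (B t j))).
  apply: ler_sum => j _; rewrite mxE (le_trans (rn_sum _ _ _)) //.
  by apply: ler_sum => t _; rewrite rnM.
rewrite exchange_big /= mulr_suml; apply: ler_sum => t _.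
rewrite -mulr_sumr ler_wpM2l ?rn_ge0 //.
rewrite [leRHS](bigD1 t) //= lerDl.
by do 2![apply: sumr_ge0 => ? _]; exact: rn_ge0.
Qed.

Lemma vn_tr p q (A : 'M[F]_(p, q)) : vn A^T = vn A.
Proof.
rewrite /vn exchange_big; apply: eq_bigr => i _; apply: eq_bigr => j _.
by rewrite mxE.
Qed.

End Scalars.

Section Bridge.
Variables (R : realType) (K : rc_kind).
Local Notation F := (rc_scalar R K).

Lemma mx_norm_le_vn p q (A : 'M[F]_(p, q)) : `|A| <= rc_emb K (vn A).
Proof.
rewrite /Num.norm /= mx_normE.
have -> : rc_emb K (vn A) = `|rc_emb K (vn A)|%:nng%:num :> F.
  by rewrite /= ger0_norm // -(rmorph0 (rc_emb K)) ler_emb vn_ge0.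
rewrite num_le; apply/bigmax_leP; split=> /=.
  by rewrite -num_le /= normr_ge0.
move=> i _; rewrite -num_le /=.
rewrite [leRHS]ger0_norm; last by rewrite -(rmorph0 (rc_emb K)) ler_emb vn_ge0.
by rewrite normr_emb ler_emb rn_le_vn.
Qed.

Lemma entry_le_mx_norm p q (A : 'M[F]_(p, q)) i j : rc_emb K (rn (A i j)) <= `|A|.
Proof.
rewrite -normr_emb {2}/Num.norm /= mx_normE.
have -> : `|A i j| = `|A i j|%:nng%:num by [].
rewrite num_le; exact: (@le_bigmax _ _ _ _ (fun k : 'I_p * 'I_q => `|A k.1 k.2|%:nng) (i, j)).
Qed.

Lemma vn_le_mx_norm p q (A : 'M[F]_(p, q)) :
  vn A <= (p * q)%:R * @rn R K `|A|.
Proof.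
apply: vn_le => i j; rewrite -(ler_emb K); apply: le_trans (entry_le_mx_norm _ _ _) _.
by rewrite -ge0_emb.
Qed.

Lemma nbhs_vnP p q (x : 'M[F]_(p, q)) (A : set 'M[F]_(p, q)) :
  nbhs x A <-> exists2 e : R, 0 < e & forall y, vn (y - x) < e -> A y.
Proof.
split.
  move=> /nbhs_normP [e /= /gt0_emb [a a0 ->]] xA; exists a => // y xy.
  apply: xA => /=; rewrite distrC (le_lt_trans (mx_norm_le_vn _)) //.
  by rewrite ltr_emb.
move=> [e e0 xA]; apply: (iffRL (nbhs_normP x A)).
(* The successor keeps the divisor positive for empty matrices. *)
have pq0 : 0 < (p * q).+1%:R :> R by [].
exists (rc_emb K (e / (p * q).+1%:R)).
  by rewrite /= -(rmorph0 (rc_emb K)) ltr_emb divr_gt0.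
move=> y /=; rewrite distrC => xy; apply: xA.
rewrite (le_lt_trans (vn_le_mx_norm _)) //.
have : @rn R K `|y - x| < e / (p * q).+1%:R by rewrite -(ltr_emb K) -ge0_emb.
rewrite ltr_pdivlMr // => h; apply: le_lt_trans h; rewrite mulrC.
by rewrite ler_wpM2l ?rn_ge0 // ler_nat.
Qed.

Lemma open_vnP p q (A : set 'M[F]_(p, q)) : open A <->
  forall x, A x -> exists2 e : R, 0 < e & forall y, vn (y - x) < e -> A y.
Proof.
by rewrite openE; split=> Ao x Ax; apply/nbhs_vnP; exact: Ao.
Qed.

Lemma continuous_vnP p q p' q' (f : 'M[F]_(p, q) -> 'M[F]_(p', q')) x :
  {for x, continuous f} <-> forall e : R, 0 < e -> exists2 d : R, 0 < d &
    forall y, vn (y - x) < d -> vn (f y - f x) < e.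
Proof.
split=> [fx e e0|fx A].
  apply/nbhs_vnP; apply: (fx (fun y => vn (y - f x) < e)).
  by apply/nbhs_vnP; exists e.
move=> /nbhs_vnP [e e0 eA]; apply/nbhs_vnP; have [d d0 dA] := fx e e0.
by exists d => // y /dA /eA.
Qed.

(** Frechet differentiability with the candidate derivative as a parameter. [J] acts on rows from
    the right, so it is the transpose of [jac], and the chain rule multiplies from left to right. *)
Definition diff_at (m n : nat) (f : 'rV[F]_m -> 'rV[F]_n) (x : 'rV[F]_m)
    (J : 'M[F]_(m, n)) : Prop :=
  forall e : R, 0 < e -> exists2 d : R, 0 < d & forall y, vn (y - x) < d ->
    vn (f y - f x - (y - x) *m J) <= e * vn (y - x).

Lemma mulmx_continuous m n (J : 'M[F]_(m, n)) :
  continuous (fun v : 'rV[F]_m => v *m J).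
Proof.
move=> x; apply/continuous_vnP => e e0; have J0 := vn_ge0 J.
have J1 : 0 < vn J + 1 by rewrite ltr_wpDl.
exists (e / (vn J + 1)); first by rewrite divr_gt0.
move=> y xy; rewrite -mulmxBl (le_lt_trans (vnM _ _)) //.
rewrite ltr_pdivlMr // in xy; apply: le_lt_trans xy.
by rewrite ler_wpM2l ?vn_ge0 // lerDl.
Qed.

Lemma differentiable_diff_at m n (f : 'rV[F]_m -> 'rV[F]_n) x :
  differentiable f x -> diff_at f x ('J f x).
Proof.
move=> fx e e0; have [_ /eqaddoP h] := (diff_locallyP _ _).1 fx.
pose e' := rc_emb K (e / ((1 * n)%:R + 1)).
have N0 : 0 < (1 * n)%:R + 1 :> R by apply: ltr_wpDl.
have e'0 : 0 < e' by rewrite -(rmorph0 (rc_emb K)) ltr_emb divr_gt0.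
have /nbhs_vnP [d d0 hd] := h e' e'0.
exists d => // y xy; have /= := hd (y - x).
rewrite subr0 => /(_ xy); rewrite !fctE /= subrK.
rewrite -[in X in X -> _](mul_rV_lin1 ('d f x)) -/('J f x).
rewrite opprD addrA => H.
apply: le_trans (vn_le_mx_norm _) _.
have H1 : @rn R K `|f y - f x - (y - x) *m 'J f x| <=
     e / ((1 * n)%:R + 1) * vn (y - x).
  rewrite -(ler_emb K) rmorphM -ge0_emb //; apply: le_trans H _.
  by rewrite ler_wpM2l // ?(ltW e'0) // mx_norm_le_vn.
apply: le_trans (ler_wpM2l _ H1) _ => //.
rewrite mulrA ler_wpM2r ?vn_ge0 // mulrA ler_pdivrMr // mulrC ler_wpM2l ?(ltW e0) //.
by rewrite lerDl.
Qed.

Lemma lin1_mxE m n (J : 'M[F]_(m, n)) : lin1_mx (mulmxr J) = J.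
Proof. by apply/row_matrixP => i; rewrite rowE mul_rV_lin1 /= -rowE. Qed.

Lemma diff_at_differentiable m n (f : 'rV[F]_m -> 'rV[F]_n) x J :
  diff_at f x J -> differentiable f x /\ 'J f x = J.
Proof.
move=> fJ.
have H : f \o shift x = cst (f x) + (mulmxr J : 'rV[F]_m -> 'rV[F]_n) +o_ (0 : 'rV[F]_m) id.
  apply/eqaddoP => _ /gt0_emb [e e0 ->].
  apply/nbhs_vnP.
  pose e' := e / ((1 * m)%:R + 1).
  have N0 : 0 < (1 * m)%:R + 1 :> R by apply: ltr_wpDl.
  have e'0 : 0 < e' by rewrite divr_gt0.
  have [d d0 hd] := fJ e' e'0; exists d => // h; rewrite subr0 => hd'.
  have := hd (h + x); rewrite addrK => /(_ hd') H.
  rewrite !fctE /= opprD addrA (le_trans (mx_norm_le_vn _)) //.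
  rewrite [X in _ * X](@ge0_emb R K) // -rmorphM ler_emb (le_trans H) //.
  rewrite (le_trans (ler_wpM2l (ltW e'0) (vn_le_mx_norm _))) // mulrA.
  rewrite ler_wpM2r ?rn_ge0 // /e' mulrAC ler_pdivrMr // ler_wpM2l ?(ltW e0) //.
  by rewrite lerDl.
have Jc : continuous (mulmxr J : {linear 'rV[F]_m -> 'rV[F]_n}).
  exact: mulmx_continuous.
have dE := diff_unique Jc H.
split.
  apply/diff_locallyP; rewrite dE; split => //.
by rewrite /jacobian -[RHS]lin1_mxE; congr lin1_mx; rewrite dE.
Qed.

End Bridge.

(** * Completeness and the contraction principle *)

Section Geometric.
Variable R : realType.
Implicit Types a : nat -> R.

Lemma half_expr_gt0 n : 0 < 2^-1 ^+ n :> R.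
Proof. by rewrite exprn_gt0. Qed.

Lemma half_expr_small (C e : R) : 0 < e -> exists n, C * 2^-1 ^+ n < e.
Proof.
move=> e0; have [C0|C0] := leP C 0.
  by exists 0%N; rewrite expr0 mulr1 (le_lt_trans C0).
exists (Num.bound (C / e)); set n := Num.bound _.
have Hn : C / e < n%:R by apply: archi_boundP; rewrite divr_ge0 ?ltW.
rewrite exprVn ltr_pdivrMr ?exprn_gt0 //.
rewrite ltr_pdivrMr // mulrC in Hn; apply: lt_le_trans Hn _.
by rewrite ler_wpM2l ?ltW // -natrX ltr_nat ltn_expl.
Qed.

Lemma le0_half_expr (x C : R) : (forall n, x <= C * 2^-1 ^+ n) -> x <= 0.
Proof.
move=> xC; rewrite leNgt; apply/negP => x0.
have [n] := half_expr_small C x0.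
by rewrite ltNge xC.
Qed.

(** The intervals of radius [2 * c * 2^-1 ^+ n] around the [a n] meet pairwise, so the supremum of
    their left ends lies in all of them. *)
Lemma geometric_cvg a c : (forall n, `|a n.+1 - a n| <= c * 2^-1 ^+ n) ->
  exists l, forall n, `|a n - l| <= 2 * c * 2^-1 ^+ n.
Proof.
move=> ac; pose h n : R := 2^-1 ^+ n.
have c0 : 0 <= c by have := ac 0%N; rewrite expr0 mulr1; apply: le_trans.
have tel n k : `|a (n + k)%N - a n| <= 2 * c * (h n - h (n + k)%N).
  elim: k => [|k IH]; first by rewrite addn0 !subrr normr0 mulr0.
  rewrite addnS; have := ac (n + k)%N; rewrite -/(h _).
  have -> : h (n + k)%N = 2 * h (n + k).+1.
    by rewrite /h exprS mulrA divff ?mul1r.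
  have := ler_normD (a (n + k).+1 - a (n + k)%N) (a (n + k)%N - a n).
  rewrite addrA subrK => h1 h2; apply: le_trans h1 _.
  move: IH; have -> : h (n + k)%N = 2 * h (n + k).+1.
    by rewrite /h exprS mulrA divff ?mul1r.
  move=> IH; apply: le_trans (lerD h2 IH) _.
  by rewrite le_eqVlt; apply/orP; left; apply/eqP; ring.
have h0 n : 0 < h n by exact: half_expr_gt0.
have tel' n k : `|a (n + k)%N - a n| <= 2 * c * h n.
  apply: le_trans (tel n k) _; rewrite ler_wpM2l ?mulr_ge0 //.
  by rewrite lerBlDr lerDl ltW.
have cross i j : a i - 2 * c * h i <= a j + 2 * c * h j.
  have ci : 0 <= 2 * c * h i by rewrite !mulr_ge0 // ltW.
  have cj : 0 <= 2 * c * h j by rewrite !mulr_ge0 // ltW.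
  have [ij|ij] := leqP i j.
    have := tel' i (j - i)%N; rewrite subnKC // ler_norml => /andP[]; lra.
  have := tel' j (i - j)%N; rewrite subnKC ?(ltnW ij) // ler_norml => /andP[]; lra.
pose E := [set a n - 2 * c * h n | n in [set: nat]].
have E0 : E !=set0 by exists (a 0%N - 2 * c * h 0%N); exists 0%N.
have Eub j : ubound E (a j + 2 * c * h j) by move=> _ [i _ <-]; exact: cross.
have Es : has_sup E by split => //; exists (a 0%N + 2 * c * h 0%N); exact: Eub.
exists (sup E) => n; rewrite ler_norml.
have h1 : sup E <= a n + 2 * c * h n by exact: ge_sup.
have h2 : a n - 2 * c * h n <= sup E by apply: ub_le_sup; [case: Es|exists n].
by rewrite -/(h n); apply/andP; split; lra.
Qed.
End Geometric.

Section Complete.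
Variables (R : realType) (K : rc_kind).
Local Notation F := (rc_scalar R K).

Lemma rc_geometric_cvg (a : nat -> F) (c : R) :
  (forall n, rn (a n.+1 - a n) <= c * 2^-1 ^+ n) ->
  exists l, forall n, rn (a n - l) <= 4 * c * 2^-1 ^+ n.
Proof.
rewrite /rn; move: a; case: K => /= a ac.
  have [l al] := geometric_cvg ac; exists l => n; apply: le_trans (al n) _.
  have c0 : 0 <= c by have := ac 0%N; rewrite expr0 mulr1; apply: le_trans.
  by rewrite ler_wpM2r ?(ltW (half_expr_gt0 _ _)) // ler_wpM2r // ler_nat.
have nE (z : R[i]) : ComplexField.Normc.normc z =
    Num.sqrt (complex.Re z ^+ 2 + complex.Im z ^+ 2) by case: z.
have ReN (z : R[i]) : `|complex.Re z| <= Num.sqrt (complex.Re z ^+ 2 + complex.Im z ^+ 2).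
  by rewrite -sqrtr_sqr ler_wsqrtr // lerDl sqr_ge0.
have ImN (z : R[i]) : `|complex.Im z| <= Num.sqrt (complex.Re z ^+ 2 + complex.Im z ^+ 2).
  by rewrite -sqrtr_sqr ler_wsqrtr // lerDr sqr_ge0.
have N2 (x y : R) : Num.sqrt (x ^+ 2 + y ^+ 2) <= `|x| + `|y|.
  rewrite -(ler_pXn2r (n := 2)) ?nnegrE ?sqrtr_ge0 ?addr_ge0 //.
  rewrite sqr_sqrtr ?addr_ge0 ?sqr_ge0 // sqrrD !real_normK ?num_real //.
  by rewrite -addrA lerD2l lerDr mulrn_wge0 ?mulr_ge0.
have ac' n : Num.sqrt (complex.Re (a n.+1 - a n) ^+ 2 +
   complex.Im (a n.+1 - a n) ^+ 2) <= c * 2^-1 ^+ n.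
  by rewrite -nE.
have [l1 al1] : exists l, forall n, `|complex.Re (a n) - l| <= 2 * c * 2^-1 ^+ n.
  apply: geometric_cvg => n; apply: le_trans (ac' n); apply: le_trans (ReN _).
  by rewrite raddfB.
have [l2 al2] : exists l, forall n, `|complex.Im (a n) - l| <= 2 * c * 2^-1 ^+ n.
  apply: geometric_cvg => n; apply: le_trans (ac' n); apply: le_trans (ImN _).
  by rewrite raddfB.
exists (Complex l1 l2) => n; rewrite nE.
apply: le_trans (N2 _ _) _.
have -> : complex.Re (a n - Complex l1 l2) = complex.Re (a n) - l1 by rewrite raddfB.
have -> : complex.Im (a n - Complex l1 l2) = complex.Im (a n) - l2 by rewrite raddfB.
have := al1 n; have := al2 n; lra.
Qed.

Lemma mx_geometric_cvg p q (a : nat -> 'M[F]_(p, q)) (c : R) :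
  (forall n, vn (a n.+1 - a n) <= c * 2^-1 ^+ n) ->
  exists C l, forall n, vn (a n - l) <= C * 2^-1 ^+ n.
Proof.
move=> ac.
have /choice [l al] : forall i, exists li : 'I_q -> F,
    forall j n, rn (a n i j - li j) <= 4 * c * 2^-1 ^+ n.
  move=> i; suff /choice [l al] : forall j, exists l : F,
    forall n, rn (a n i j - l) <= 4 * c * 2^-1 ^+ n by exists l.
  move=> j.
  apply: rc_geometric_cvg => n; apply: le_trans (ac n).
  by have := rn_le_vn (a n.+1 - a n) i j; rewrite !mxE.
exists ((p * q)%:R * (4 * c)), (\matrix_(i, j) l i j) => n.
by rewrite -mulrA; apply: vn_le => i j; rewrite !mxE.
Qed.

(** Picard iteration for x = a + y - e x, started at [a]. The n-th step has length at most
    [vn y * 2^-1 ^+ n], so the iterates stay within [2 * vn y] of [a]; hence the bound [rho / 2] on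
    [y]. *)
Lemma contraction_surj m (a : 'rV[F]_m) (e : 'rV[F]_m -> 'rV[F]_m) (rho : R) y :
  (forall x x', vn (x - a) < rho -> vn (x' - a) < rho ->
     vn (e x - e x') <= 2^-1 * vn (x - x')) ->
  e a = 0 -> vn y < rho / 2 ->
  exists2 x, vn (x - a) < rho & x - a + e x = y.
Proof.
move=> eL ea yr; have y0 := vn_ge0 y.
have rho0 : 0 < rho by have := le_lt_trans y0 yr; rewrite divr_gt0 //; lra.
pose u := fix u n := if n is n'.+1 then a + y - e (u n') else a.
have uS n : u n.+1 = a + y - e (u n) by [].
have H n : vn (u n - a) <= 2 * vn y * (1 - 2^-1 ^+ n) /\
    vn (u n.+1 - u n) <= vn y * 2^-1 ^+ n.
  elim: n => [|n [IH1 IH2]].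
    rewrite uS /= ea subr0 subrr vn0 expr0 subrr mulr0 mulr1; split => //.
    by rewrite addrAC subrr add0r.
  have q0 := half_expr_gt0 R n.
  have qS : 2^-1 ^+ n = 2 * 2^-1 ^+ n.+1 :> R by rewrite exprS mulrA divff ?mul1r.
  have bnd k : 2 * vn y * (1 - 2^-1 ^+ k) < rho.
    have := half_expr_gt0 R k; set z := 2^-1 ^+ k; nra.
  have IH1' : vn (u n.+1 - a) <= 2 * vn y * (1 - 2^-1 ^+ n.+1).
    have := vn_dist_trans (u n) (u n.+1) a; nra.
  split => //.
  have -> : u n.+2 - u n.+1 = e (u n) - e (u n.+1).
    by rewrite (uS n.+1) {1}(uS n) opprB addrC addrA subrK.
  apply: le_trans (eL _ _ _ _) _.
  - exact: le_lt_trans IH1 (bnd _).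
  - exact: le_lt_trans IH1' (bnd _).
  - by rewrite vn_distC; nra.
have [C [l ul]] := mx_geometric_cvg (fun n => (H n).2).
have la : vn (l - a) <= 2 * vn y.
  rewrite -subr_le0; apply: (@le0_half_expr _ _ C) => n.
  have := vn_dist_trans (u n) l a; rewrite (vn_distC l (u n)).
  have := (H n).1; have := ul n; have := half_expr_gt0 R n.
  set z := 2^-1 ^+ n; nra.
have lr : vn (l - a) < rho by lra.
exists l => //; apply/subr0_eq/vn0_eq0.
apply: (@le0_half_expr _ _ (2 * C)) => n.
have un : vn (u n - a) < rho.
  apply: le_lt_trans (H n).1 _; have := half_expr_gt0 R n; set z := 2^-1 ^+ n; nra.
have -> : l - a + e l - y = (l - u n.+1) + (e l - e (u n)).
  rewrite uS opprB; apply/rowP => i; rewrite !mxE; ring.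
apply: le_trans (vnD _ _) _; have := eL _ _ lr un.
rewrite (vn_distC l (u n)) (vn_distC l (u n.+1)); have := ul n; have := ul n.+1.
rewrite exprS; have := half_expr_gt0 R n; set z := 2^-1 ^+ n.
have := vn_ge0 (u n.+1 - l); nra.
Qed.

Lemma emb_scale_continuous p q (v : 'M[F]_(p, q)) :
  continuous (fun t : R => rc_emb K t *: v).
Proof.
move=> t A /nbhs_vnP [e e0 eA].
have v1 : 0 < vn v + 1 by rewrite ltr_wpDl ?vn_ge0.
apply/nbhs_normP; exists (e / (vn v + 1)); first by rewrite /= divr_gt0.
move=> s /=; rewrite distrC ltr_pdivlMr // => ts; apply: eA.
rewrite -scalerBl -rmorphB vnZ rn_emb; apply: le_lt_trans ts.
by rewrite ler_wpM2l // lerDl.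
Qed.

(** Balls serve as parameter domains, which must be connected. A ball is the union of the segments
    from 0 to its points. *)
Lemma connected_vn_ball p q (d : R) : connected [set z : 'M[F]_(p, q) | vn z < d].
Proof.
have [d0|d0] := leP d 0.
  have -> : [set z : 'M[F]_(p, q) | vn z < d] = set0.
    apply/seteqP; split => // z /= zd; have := vn_ge0 z; lra.
  exact: connected0.
have -> : [set z : 'M[F]_(p, q) | vn z < d] =
    \bigcup_(z in [set z | vn z < d]) ((fun t : R => rc_emb K t *: z) @` `[0, 1]).
  apply/seteqP; split => [z zd|_ [z /= zd [t /= /[!in_itv]/= /andP[t0 t1] <-]]].
    exists z => //; exists 1; last by rewrite rmorph1 scale1r.
    by rewrite /= in_itv /= ler01 lexx.
  rewrite /= vnZ rn_emb ger0_norm //; apply: le_lt_trans zd.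
  by rewrite ler_piMl ?vn_ge0.
apply: bigcup_connected.
  exists 0 => z zd; exists 0; last by rewrite rmorph0 scale0r.
  by rewrite /= in_itv /= ler01 lexx.
move=> z zd; apply: connected_continuous_connected; first exact: segment_connected.
by apply: continuous_subspaceT; exact: emb_scale_continuous.
Qed.

End Complete.

(** * Singular values and truncation *)

Lemma scalar_mx0 (F : fieldType) n : (0%:M : 'M[F]_n) = 0.
Proof. exact: raddf0. Qed.

Section ConjTranspose.
Variables (R : realType) (K : rc_kind).
Local Notation F := (rc_scalar R K).

Lemma ctrmxK p q (A : 'M[F]_(p, q)) : ctrmx (ctrmx A) = A.
Proof. by apply/matrixP => i j; rewrite !mxE rc_conjK. Qed.

Lemma ctrmxM p q l (A : 'M[F]_(p, q)) (B : 'M[F]_(q, l)) :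
  ctrmx (A *m B) = ctrmx B *m ctrmx A.
Proof. by rewrite /ctrmx trmx_mul map_mxM. Qed.

Lemma ctrmx_sum p q (I : Type) (r : seq I) (P : pred I) (E : I -> 'M[F]_(p, q)) :
  ctrmx (\sum_(i <- r | P i) E i) = \sum_(i <- r | P i) ctrmx (E i).
Proof. by rewrite /ctrmx !raddf_sum. Qed.

Lemma ctrmxZ p q a (A : 'M[F]_(p, q)) : ctrmx (a *: A) = rc_conj a *: ctrmx A.
Proof. by apply/matrixP => i j; rewrite !mxE rmorphM. Qed.

Lemma ctrmxZ_emb p q (a : R) (A : 'M[F]_(p, q)) :
  ctrmx (rc_emb K a *: A) = rc_emb K a *: ctrmx A.
Proof. by rewrite ctrmxZ rc_conj_emb. Qed.

Lemma ctrmx_scalar n a : ctrmx (a%:M : 'M[F]_n) = (rc_conj a)%:M.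
Proof. by rewrite /ctrmx tr_scalar_mx map_scalar_mx. Qed.

Lemma vn_ctrmx p q (A : 'M[F]_(p, q)) : vn (ctrmx A) = vn A.
Proof.
rewrite -vn_tr; apply: eq_bigr => i _; apply: eq_bigr => j _.
by rewrite !mxE rn_conj.
Qed.

(** The squared Euclidean norm: orthonormality refers to it and not to [vn]. *)
Definition nsq p (v : 'cV[F]_p) : R := \sum_i rn (v i 0) ^+ 2.

Lemma nsq_ge0 p (v : 'cV[F]_p) : 0 <= nsq v.
Proof. by apply: sumr_ge0 => i _; rewrite sqr_ge0. Qed.

Lemma nsq_eq0 p (v : 'cV[F]_p) : nsq v = 0 -> v = 0.
Proof.
move=> /eqP; rewrite psumr_eq0 => [/allP v0|i _]; last exact: sqr_ge0.
apply/colP => i; apply/eqP; rewrite mxE -rn_eq0 -sqrf_eq0.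
exact: implyP (v0 i (mem_index_enum _)) isT.
Qed.

Lemma ctrmx_mul_self p (v : 'cV[F]_p) : ctrmx v *m v = (rc_emb K (nsq v))%:M.
Proof.
apply/matrixP => i j; rewrite !ord1 !mxE mulr1n rmorph_sum /=.
by apply: eq_bigr => k _; rewrite !mxE mulrC mul_rc_conj.
Qed.

Lemma scalar_mx1_inj : injective (fun a : F => a%:M : 'M[F]_1).
Proof. by move=> a b /matrixP /(_ 0 0); rewrite !mxE !mulr1n. Qed.

Lemma nsq_ctrmx_mul p (v : 'cV[F]_p) a : ctrmx v *m v = (rc_emb K a)%:M -> nsq v = a.
Proof. by rewrite ctrmx_mul_self => /scalar_mx1_inj /rc_emb_inj. Qed.

Lemma normalize_cV p (v : 'cV[F]_p) : v != 0 ->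
  exists c : R, c != 0 /\
    ctrmx (rc_emb K c *: v) *m (rc_emb K c *: v) = 1%:M.
Proof.
move=> v0; have n0 : 0 < nsq v.
  by rewrite lt_neqAle nsq_ge0 andbT eq_sym; apply: contra v0 => /eqP /nsq_eq0 ->.
exists (Num.sqrt (nsq v))^-1; split; first by rewrite invr_neq0 // gt_eqF ?sqrtr_gt0.
rewrite ctrmxZ_emb -scalemxAl -scalemxAr ctrmx_mul_self scalerA scale_scalar_mx.
rewrite -!rmorphM /= -expr2 exprVn sqr_sqrtr ?nsq_ge0 // mulVf ?gt_eqF //.
by rewrite rmorph1.
Qed.

Definition orthonormal_upto p t (u : nat -> 'cV[F]_p) := forall i j,
  (i < t)%N -> (j < t)%N -> ctrmx (u i) *m u j = ((i == j)%:R)%:M.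

Lemma orthonormal_ext p t (u : nat -> 'cV[F]_p) x :
  orthonormal_upto t u -> ctrmx x *m x = 1%:M ->
  (forall i, (i < t)%N -> ctrmx (u i) *m x = 0) ->
  orthonormal_upto t.+1 (fun i => if i == t then x else u i).
Proof.
move=> uo xx ux i j; rewrite !ltnS => it jt.
have [ei|ni] := eqVneq i t; have [ej|nj] := eqVneq j t.
- by rewrite xx ei ej eqxx.
- have jt' : (j < t)%N by rewrite ltn_neqAle nj.
  rewrite ei eq_sym (negPf nj); apply: (can_inj (@ctrmxK _ _)).
  by rewrite ctrmxM ctrmxK ux // ctrmx_scalar rmorph0 scalar_mx0.
- have it' : (i < t)%N by rewrite ltn_neqAle ni.
  by rewrite ej (negPf ni) ux // scalar_mx0.
- by rewrite uo // ltn_neqAle ?ni ?nj.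
Qed.

Lemma orthogonal_unit p t (u : nat -> 'cV[F]_p) : (t < p)%N ->
  exists2 x : 'cV[F]_p, ctrmx x *m x = 1%:M &
    forall i, (i < t)%N -> ctrmx (u i) *m x = 0.
Proof.
move=> tp; pose C : 'M[F]_(p, t) := \matrix_(i, j) rc_conj (u j i 0).
have k0 : kermx C != 0.
  by rewrite -mxrank_eq0 mxrank_ker -lt0n subn_gt0 (leq_ltn_trans (rank_leq_col _)).
have /rowV0Pn [w wC w0] := k0; have {}wC := sub_kermxP wC.
have wT0 : w^T != 0 by rewrite trmx_eq0.
have [c [c0 cw]] := normalize_cV wT0.
exists (rc_emb K c *: w^T) => // i it; rewrite -scalemxAr.
have -> : ctrmx (u i) *m w^T = 0; last by rewrite scaler0.
apply/matrixP => a b; rewrite !ord1 !mxE.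
have /matrixP /(_ 0 (Ordinal it)) := wC; rewrite !mxE => e; rewrite -[RHS]e.
by apply: eq_bigr => k _; rewrite !mxE mulrC.
Qed.

(** For a square matrix, U^* U = 1 implies U U^* = 1. *)
Lemma orthonormal_basis_sum p (u : nat -> 'cV[F]_p) : orthonormal_upto p u ->
  \sum_(j < p) u j *m ctrmx (u j) = 1%:M.
Proof.
move=> uo; pose U : 'M[F]_p := \matrix_(i, j) u j i 0.
have UU : ctrmx U *m U = 1%:M.
  apply/matrixP => i j; have /matrixP /(_ 0 0) := uo i j (ltn_ord i) (ltn_ord j).
  rewrite !mxE mulr1n => <-.
  by apply: eq_bigr => k _; rewrite !mxE.
rewrite -(mulmx1C UU); apply/matrixP => i j; rewrite summxE !mxE.
by apply: eq_bigr => k _; rewrite !mxE big_ord1 !mxE.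
Qed.

End ConjTranspose.

Section Eigen.
Variable R : realType.

(** [M] is the matrix of [H] on the invariant subspace spanned by the rows of [B]. It has an
    eigenvalue because the complex numbers are algebraically closed; this is real because y^* H y
    equals its own conjugate transpose. *)
Lemma hermitian_eigen_complex d n (H : 'M[R[i]]_n) (B : 'M[R[i]]_(d, n)) M :
  (0 < d)%N -> @ctrmx R ComplexScalars _ _ H = H -> row_free B ->
  B *m H^T = M *m B -> exists a : R, eigenvalue M (a%:C)%C.
Proof.
move=> d0 hH Bf BH; have [a Ma] := eigenvalue_closed M d0.
have [v vM v0] := eigenvalueP Ma.
pose y : 'cV[R[i]]_n := (v *m B)^T.
have y0 : y != 0 by rewrite trmx_eq0 mulmx_free_eq0.
have Hy : H *m y = a *: y.
  apply: trmx_inj; rewrite trmx_mul trmxK -mulmxA BH mulmxA vM linearZ /= trmxK.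
  by rewrite scalemxAl.
have h1 : @ctrmx R ComplexScalars _ _ y *m (H *m y) =
   a *: (rc_emb ComplexScalars (@nsq R ComplexScalars _ y))%:M.
  by rewrite Hy -scalemxAr (@ctrmx_mul_self R ComplexScalars).
have h2 : @ctrmx R ComplexScalars _ _ (@ctrmx R ComplexScalars _ _ y *m (H *m y)) =
    @ctrmx R ComplexScalars _ _ y *m (H *m y).
  by rewrite !(@ctrmxM R ComplexScalars) (@ctrmxK R ComplexScalars) hH mulmxA.
have ar : @rc_conj R ComplexScalars a = a.
  move: h2; rewrite h1 (@ctrmxZ R ComplexScalars) (@ctrmx_scalar R ComplexScalars).
  rewrite rc_conj_emb !scale_scalar_mx => /(@scalar_mx1_inj R ComplexScalars) /mulIf; apply.
  rewrite -(rmorph0 (@rc_emb R ComplexScalars)) (inj_eq (@rc_emb_inj R ComplexScalars)).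
  by apply: contra y0 => /eqP /(@nsq_eq0 R ComplexScalars) ->.
exists (complex.Re a); rewrite RRe_real //.
by apply/CrealP; exact: ar.
Qed.

(** Over the reals, pass to complex matrices: the eigenvalue found there is real, hence already a
    root of the real characteristic polynomial. *)
Lemma hermitian_eigen (K : rc_kind) d n (H : 'M[rc_scalar R K]_n)
    (B : 'M[rc_scalar R K]_(d, n)) M :
  (0 < d)%N -> ctrmx H = H -> row_free B ->
  B *m H^T = M *m B -> exists a : R, eigenvalue M (rc_emb K a).
Proof.
move: H B M; case: K => /= H B M d0 hH Bf BH; last exact: hermitian_eigen_complex BH.
pose f := real_complex R.
have [|||a] := @hermitian_eigen_complex d n (map_mx f H) (map_mx f B) (map_mx f M) d0.
- apply/matrixP => i j; rewrite !mxE.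
  have /matrixP /(_ i j) := hH; rewrite !mxE /= => ->.
  exact: (@rc_conj_emb R ComplexScalars).
- by rewrite row_free_map.
- by rewrite map_trmx -!map_mxM BH.
rewrite eigenvalue_root_char -map_char_poly /= fmorph_root -eigenvalue_root_char => Ma.
by exists a.
Qed.

End Eigen.

Section SVD.
Variables (R : realType) (K : rc_kind).
Local Notation F := (rc_scalar R K).

(** The next eigenvector is sought in the orthogonal complement of the previous ones, which is
    invariant because [H] is Hermitian. The left kernel of [C] is this complement, written in
    rows. *)
Lemma hermitian_eigenbasis n (H : 'M[F]_n) t : ctrmx H = H -> (t <= n)%N ->
  exists (w : nat -> 'cV[F]_n) (lam : nat -> R), orthonormal_upto t w /\
    forall i, (i < t)%N -> H *m w i = rc_emb K (lam i) *: w i.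
Proof.
move=> hH; elim: t => [|t IH] tn; first by exists (fun=> 0), (fun=> 0); split.
have [w [lam [wo wl]]] := IH (ltnW tn).
pose C : 'M[F]_(n, t) := \matrix_(i, j) rc_conj (w j i 0).
pose B := row_base (kermx C).
have d0 : (0 < \rank (kermx C))%N.
  by rewrite mxrank_ker subn_gt0 (leq_ltn_trans (rank_leq_col _)).
have Cx (x : 'rV[F]_n) : (x <= kermx C)%MS <->
    forall i, (i < t)%N -> ctrmx (w i) *m x^T = 0.
  split=> [/sub_kermxP xC i it|wx].
    apply/matrixP => a b; rewrite !ord1 !mxE.
    have /matrixP /(_ 0 (Ordinal it)) := xC; rewrite !mxE => e; rewrite -[RHS]e.
    by apply: eq_bigr => k _; rewrite !mxE mulrC.
  apply/sub_kermxP; apply/rowP => j; have /matrixP /(_ 0 0) := wx j (ltn_ord j).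
  rewrite !mxE => e; rewrite -[RHS]e.
  by apply: eq_bigr => k _; rewrite !mxE mulrC.
have BH : (B *m H^T <= B)%MS.
  rewrite eq_row_base; apply/row_subP => i; rewrite row_mul.
  have := row_sub i B; rewrite eq_row_base => /Cx wB.
  apply/Cx => j jt; rewrite trmx_mul trmxK mulmxA.
  have -> : ctrmx (w j) *m H = rc_emb K (lam j) *: ctrmx (w j).
    by rewrite -{1}hH -ctrmxM wl // ctrmxZ_emb.
  by rewrite -scalemxAl wB // scaler0.
have [M BM] := submxP BH.
have [a Ma] := hermitian_eigen d0 hH (row_base_free _) BM.
have [v vM v0] := eigenvalueP Ma.
have y0 : (v *m B)^T != 0 by rewrite trmx_eq0 mulmx_free_eq0 ?row_base_free.
have [c [c0 cy]] := normalize_cV y0.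
have wy i : (i < t)%N -> ctrmx (w i) *m (rc_emb K c *: (v *m B)^T) = 0.
  have /Cx wvB : (v *m B <= kermx C)%MS by rewrite mulmx_sub // eq_row_base.
  by move=> it; rewrite -scalemxAr wvB // scaler0.
exists (fun i => if i == t then rc_emb K c *: (v *m B)^T else w i),
  (fun i => if i == t then a else lam i); split; first exact: orthonormal_ext.
move=> i; rewrite ltnS leq_eqVlt => /orP[/eqP ->|it].
  rewrite eqxx -scalemxAr; have -> : H *m (v *m B)^T = rc_emb K a *: (v *m B)^T.
    apply: trmx_inj; rewrite trmx_mul trmxK -mulmxA BM mulmxA vM linearZ /= trmxK.
    by rewrite scalemxAl.
  by rewrite !scalerA mulrC.
by rewrite (ltn_eqF it) wl.
Qed.

Lemma sorted_eigenbasis n (H : 'M[F]_n) : ctrmx H = H ->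
  exists (w : nat -> 'cV[F]_n) (lam : nat -> R), [/\ orthonormal_upto n w,
    (forall i, (i < n)%N -> H *m w i = rc_emb K (lam i) *: w i) &
    forall i j, (i <= j)%N -> (j < n)%N -> lam j <= lam i].
Proof.
move=> hH; have [w [lam [wo wl]]] := hermitian_eigenbasis hH (leqnn n).
pose ge i j := lam j <= lam i.
pose sq := sort ge (iota 0 n); pose s := nth 0%N sq.
have szs : size sq = n by rewrite size_sort size_iota.
have sn i : (i < n)%N -> (s i < n)%N.
  move=> it; have : s i \in sq by rewrite mem_nth ?szs.
  by rewrite mem_sort mem_iota.
exists (fun i => w (s i)), (fun i => lam (s i)); split.
- move=> i j it jt; rewrite wo ?sn // nth_uniq ?szs //.
  by rewrite sort_uniq iota_uniq.
- by move=> i it; rewrite wl ?sn.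
- move=> i j ij jn; apply: (@sorted_leq_nth _ ge) => //.
  + by move=> a b c; rewrite /ge => h1 h2; apply: le_trans h2 h1.
  + by move=> a; rewrite /ge.
  + by apply: sort_sorted => a b; rewrite /ge; exact: le_total.
  + by rewrite inE szs (leq_ltn_trans ij).
  + by rewrite inE szs.
Qed.

(** The eigenvectors of A^* A, by decreasing eigenvalue, are the right singular vectors; the left
    ones are the normalized images [A *m w i], as long as these do not vanish. *)
Lemma svd_exists p q (A : 'M[F]_(p, q)) : exists s u v, is_svd A s u v.
Proof.
have hH : ctrmx (ctrmx A *m A) = ctrmx A *m A by rewrite ctrmxM ctrmxK.
have [w [lam [wo wl lamd]]] := sorted_eigenbasis hH.
have AwAw i j : (i < q)%N -> (j < q)%N ->
    ctrmx (A *m w i) *m (A *m w j) = (rc_emb K (lam j) * (i == j)%:R)%:M.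
  move=> iq jq; rewrite ctrmxM -mulmxA (mulmxA _ A) wl // -scalemxAr wo //.
  by rewrite scale_scalar_mx.
have lamE i : (i < q)%N -> nsq (A *m w i) = lam i.
  by move=> iq; apply: nsq_ctrmx_mul; rewrite AwAw // eqxx mulr1.
have lam0 i : (i < q)%N -> 0 <= lam i by move=> /lamE <-; exact: nsq_ge0.
pose sg i := Num.sqrt (lam i).
have sgsg i : (i < q)%N -> sg i * sg i = lam i by move=> iq; rewrite -expr2 sqr_sqrtr ?lam0.
have H t : (t <= minn p q)%N -> exists u : nat -> 'cV[F]_p, orthonormal_upto t u /\
    forall i, (i < t)%N -> A *m w i = rc_emb K (sg i) *: u i.
  elim: t => [|t IH] tn; first by exists (fun=> 0); split.
  have [u [uo uA]] := IH (ltnW tn).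
  have tp : (t < p)%N by apply: leq_trans tn (geq_minl _ _).
  have tq : (t < q)%N by apply: leq_trans tn (geq_minr _ _).
  suff [x [xx ux Ax]] : exists x, [/\ ctrmx x *m x = 1%:M,
      (forall i, (i < t)%N -> ctrmx (u i) *m x = 0) & A *m w t = rc_emb K (sg t) *: x].
    exists (fun i => if i == t then x else u i); split; first exact: orthonormal_ext.
    move=> i; rewrite ltnS leq_eqVlt => /orP[/eqP ->|it]; first by rewrite eqxx.
    by rewrite (ltn_eqF it) uA.
  (* For a vanishing singular value, any unit vector orthogonal to the previous ones will do. *)
  have [lt0|lt0] := eqVneq (lam t) 0.
    have [x xx ux] := orthogonal_unit u tp; exists x; split => //.
    rewrite /sg lt0 sqrtr0 rmorph0 scale0r; apply: nsq_eq0.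
    by rewrite lamE.
  have sgt i : (i <= t)%N -> sg i != 0.
    move=> it; rewrite gt_eqF // sqrtr_gt0; apply: lt_le_trans (lamd _ _ it tq).
    by rewrite lt_neqAle lam0 // eq_sym lt0.
  exists (rc_emb K (sg t)^-1 *: (A *m w t)); split.
  - rewrite ctrmxZ_emb -scalemxAl -scalemxAr AwAw // eqxx mulr1 scalerA scale_scalar_mx.
    rewrite -!rmorphM /= -sgsg // mulrA mulfVK ?sgt // mulVf ?sgt //.
    by rewrite rmorph1.
  - move=> i it; have iq := ltn_trans it tq.
    have -> : u i = rc_emb K (sg i)^-1 *: (A *m w i).
      rewrite uA // scalerA -rmorphM /= mulVf ?sgt ?(ltnW it) //.
      by rewrite rmorph1 scale1r.
    rewrite ctrmxZ_emb -scalemxAl -scalemxAr AwAw // (ltn_eqF it) mulr0 scalar_mx0.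
    by rewrite !scaler0.
  - by rewrite scalerA -rmorphM /= divff ?sgt // rmorph1 scale1r.
have [u [uo uA]] := H _ (leqnn _).
(* This concerns only p < q. If [lam i] were nonzero, so would be the earlier eigenvalues, and the p
   left singular vectors would form a basis of multiples of the [A *m w j]. But [A *m w i] is
   orthogonal to all of these, hence 0. *)
have Aw0 i : (minn p q <= i)%N -> (i < q)%N -> A *m w i = 0.
  move=> mi iq; apply: nsq_eq0; rewrite lamE //; apply/eqP/negPn/negP => li0.
  have pq : minn p q = p.
    by apply/minn_idPl; rewrite leqNgt; apply/negP => qp;
       move: mi; rewrite (minn_idPr (ltnW qp)) leqNgt iq.
  rewrite pq in mi uo uA.
  have sgj j : (j < p)%N -> sg j != 0.
    move=> jp; rewrite gt_eqF // sqrtr_gt0.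
    apply: lt_le_trans (lamd _ _ (leq_trans (ltnW jp) mi) iq).
    by rewrite lt_neqAle lam0 // eq_sym li0.
  have : A *m w i = 0.
    rewrite -[LHS]mul1mx -(orthonormal_basis_sum uo) mulmx_suml big1 // => j _.
    have jp := ltn_ord j; have ji := leq_trans jp mi.
    have -> : ctrmx (u j) = rc_emb K (sg j)^-1 *: ctrmx (A *m w j).
      rewrite uA // ctrmxZ_emb scalerA -rmorphM /= mulVf ?sgj //.
      by rewrite rmorph1 scale1r.
    rewrite -mulmxA -scalemxAl AwAw // ?(ltn_trans ji) // (ltn_eqF ji) mulr0 scalar_mx0.
    by rewrite scaler0 mulmx0.
  move=> /(congr1 (@nsq _ _ _)); rewrite lamE // => lamz.
  by move: li0; rewrite lamz /nsq big1 ?eqxx // => k _; rewrite mxE rn0 expr0n.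
pose s j := if (j < minn p q)%N then rc_emb K (sg j) else 0.
have ps (x : R) : (0 <= rc_emb K x) = (0 <= x) by rewrite -(ler_emb K) rmorph0.
exists s, u, w; split.
- by move=> j; rewrite /s; case: ifP => // _; rewrite ps sqrtr_ge0.
- move=> i j ij; rewrite /s; case: ifP => jm; last first.
    by case: ifP => // _; rewrite ps sqrtr_ge0.
  rewrite (leq_ltn_trans ij jm) ler_emb ler_wsqrtr // lamd //.
  by apply: leq_trans jm (geq_minr _ _).
- by move=> j; rewrite /s ltnNge => ->.
- exact: uo.
- move=> i j im jm; apply: wo; [apply: leq_trans im _|apply: leq_trans jm _]; exact: geq_minr.
- rewrite -[LHS]mulmx1 -(orthonormal_basis_sum wo) mulmx_sumr.
  rewrite (big_ord_widen_cond q (fun=> true) (fun j => s j *: (u j *m ctrmx (w j)))) ?geq_minr //.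
  rewrite [LHS](bigID (fun j : 'I_q => (j < minn p q)%N)) /= [X in _ + X]big1 ?addr0.
    by apply: eq_bigr => j jm; rewrite mulmxA uA // -scalemxAl /s jm.
  by move=> j; rewrite -leqNgt => jm; rewrite mulmxA Aw0 // mul0mx.
Qed.

(** Orthonormality of the inner vectors collapses the double sum. Partial sums of a singular value
    decomposition, their adjoints and their inverses are all multiplied this way. *)
Lemma orthonormal_sum_mul N p l q (v : nat -> 'cV[F]_p) (P1 P2 : pred 'I_N)
    (a b : nat -> F) (x : nat -> 'cV[F]_q) (y : nat -> 'rV[F]_l) :
  orthonormal_upto N v ->
  (\sum_(j < N | P1 j) a j *: (x j *m ctrmx (v j))) *m
    (\sum_(i < N | P2 i) b i *: (v i *m y i)) =
  \sum_(j < N | P1 j && P2 j) (a j * b j) *: (x j *m y j).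
Proof.
move=> vo; rewrite mulmx_suml big_mkcondr /=; apply: eq_bigr => j _.
rewrite mulmx_sumr.
have E (i : 'I_N) : a j *: (x j *m ctrmx (v j)) *m (b i *: (v i *m y i)) =
    ((i == j)%:R * (a j * b i)) *: (x j *m y i).
  rewrite -scalemxAl -scalemxAr scalerA -mulmxA (mulmxA (ctrmx _)) vo //.
  by rewrite mul_scalar_mx -scalemxAr scalerA mulrC eq_sym.
under eq_bigr do rewrite E.
rewrite big_mkcond /= (bigD1 j) //= big1 ?addr0.
  by rewrite eqxx mul1r.
by move=> i /negPf ->; rewrite mul0r scale0r if_same.
Qed.

End SVD.

Section RankProj.
Variables (R : realType) (K : rc_kind).
Local Notation F := (rc_scalar R K).

(** The witness inverts the singular values one by one; with the convention that 0 has inverse 0, it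
    is correct also when some of the first r vanish. *)
Lemma mp_inverseP p q r (A : 'M[F]_(p, q)) (s : nat -> F) u v :
  (r <= minn p q)%N -> is_svd A s u v ->
  is_mp_inverse (\sum_(j < r) s j *: (u j *m ctrmx (v j)))
    (mp_inverse (\sum_(j < r) s j *: (u j *m ctrmx (v j)))).
Proof.
move=> rN sv; rewrite /mp_inverse.
set B := \sum_(j < r) _; set N := minn p q in rN *.
suff : is_mp_inverse B (\sum_(j < N | (j < r)%N) (s j)^-1 *: (v j *m ctrmx (u j))).
  by move=> h; exact: (xgetPex 0 (ex_intro (is_mp_inverse B) _ h)).
have sJ j : rc_conj (s j) = s j by rewrite (ge0_emb (svd_ge0 sv j)) rc_conj_emb.
have sVJ j : rc_conj (s j)^-1 = (s j)^-1 by rewrite fmorphV /= sJ.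
have uo : orthonormal_upto N u := svd_left_orthonormal sv.
have vo : orthonormal_upto N v := svd_right_orthonormal sv.
have BE : B = \sum_(j < N | (j < r)%N) s j *: (u j *m ctrmx (v j)).
  exact: (big_ord_widen_cond N (fun=> true) (fun j => s j *: (u j *m ctrmx (v j)))).
set X := \sum_(j < N | _) _.
have BX : B *m X = \sum_(j < N | (j < r)%N) (s j * (s j)^-1) *: (u j *m ctrmx (u j)).
  rewrite BE.
  apply: etrans (orthonormal_sum_mul (fun j : 'I_N => (j < r)%N)
    (fun j : 'I_N => (j < r)%N) s (fun j => (s j)^-1) u (fun j => ctrmx (u j)) vo) _.
  by apply: eq_bigl => j; rewrite andbb.
have XB : X *m B = \sum_(j < N | (j < r)%N) ((s j)^-1 * s j) *: (v j *m ctrmx (v j)).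
  rewrite BE.
  apply: etrans (orthonormal_sum_mul (fun j : 'I_N => (j < r)%N)
    (fun j : 'I_N => (j < r)%N) (fun j => (s j)^-1) s v (fun j => ctrmx (v j)) uo) _.
  by apply: eq_bigl => j; rewrite andbb.
split.
- rewrite BX BE.
  apply: etrans (orthonormal_sum_mul (fun j : 'I_N => (j < r)%N)
    (fun j : 'I_N => (j < r)%N) (fun j => s j * (s j)^-1) s u (fun j => ctrmx (v j)) uo) _.
  apply: eq_big => [j|j _]; rewrite ?andbb //.
  have [->|s0] := eqVneq (s j) 0; first by rewrite !mul0r.
  by rewrite divff // mul1r.
- rewrite XB.
  apply: etrans (orthonormal_sum_mul (fun j : 'I_N => (j < r)%N)
    (fun j : 'I_N => (j < r)%N) (fun j => (s j)^-1 * s j) (fun j => (s j)^-1) v (fun j => ctrmx (u j)) vo) _.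
  apply: eq_big => [j|j _]; rewrite ?andbb //.
  have [->|s0] := eqVneq (s j) 0; first by rewrite mulr0 mul0r invr0.
  by rewrite mulVf // mul1r.
- rewrite BX ctrmx_sum; apply: eq_bigr => j _.
  by rewrite ctrmxZ rmorphM /= sJ sVJ ctrmxM ctrmxK.
- rewrite XB ctrmx_sum; apply: eq_bigr => j _.
  by rewrite ctrmxZ rmorphM /= sJ sVJ ctrmxM ctrmxK.
Qed.

Lemma rank_projP p q r (A : 'M[F]_(p, q)) : is_rank_proj r A (rank_proj r A).
Proof.
rewrite /rank_proj; have [s [u [v sv]]] := svd_exists A.
suff : is_rank_proj r A (\sum_(j < r) s j *: (u j *m ctrmx (v j))).
  by move=> h; exact: (xgetPex 0 (ex_intro (is_rank_proj r A) _ h)).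
by exists s, u, v.
Qed.

Lemma unit_entry_le1 p (u : 'cV[F]_p) : ctrmx u *m u = 1%:M -> vn u <= p%:R.
Proof.
rewrite -(rmorph1 (rc_emb K)) => /nsq_ctrmx_mul u1.
suff -> : p%:R = (p * 1)%:R * 1 :> R; last by rewrite muln1 mulr1.
apply: vn_le => i j; rewrite !ord1.
rewrite -(expr_le1 (n := 2)) ?rn_ge0 // -u1 /nsq (bigD1 i) //= lerDl.
by apply: sumr_ge0 => k _; rewrite sqr_ge0.
Qed.

(** The diagonal of P = P^* P reads P_jj = sum over k of |P_kj|^2. Hence |P_jj|^2 <= P_jj, so P_jj
    <= 1, and then each entry has modulus at most 1. *)
Lemma hermitian_idempotent_vn p (P : 'M[F]_p) :
  ctrmx P = P -> P *m P = P -> vn P <= (p * p)%:R.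
Proof.
move=> hP PP; rewrite -[leRHS]mulr1; apply: vn_le => i j.
have Pjj : P j j = rc_emb K (\sum_k rn (P k j) ^+ 2).
  rewrite -[LHS](congr1 (fun M : 'M[F]_p => M j j) PP) -{1}hP !mxE rmorph_sum /=.
  by apply: eq_bigr => k _; rewrite !mxE mulrC mul_rc_conj.
have Pkj k : rn (P k j) ^+ 2 <= rn (P j j).
  rewrite Pjj rn_emb ger0_norm; last by apply: sumr_ge0 => ? _; rewrite sqr_ge0.
  by rewrite (bigD1 k) //= lerDl; apply: sumr_ge0 => ? _; rewrite sqr_ge0.
have := Pkj i; have := Pkj j; have := rn_ge0 (P i j); have := rn_ge0 (P j j).
move: (rn (P j j)) (rn (P i j)) => a b {hP PP Pjj Pkj} h1 h2 h3 h4.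
have a1 : a <= 1 by rewrite leNgt; apply/negP => ?; nra.
by rewrite leNgt; apply/negP => ?; nra.
Qed.

(** One half of the Eckart-Young theorem, with a crude constant. The span of the first r + 1 right
    singular vectors is too large to avoid the kernel of [J0]; on a common nonzero vector [x], [A]
    and [A - J0] agree. *)
Lemma singular_value_le (p q r : nat) (A J0 : 'M[F]_(p, q)) (s : nat -> F) u v :
  \rank J0 = r -> (r < minn p q)%N -> is_svd A s u v ->
  rn (s r) <= p%:R * (r.+1%:R * q%:R) * vn (A - J0).
Proof.
move=> rJ rN sv; pose V : 'M[F]_(q, r.+1) := \matrix_(i, j) v j i 0.
have lN j : (j <= r)%N -> (j < minn p q)%N by move=> jr; apply: leq_ltn_trans rN.
have : kermx (J0 *m V)^T != 0.
  rewrite -mxrank_eq0 mxrank_ker mxrank_tr -lt0n subn_gt0 ltnS.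
  by apply: leq_trans (mxrankM_maxl _ _) _; rewrite rJ.
move=> /rowV0Pn [c /sub_kermxP cJ c0].
have Jc : J0 *m (V *m c^T) = 0.
  by apply: trmx_inj; rewrite mulmxA trmx_mul trmxK cJ trmx0.
set x := V *m c^T in Jc.
have xE : x = \sum_(i < r.+1) c 0 i *: v i.
  apply/colP => k; rewrite !mxE summxE; apply: eq_bigr => i _.
  by rewrite !mxE mulrC.
(* Testing against [u j] isolates [s j * c 0 j]. The largest coefficient of [x] also bounds the size
   of [x], so it cancels from the estimate. *)
have [j _ jmax] := @arg_maxP _ _ _ (ord0 : 'I_r.+1) predT (fun i => rn (c 0 i)) isT.
have cj0 : 0 < rn (c 0 j).
  rewrite lt_neqAle rn_ge0 andbT eq_sym; apply: contra c0 => /eqP cj0.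
  apply/eqP/rowP => i; apply/eqP; rewrite mxE -rn_eq0 eq_le rn_ge0 andbT -cj0.
  exact: jmax.
have jN := lN j (ltn_ord j : (j <= r)%N).
have uo := svd_left_orthonormal sv; have vo := svd_right_orthonormal sv.
have uAv (i : 'I_r.+1) : ctrmx (u j) *m A *m v i = (s j * (i == j)%:R)%:M.
  rewrite {1}(svd_sum sv) mulmx_sumr mulmx_suml.
  rewrite (bigD1 (Ordinal jN)) //= big1 ?addr0.
    rewrite -scalemxAr mulmxA uo // eqxx mul1mx -scalemxAl vo ?lN ?leq_ord //.
    by rewrite scale_scalar_mx eq_sym.
  move=> k kj; rewrite -scalemxAr mulmxA uo // eq_sym.
  by rewrite (_ : (_ == _) = false) ?scalar_mx0 ?mul0mx ?scaler0 ?mul0mx //; apply: negbTE.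
have uAx : ctrmx (u j) *m (A - J0) *m x = (s j * c 0 j)%:M.
  rewrite mulmxBr mulmxBl -(mulmxA _ J0) Jc mulmx0 subr0 xE mulmx_sumr.
  rewrite (bigD1 j) //= big1 ?addr0.
    by rewrite -scalemxAr uAv eqxx mulr1 scale_scalar_mx mulrC.
  by move=> i /negPf ij; rewrite -scalemxAr uAv ij mulr0 scalar_mx0 scaler0.
have vx : vn x <= r.+1%:R * q%:R * rn (c 0 j).
  rewrite xE; apply: le_trans (vn_sum _ _ _) _.
  apply: (@le_trans _ _ (\sum_(i < r.+1) q%:R * rn (c 0 j))).
    apply: ler_sum => i _; rewrite vnZ mulrC; apply: ler_pM; rewrite ?vn_ge0 ?rn_ge0 //.
      by apply: unit_entry_le1; rewrite vo ?eqxx // lN // leq_ord.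
    exact: jmax.
  by rewrite sumr_const card_ord -[leLHS]mulr_natl mulrA.
have ujn : vn (u j) <= p%:R by apply: unit_entry_le1; rewrite uo // eqxx.
have : rn (s j * c 0 j) <= p%:R * vn (A - J0) * (r.+1%:R * q%:R * rn (c 0 j)).
  have -> : rn (s j * c 0 j) = vn ((s j * c 0 j)%:M : 'M[F]_1).
    by rewrite /vn !big_ord1 mxE mulr1n.
  rewrite -uAx; apply: le_trans (vnM _ _) _.
  apply: ler_pM; rewrite ?vn_ge0 //.
  apply: le_trans (vnM _ _) _; rewrite vn_ctrmx.
  by apply: ler_wpM2r; rewrite ?vn_ge0.
rewrite rnM => H.
have sj : rn (s j) <= p%:R * vn (A - J0) * (r.+1%:R * q%:R).
  by rewrite -(ler_pM2r cj0); apply: le_trans H _; rewrite !mulrA.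
have srj : rn (s r) <= rn (s j).
  rewrite -(ler_emb K) -!ge0_emb ?(svd_ge0 sv) //; apply: (svd_nonincreasing sv).
  exact: leq_ord.
by apply: le_trans srj _; rewrite mulrAC.
Qed.

(** All that is drawn from the truncation, valid for any choice of singular vectors. The left
    singular vectors of the kept part are orthogonal to those of the tail, so [P] kills the tail;
    the tail is bounded by [s r], hence by the distance from [A] to the rank r matrix [J0]. *)
Lemma rank_proj_approx (p q r : nat) (J0 : 'M[F]_(p, q)) : \rank J0 = r ->
  exists2 C : R, 0 <= C & forall A : 'M[F]_(p, q),
    let P := rank_proj r A *m mp_inverse (rank_proj r A) in
    [/\ P *m A = rank_proj r A, vn P <= C &
        vn (A - rank_proj r A) <= C * vn (A - J0)].
Proof.
move=> rJ; pose N := minn p q.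
have rN : (r <= N)%N by rewrite -rJ leq_min rank_leq_row rank_leq_col.
pose C1 : R := N%:R * (p%:R * q%:R) * (p%:R * (r.+1%:R * q%:R)).
have C10 : 0 <= C1 by rewrite !mulr_ge0.
exists ((p * p)%:R + C1); first by rewrite addr_ge0.
move=> A P; have [s [u [v [sv AE]]]] := rank_projP r A.
set B := rank_proj r A in P AE *.
have [BXB _ hP _] : is_mp_inverse B (mp_inverse B).
  by rewrite AE; exact: (mp_inverseP rN sv).
rewrite -/P in BXB hP.
have uo : orthonormal_upto N u := svd_left_orthonormal sv.
have vo : orthonormal_upto N v := svd_right_orthonormal sv.
have BE : B = \sum_(j < N | (j < r)%N) s j *: (u j *m ctrmx (v j)).
  rewrite AE.
  exact: (big_ord_widen_cond N (fun=> true) (fun j => s j *: (u j *m ctrmx (v j)))).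
have AB : A - B = \sum_(j < N | ~~ (j < r)%N) s j *: (u j *m ctrmx (v j)).
  rewrite {1}(svd_sum sv) (bigID (fun j : 'I_N => (j < r)%N)) /= -BE.
  by rewrite addrAC subrr add0r.
have BAB : ctrmx B *m (A - B) = 0.
  rewrite AB BE ctrmx_sum.
  have -> : \sum_(j < N | (j < r)%N) ctrmx (s j *: (u j *m ctrmx (v j))) =
      \sum_(j < N | (j < r)%N) rc_conj (s j) *: (v j *m ctrmx (u j)).
    by apply: eq_bigr => j _; rewrite ctrmxZ ctrmxM ctrmxK.
  apply: etrans (orthonormal_sum_mul (fun j : 'I_N => (j < r)%N)
    (fun j : 'I_N => ~~ (j < r)%N) (fun j => rc_conj (s j)) s v (fun j => ctrmx (v j)) uo) _.
  by rewrite big_pred0 // => j; rewrite andbN.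
split.
- have -> : A = B + (A - B) by rewrite addrC subrK.
  rewrite mulmxDr BXB -[P in P *m (_ - _)]hP ctrmxM -mulmxA BAB mulmx0 addr0.
  by [].
- apply: le_trans (_ : (p * p)%:R <= _); last by rewrite lerDl.
  by apply: hermitian_idempotent_vn => //; rewrite mulmxA BXB.
- apply: le_trans (_ : C1 * vn (A - J0) <= _); last first.
    by rewrite ler_wpM2r ?vn_ge0 // lerDr.
  have [rN'|rN'] := ltnP r N; last first.
    rewrite AB big_pred0 => [|j]; first by rewrite vn0 mulr_ge0 ?vn_ge0.
    by rewrite (leq_trans (ltn_ord j) rN').
  rewrite AB; apply: le_trans (vn_sum _ _ _) _.
  apply: (@le_trans _ _ (\sum_(j < N) rn (s r) * (p%:R * q%:R))); last first.
    rewrite sumr_const card_ord -[leLHS]mulr_natl (mulrC (rn _)) /C1 -!mulrA.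
    have := singular_value_le rJ rN' sv; rewrite -!mulrA => H.
    by do 3!apply: ler_wpM2l => //.
  rewrite big_mkcond /=; apply: ler_sum => j _; case: ifP => jr; last first.
    by rewrite !mulr_ge0 ?rn_ge0.
  rewrite -leqNgt in jr; rewrite vnZ; apply: ler_pM; rewrite ?rn_ge0 ?vn_ge0 //.
    by rewrite -(ler_emb K) -!ge0_emb ?(svd_ge0 sv) //; apply: (svd_nonincreasing sv).
  apply: le_trans (vnM _ _) _; rewrite vn_ctrmx; apply: ler_pM; rewrite ?vn_ge0 //.
    by apply: unit_entry_le1; rewrite uo // eqxx.
  by apply: unit_entry_le1; rewrite vo // eqxx.
Qed.

End RankProj.

(** * Strict differentiability *)

Section DiffAt.
Variables (R : realType) (K : rc_kind).
Local Notation F := (rc_scalar R K).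

Lemma diff_at_unique m n (f : 'rV[F]_m -> 'rV[F]_n) x J J' :
  diff_at f x J -> diff_at f x J' -> J = J'.
Proof.
by move=> /diff_at_differentiable [_ <-] /diff_at_differentiable [_ <-].
Qed.

Lemma diff_at_lipschitz m n (f : 'rV[F]_m -> 'rV[F]_n) x J : diff_at f x J ->
  exists2 d : R, 0 < d & forall y, vn (y - x) < d ->
    vn (f y - f x) <= (vn J + 1) * vn (y - x).
Proof.
move=> fJ; have [d d0 H] := fJ 1 ltr01; exists d => // y /H.
have := vnD (f y - f x - (y - x) *m J) ((y - x) *m J); rewrite subrK.
have := vnM (y - x) J; lra.
Qed.

Lemma diff_at_continuous m n (f : 'rV[F]_m -> 'rV[F]_n) x J : diff_at f x J ->
  forall e : R, 0 < e -> exists2 d : R, 0 < d &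
    forall y, vn (y - x) < d -> vn (f y - f x) < e.
Proof.
move=> /diff_at_lipschitz [d d0 H] e e0; have J0 := vn_ge0 J.
have J1 : 0 < vn J + 1 by lra.
exists (Num.min d (e / (vn J + 1))); first by rewrite lt_min d0 divr_gt0.
move=> y; rewrite lt_min => /andP[/H h1]; rewrite ltr_pdivlMr // mulrC.
exact: le_lt_trans.
Qed.

Lemma diff_at_comp m n l (f : 'rV[F]_m -> 'rV[F]_n) (g : 'rV[F]_n -> 'rV[F]_l) x J J' :
  diff_at f x J -> diff_at g (f x) J' -> diff_at (g \o f) x (J *m J').
Proof.
move=> fJ gJ e e0.
have J0 := vn_ge0 J; have J'0 := vn_ge0 J'.
pose e1 := e / 2 / (vn J + 1); pose e2 := e / 2 / (vn J' + 1).
have e10 : 0 < e1 by rewrite !divr_gt0 //; lra.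
have e20 : 0 < e2 by rewrite !divr_gt0 //; lra.
have e1E : e1 * (vn J + 1) = e / 2 by rewrite /e1 divfK // gt_eqF //; lra.
have e2E : e2 * (vn J' + 1) = e / 2 by rewrite /e2 divfK // gt_eqF //; lra.
have [d1 d10 H1] := gJ e1 e10; have [d2 d20 H2] := fJ e2 e20.
have [d3 d30 H3] := diff_at_continuous fJ d10.
have [d4 d40 H4] := diff_at_lipschitz fJ.
exists (Num.min (Num.min d2 d3) d4); first by rewrite !lt_min d20 d30 d40.
move=> y; rewrite !lt_min => /andP[/andP[/H2 h2 /H3 /H1 h1] /H4 h4].
have -> : (g \o f) y - (g \o f) x - (y - x) *m (J *m J') =
   (g (f y) - g (f x) - (f y - f x) *m J') + (f y - f x - (y - x) *m J) *m J'.
  by rewrite (mulmxBl (f y - f x)) mulmxA addrA subrK.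
have := vnD (g (f y) - g (f x) - (f y - f x) *m J')
  ((f y - f x - (y - x) *m J) *m J').
have := vnM (f y - f x - (y - x) *m J) J'.
have h5 : e1 * vn (f y - f x) <= e / 2 * vn (y - x).
  by rewrite -e1E -mulrA ler_wpM2l ?(ltW e10).
have h6 : vn (f y - f x - (y - x) *m J) * vn J' <= e / 2 * vn (y - x).
  apply: le_trans (ler_wpM2r J'0 h2) _.
  rewrite -e2E mulrAC ler_wpM2r ?vn_ge0 // ler_wpM2l ?(ltW e20) //; lra.
lra.
Qed.

Lemma diff_at_linear m n (A : 'M[F]_(m, n)) x : diff_at (fun y => y *m A) x A.
Proof.
move=> e e0; exists 1 => // y _; rewrite -mulmxBl subrr vn0.
by rewrite mulr_ge0 ?vn_ge0 ?ltW.
Qed.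

Lemma diff_at_cst m n (c : 'rV[F]_n) x : diff_at (fun _ : 'rV[F]_m => c) x 0.
Proof.
move=> e e0; exists 1 => // y _; rewrite subrr mulmx0 subrr vn0.
by rewrite mulr_ge0 ?vn_ge0 ?ltW.
Qed.

Lemma diff_at_near m n (f g : 'rV[F]_m -> 'rV[F]_n) x J (r : R) : 0 < r ->
  (forall y, vn (y - x) < r -> f y = g y) -> diff_at f x J -> diff_at g x J.
Proof.
move=> r0 fg fJ e e0; have [d d0 H] := fJ e e0.
exists (Num.min d r); first by rewrite lt_min d0.
move=> y; rewrite lt_min => /andP[yd yr]; rewrite -!fg ?H //.
by rewrite subrr vn0.
Qed.

(** Strict differentiability: both points vary, so near [a] the remainder of the linearization is
    Lipschitz with a small constant, which is what contraction arguments ask for. *)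
Definition strict_at m n (f : 'rV[F]_m -> 'rV[F]_n) (a : 'rV[F]_m) (J : 'M[F]_(m, n)) :=
  forall e : R, 0 < e -> exists2 d : R, 0 < d &
    forall x y, vn (x - a) < d -> vn (y - a) < d ->
      vn (f x - f y - (x - y) *m J) <= e * vn (x - y).

Lemma vn_le_eps p q (A : 'M[F]_(p, q)) (b c : R) :
  (forall e, 0 < e -> vn A <= b + e * c) -> vn A <= b.
Proof.
move=> H; rewrite leNgt; apply/negP => bA.
pose c' := `|c| + 1; have c'0 : 0 < c' by rewrite ltr_wpDl.
have e0 : 0 < (vn A - b) / 2 / c' by rewrite !divr_gt0 // subr_gt0.
have := H _ e0; have : (vn A - b) / 2 / c' * c <= (vn A - b) / 2.
  rewrite -[leRHS](@divfK _ c') ?gt_eqF // ler_wpM2l ?(ltW e0) //.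
  by rewrite /c' (le_trans (ler_norm c)) // lerDl.
lra.
Qed.

(** Evaluate both linearizations at [x + t v] for a small real [t] and divide by [t]. With
    [strict_at], this shows that Jacobians near [a] are close to the one at [a]. *)
Lemma approx_deriv_le m n (f : 'rV[F]_m -> 'rV[F]_n) x J J' (eta r : R) : 0 < r ->
  (forall y, vn (y - x) < r -> vn (f y - f x - (y - x) *m J) <= eta * vn (y - x)) ->
  diff_at f x J' -> forall v : 'rV[F]_m, vn (v *m (J' - J)) <= eta * vn v.
Proof.
move=> r0 fJ fJ' v; apply: (@vn_le_eps _ _ _ _ (vn v)) => e e0.
have [d d0 H] := fJ' e e0.
pose t := Num.min d r / 2 / (vn v + 1).
have v0 := vn_ge0 v; have v1 : 0 < vn v + 1 by lra.
have m0 : 0 < Num.min d r by rewrite lt_min d0.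
have t0 : 0 < t by rewrite !divr_gt0.
have tv : t * vn v < Num.min d r.
  apply: (@le_lt_trans _ _ (Num.min d r / 2)); last lra.
  by rewrite -[leRHS](@divfK _ (vn v + 1)) ?gt_eqF // ler_wpM2l ?(ltW t0) // lerDl.
pose y := rc_emb K t *: v + x.
have yx : y - x = rc_emb K t *: v by rewrite addrK.
have yv : vn (y - x) = t * vn v by rewrite yx vnZ rn_emb gtr0_norm.
have := tv; rewrite lt_min -yv => /andP[/H h1 /fJ h2].
rewrite -(ler_pM2l t0).
have -> : t * vn (v *m (J' - J)) = vn ((y - x) *m (J' - J)).
  by rewrite yx -scalemxAl vnZ rn_emb gtr0_norm.
have -> : (y - x) *m (J' - J) =
    (f y - f x - (y - x) *m J) - (f y - f x - (y - x) *m J').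
  by rewrite mulmxBr; apply/rowP => i; rewrite !mxE /=; ring.
apply: le_trans (vnB _ _) _; rewrite mulrDr; apply: lerD.
  by rewrite mulrCA -yv.
by rewrite mulrCA -yv.
Qed.

(** For a square matrix injectivity suffices: a vector of the kernel satisfies v = - v S, so its
    norm is at most [b] times itself. *)
Lemma small_perturbation_unit m (S : 'M[F]_m) (b : R) : b < 1 ->
  (forall v : 'rV[F]_m, vn (v *m S) <= b * vn v) -> 1%:M + S \in unitmx.
Proof.
move=> b1 HS; rewrite -row_free_unit -kermx_eq0; apply/eqP.
apply/row_matrixP => i; rewrite row0; set v := row i _.
have vS : v *m (1%:M + S) = 0 by apply/sub_kermxP; exact: row_sub.
have : v = - (v *m S).
  by apply/eqP; rewrite -addr_eq0 -[v in v + _]mulmx1 -mulmxDr vS.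
move=> /(congr1 (@vn _ _ _ _)); rewrite vnN => vE.
apply: vn0_eq0; have := HS v; rewrite -vE; have := vn_ge0 v; nra.
Qed.

(** The remainder of [g] at [y] is, up to sign, the remainder of [G] at [g y] multiplied by
    [invmx T]; the Lipschitz bound on [g] measures it in terms of [y - G x]. *)
Lemma diff_at_inverse m (G g : 'rV[F]_m -> 'rV[F]_m) x T (r C : R) :
  T \in unitmx -> diff_at G x T -> 0 < r ->
  (forall y, vn (y - G x) < r -> G (g y) = y /\ vn (g y - x) <= C * vn (y - G x)) ->
  diff_at g (G x) (invmx T).
Proof.
move=> Tu GT r0 gG e e0.
have gx : g (G x) = x.
  by apply/subr0_eq/vn0_eq0; have [|_] := gG (G x); rewrite subrr vn0 // mulr0.
pose D := `|C| * vn (invmx T) + 1.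
have D0 : 0 < D by rewrite ltr_wpDl // mulr_ge0 ?vn_ge0.
have C1 : 0 < `|C| + 1 by rewrite ltr_wpDl.
have [d d0 H] := GT (e / D) (divr_gt0 e0 D0).
exists (Num.min r (d / (`|C| + 1))); first by rewrite lt_min r0 divr_gt0.
move=> y; rewrite lt_min => /andP[yr yd]; have [Gy gyx] := gG y yr.
have y0 := vn_ge0 (y - G x).
have gyx' : vn (g y - x) <= `|C| * vn (y - G x).
  by apply: le_trans gyx _; rewrite ler_wpM2r // ler_norm.
have gyd : vn (g y - x) < d.
  rewrite ltr_pdivlMr // mulrC in yd; apply: le_lt_trans yd.
  by apply: le_trans gyx' _; rewrite ler_wpM2r // lerDl.
have := H _ gyd; rewrite Gy => h.
have -> : g y - g (G x) - (y - G x) *m invmx T =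
    - ((y - G x - (g y - x) *m T) *m invmx T).
  by rewrite gx [in RHS]mulmxBl mulmxK // opprB.
rewrite vnN; apply: le_trans (vnM _ _) _.
apply: le_trans (ler_wpM2r (vn_ge0 _) h) _.
apply: le_trans (_ : e / D * (`|C| * vn (y - G x)) * vn (invmx T) <= _).
  rewrite ler_wpM2r ?vn_ge0 // ler_wpM2l // ltW // divr_gt0 //.
have -> : e / D * (`|C| * vn (y - G x)) * vn (invmx T) =
    e * (`|C| * vn (invmx T) / D) * vn (y - G x) by ring.
rewrite ler_wpM2r // ler_piMr ?(ltW e0) //.
by rewrite ler_pdivrMr // mul1r lerDl.
Qed.

Lemma strict_local_surj m (psi : 'rV[F]_m -> 'rV[F]_m) z A :
  strict_at psi z A -> A \in unitmx -> forall rho : R, 0 < rho ->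
  exists2 d : R, 0 < d & forall y, vn (y - psi z) < d ->
    exists2 w, vn (w - z) < rho & psi w = y.
Proof.
move=> ps Au rho rho0; have Ai0 := vn_ge0 (invmx A).
have Ai1 : 0 < vn (invmx A) + 1 by lra.
(* With this precision, [psi] followed by the inverse of [A] differs from a translation by a map
   with Lipschitz constant 1/2. *)
have eta0 : 0 < 2^-1 / (vn (invmx A) + 1) by rewrite divr_gt0 // invr_gt0.
have [d d0 H] := ps _ eta0.
pose rho' := Num.min rho d.
have rho'0 : 0 < rho' by rewrite lt_min rho0.
exists (rho' / 2 / (vn (invmx A) + 1)); first by rewrite !divr_gt0.
move=> y yd.
pose e x := (psi x - psi z) *m invmx A - (x - z).
have [|||x xz xy] := @contraction_surj R K m z e rho' ((y - psi z) *m invmx A).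
- move=> x x'; rewrite !lt_min => /andP[_ xd] /andP[_ xd'].
  have -> : e x - e x' = (psi x - psi x' - (x - x') *m A) *m invmx A.
    rewrite mulmxBl mulmxK // /e.
    have -> : psi x - psi x' = (psi x - psi z) - (psi x' - psi z).
      by rewrite opprB addrA subrK.
    rewrite [in RHS]mulmxBl.
    by apply/rowP => i; rewrite !mxE; ring.
  apply: le_trans (vnM _ _) _; apply: le_trans (ler_wpM2r Ai0 (H _ _ xd xd')) _.
  rewrite mulrAC ler_wpM2r ?vn_ge0 // -mulrA ler_piMr ?invr_ge0 //.
  by rewrite mulrC ler_pdivrMr // mul1r lerDl.
- by rewrite /e !subrr mul0mx subrr.
- apply: le_lt_trans (vnM _ _) _; rewrite ltr_pdivlMr // in yd.
  by apply: le_lt_trans yd; rewrite ler_wpM2l ?vn_ge0 // lerDl.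
exists x; first by move: xz; rewrite lt_min => /andP[].
move: xy; rewrite /e addrC subrK => /(can_inj (mulmxKV Au)) /addIr.
by [].
Qed.

End DiffAt.

(** * Mean value inequality *)

Section Dyadic.
Variable R : realType.
Local Notation h n := (2^-1 ^+ n : R).

Lemma half_exprS n : h n = 2 * h n.+1.
Proof. by rewrite exprS mulrA divff ?mul1r // pnatr_eq0. Qed.

Lemma dyadic_nested (x : nat -> R) (p : R) : 0 <= p ->
  (forall n, x n <= x n.+1 <= x n + p * h n.+1) ->
  exists u, forall n, x n <= u <= x n + p * h n.
Proof.
move=> p0 xS.
have xnk n k : x n <= x (n + k)%N /\ x (n + k)%N + p * h (n + k) <= x n + p * h n.
  elim: k => [|k [IH1 IH2]]; first by rewrite addn0 lexx.
  rewrite addnS; have /andP[h1 h2] := xS (n + k)%N.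
  move: IH2; rewrite (half_exprS (n + k)); set z := h (n + k).+1 in h2 *.
  by split; lra.
have [|u uP] := @geometric_cvg R x p.
  move=> n; have /andP[h1 h2] := xS n; have := half_expr_gt0 R n.+1.
  move=> z0; have := mulr_ge0 p0 (ltW z0).
  rewrite (half_exprS n) ger0_norm ?subr_ge0 //; lra.
exists u => n; apply/andP; split.
  rewrite -subr_le0; apply: (@le0_half_expr _ _ (2 * p * h n)) => k.
  have [h1 _] := xnk n k; have := uP (n + k)%N; rewrite ler_norml exprD => /andP[h3 h4].
  by rewrite -mulrA; lra.
rewrite -subr_le0; apply: (@le0_half_expr _ _ (2 * p * h n)) => k.
have [_ h2] := xnk n k; have := uP (n + k)%N; rewrite ler_norml => /andP[h3 h4].
have : 0 <= p * h (n + k) by rewrite mulr_ge0 // ltW // half_expr_gt0.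
move: h3 h4 h2; rewrite exprD; lra.
Qed.

(* A property of dyadic rectangles which is inherited from the four quarters and
   holds for all small rectangles around each point holds for the whole rectangle. *)
Lemma dyadic_rectangle (Q : nat -> R -> R -> Prop) (p q x0 y0 : R) :
  0 <= p -> 0 <= q ->
  (forall n x y, Q n.+1 x y -> Q n.+1 (x + p * h n.+1) y ->
     Q n.+1 x (y + q * h n.+1) -> Q n.+1 (x + p * h n.+1) (y + q * h n.+1) ->
     Q n x y) ->
  (forall u v, x0 <= u <= x0 + p -> y0 <= v <= y0 + q ->
     exists2 d, 0 < d & forall n x y, x <= u <= x + p * h n -> y <= v <= y + q * h n ->
       (p + q) * h n < d -> Q n x y) ->
  Q 0%N x0 y0.
Proof.
move=> p0 q0 Qsub Qloc; apply: contrapT => nQ.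
have child n (w : R * R) : exists w' : R * R, ~ Q n w.1 w.2 -> ~ Q n.+1 w'.1 w'.2 /\
    ((w'.1 = w.1 \/ w'.1 = w.1 + p * h n.+1) /\ (w'.2 = w.2 \/ w'.2 = w.2 + q * h n.+1)).
  have [Qw|nQw] := pselect (Q n w.1 w.2); first by exists w.
  apply: contrapT => nex; apply: nQw; apply: Qsub; apply: contrapT => nQ'; apply: nex.
  - by exists (w.1, w.2) => _; split => //; split; left.
  - by exists (w.1 + p * h n.+1, w.2) => _; split => //; split; [right|left].
  - by exists (w.1, w.2 + q * h n.+1) => _; split => //; split; [left|right].
  - by exists (w.1 + p * h n.+1, w.2 + q * h n.+1) => _; split => //; split; right.
have /choice [nx nxP] : forall nw : nat * (R * R), exists w' : R * R,
    ~ Q nw.1 nw.2.1 nw.2.2 -> ~ Q nw.1.+1 w'.1 w'.2 /\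
    ((w'.1 = nw.2.1 \/ w'.1 = nw.2.1 + p * h nw.1.+1) /\
     (w'.2 = nw.2.2 \/ w'.2 = nw.2.2 + q * h nw.1.+1)).
  by move=> [n w]; exact: child.
pose w := fix w n := if n is n'.+1 then nx (n', w n') else (x0, y0).
have wQ n : ~ Q n (w n).1 (w n).2.
  by elim: n => [//|n IH]; have [] := nxP (n, w n) IH.
have step (c s : R) n : 0 <= c -> forall s', (s' = s \/ s' = s + c * h n.+1) ->
    s <= s' <= s + c * h n.+1.
  move=> c0 s' hs'; have : 0 <= c * h n.+1 by rewrite mulr_ge0 // ltW // half_expr_gt0.
  by move=> ?; apply/andP; case: hs' => ->; split; lra.
have [|u uP] := @dyadic_nested (fun n => (w n).1) p p0.
  by move=> n; apply: step => //; have [_ []] := nxP (n, w n) (wQ n).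
have [|v vP] := @dyadic_nested (fun n => (w n).2) q q0.
  by move=> n; apply: step => //; have [_ []] := nxP (n, w n) (wQ n).
have [||d d0 H] := Qloc u v.
- by have := uP 0%N; rewrite expr0 mulr1.
- by have := vP 0%N; rewrite expr0 mulr1.
have [n hn] := half_expr_small (p + q) d0.
exact: wQ (H n _ _ (uP n) (vP n) hn).
Qed.

(* The mean value inequality, for any subadditive [N]; only a local Lipschitz bound
   along the curve is used, not differentiability. *)
Lemma mean_value_inequality (T : zmodType) (N : T -> R) (U : R -> T) (a b M : R) :
  (forall x y, N (x + y) <= N x + N y) -> (forall x, N (- x) = N x) -> a <= b ->
  (forall t, a <= t <= b -> forall e, 0 < e -> exists2 d, 0 < d &
     forall s, `|s - t| < d -> N (U s - U t) <= (M + e) * `|s - t|) ->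
  N (U b - U a) <= M * (b - a).
Proof.
move=> ND NN ab loc.
have NB x y z : N (x - z) <= N (x - y) + N (y - z).
  by apply: le_trans (ND _ _); rewrite addrA subrK.
apply/ler_addgt0Pr => e e0.
pose e' := e / (b - a + 1).
have e'0 : 0 < e' by rewrite divr_gt0 // ltr_wpDl // subr_ge0.
apply: (@le_trans _ _ ((M + e') * (b - a))); last first.
  rewrite mulrDl lerD2l mulrAC ler_pdivrMr; last by rewrite ltr_wpDl // subr_ge0.
  by rewrite ler_wpM2l ?(ltW e0) // lerDl.
have ba : 0 <= b - a by rewrite subr_ge0.
pose Q n (x y : R) := N (U (x + (b - a) * h n) - U x) <= (M + e') * ((b - a) * h n).
(* Rectangles of height 0 turn the quartering into a bisection of the interval. *)
have := @dyadic_rectangle Q (b - a) 0 a 0 ba (lexx _).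
rewrite /Q expr0 !mulr1 [a + _]addrC subrK; apply.
- move=> n x _ h1 h2 _ _; rewrite (half_exprS n).
  apply: le_trans (NB _ (U (x + (b - a) * h n.+1)) _) _.
  have -> : x + (b - a) * (2 * h n.+1) = x + (b - a) * h n.+1 + (b - a) * h n.+1 by ring.
  by apply: le_trans (lerD h2 h1) _; rewrite le_eqVlt; apply/orP; left; apply/eqP; ring.
- move=> u v uab _; have [d d0 H] := loc u uab e' e'0.
  exists d => // n x y /andP[xu ux] _; rewrite addr0 => hd.
  apply: le_trans (NB _ (U u) _) _.
  have h1 : N (U (x + (b - a) * h n) - U u) <= (M + e') * (x + (b - a) * h n - u).
    have := H (x + (b - a) * h n); rewrite ger0_norm ?subr_ge0 //; apply; lra.
  have h2 : N (U u - U x) <= (M + e') * (u - x).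
    rewrite -NN opprB; have := H x; rewrite distrC ger0_norm ?subr_ge0 //; apply; lra.
  by apply: le_trans (lerD h1 h2) _; rewrite -mulrDr addrA subrK addrC addKr.
Qed.

End Dyadic.

Section Strict.
Variables (R : realType) (K : rc_kind).
Local Notation F := (rc_scalar R K).

(** The mean value inequality for f - J along the segment from [y] to [x]. Only the action of
    [Jp - J] on the direction [x - y] has to be bounded, which is what Cauchy's estimate on a
    complex line provides. *)
Lemma segment_mean_value m n (f : 'rV[F]_m -> 'rV[F]_n) (a x y : 'rV[F]_m) J (d M : R) :
  vn (x - a) < d -> vn (y - a) < d ->
  (forall p, vn (p - a) < d -> exists2 Jp, diff_at f p Jp &
     vn ((x - y) *m (Jp - J)) <= M) ->
  vn (f x - f y - (x - y) *m J) <= M.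
Proof.
move=> xd yd H; pose q (t : R) := y + rc_emb K t *: (x - y).
pose U t := f (q t) - q t *m J.
have qB s t : q s - q t = rc_emb K (s - t) *: (x - y).
  by rewrite /q opprD addrACA subrr add0r -scalerBl -rmorphB.
have qd t : 0 <= t <= 1 -> vn (q t - a) < d.
  move=> /andP[t0 t1].
  have -> : q t - a = rc_emb K (1 - t) *: (y - a) + rc_emb K t *: (x - a).
    rewrite /q rmorphB rmorph1 scalerBl scale1r !scalerBr.
    by apply/rowP => i; rewrite !mxE; ring.
  apply: le_lt_trans (vnD _ _) _; rewrite !vnZ !rn_emb !ger0_norm ?subr_ge0 //.
  have [->|t0'] := eqVneq t 0; first by rewrite subr0 mul1r mul0r addr0.
  have tp : 0 < t by rewrite lt_neqAle eq_sym t0'.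
  have h1 : t * vn (x - a) < t * d by rewrite ltr_pM2l.
  have h2 : (1 - t) * vn (y - a) <= (1 - t) * d by rewrite ler_wpM2l ?subr_ge0 // ltW.
  lra.
have -> : f x - f y - (x - y) *m J = U 1 - U 0.
  have q1 : q 1 = x by rewrite /q rmorph1 scale1r addrC subrK.
  have q0 : q 0 = y by rewrite /q rmorph0 scale0r addr0.
  rewrite /U q1 q0 mulmxBl.
  by apply/rowP => i; rewrite !mxE; ring.
have := @mean_value_inequality R _ (@vn R K 1 n) U 0 1 M (@vnD _ _ _ _) (@vnN _ _ _ _) ler01.
rewrite subr0 mulr1; apply => t t01 e e0.
have [Jp fJp JpM] := H _ (qd t t01).
pose c := vn (x - y) + 1; have c0 : 0 < c by rewrite ltr_wpDl ?vn_ge0.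
have [d' d'0 H'] := fJp (e / c) (divr_gt0 e0 c0).
exists (d' / c); first by rewrite divr_gt0.
move=> s; rewrite ltr_pdivlMr // => sd.
have E : U s - U t = (f (q s) - f (q t) - (q s - q t) *m Jp) + (q s - q t) *m (Jp - J).
  rewrite /U mulmxBr !mulmxBl.
  by apply/rowP => i; rewrite !mxE; ring.
have st : vn (q s - q t) = `|s - t| * vn (x - y) by rewrite qB vnZ rn_emb.
have h1 : vn (f (q s) - f (q t) - (q s - q t) *m Jp) <= e / c * (`|s - t| * vn (x - y)).
  rewrite -st; apply: H'; rewrite st; apply: le_lt_trans sd.
  by rewrite ler_wpM2l // lerDl.
have h2 : vn ((q s - q t) *m (Jp - J)) <= `|s - t| * M.
  by rewrite qB -scalemxAl vnZ rn_emb ler_wpM2l.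
rewrite E; apply: le_trans (vnD _ _) _; apply: le_trans (lerD h1 h2) _.
have : e / c * (`|s - t| * vn (x - y)) <= e * `|s - t|.
  have -> : e / c * (`|s - t| * vn (x - y)) = e * `|s - t| * (vn (x - y) / c) by ring.
  rewrite ler_piMr ?mulr_ge0 ?(ltW e0) // ler_pdivrMr // mul1r lerDl.
  by [].
lra.
Qed.
End Strict.

Lemma real_strict_at (R : realType) m n (D : set 'rV[rc_scalar R RealScalars]_m)
    (f : 'rV[rc_scalar R RealScalars]_m -> 'rV[rc_scalar R RealScalars]_n) a :
  open D -> twice_continuously_differentiable_on D f -> D a -> strict_at f a ('J f a).
Proof.
move=> oD [fD jD _] Da e e0.
have [d1 d10 H1] := (open_vnP D).1 oD a Da.
have [d2 d20 H2] := (continuous_vnP _ _).1 (differentiable_continuous (jD a Da)) e e0.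
exists (Num.min d1 d2); first by rewrite lt_min d10.
move=> x y xd yd; apply: segment_mean_value xd yd _ => p.
rewrite lt_min => /andP[/H1 Dp /H2 pd].
exists ('J f p); first exact/differentiable_diff_at/fD.
apply: le_trans (vnM _ _) _; rewrite mulrC ler_wpM2r ?vn_ge0 // ltW //.
by move: pd; rewrite /jac -linearB vn_tr.
Qed.

(** * Goursat's theorem and Cauchy's estimate *)

Section RealPrimitive.
Variable R : realType.

Lemma derivable_approx (f : R -> R) x : derivable f x 1 -> forall e, 0 < e ->
  exists2 d, 0 < d & forall s, `|s - x| < d ->
    `|f s - f x - (s - x) * f^`()%classic x| <= e * `|s - x|.
Proof.
move=> /derivable1_diffP fx e e0.
have [_ /eqaddoP h] := (diff_locallyP _ _).1 fx.
have /nbhs_normP [d /= d0 H] := h e e0; exists d => // s sx.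
have := H (s - x); rewrite /= sub0r normrN => /(_ sx).
rewrite !fctE /= subrK diff1E // opprD addrA.
by [].
Qed.

(** The only appeal to integration. From here on, curve integrals are increments of primitives,
    handled by the mean value inequality. *)
Lemma real_primitive (u : R -> R) (a b : R) : a < b ->
  (forall t, a <= t <= b -> forall e, 0 < e -> exists2 d, 0 < d &
     forall s, `|s - t| < d -> `|u s - u t| < e) ->
  exists U : R -> R, forall t, a < t < b -> forall e, 0 < e -> exists2 d, 0 < d &
     forall s, `|s - t| < d -> `|U s - U t - (s - t) * u t| <= e * `|s - t|.
Proof.
move=> ab uc.
have uc' t : a <= t <= b -> {for t, continuous u}.
  move=> /uc H; apply/cvgrPdist_lt => e e0; have [d d0 Hd] := H e e0.
  apply/nbhs_normP; exists d => // s /=; rewrite distrC => /Hd.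
  by rewrite distrC.
have ui : (@lebesgue_measure R).-integrable `[a, b] (EFin \o u).
  apply: continuous_compact_integrable; first exact: segment_compact.
  apply: continuous_in_subspaceT => x; rewrite inE /= in_itv /=.
  exact: uc'.
exists (fun x => (\int[@lebesgue_measure R]_(t in `[a, x]) u t)%R) => t /andP[at_ tb] e e0.
have tab : a <= t <= b by rewrite !ltW.
have [dU Ut] := continuous_FTC1_closed tb ui at_ (uc' t tab).
have [d d0 H] := derivable_approx dU e0.
exists d => // s /H.
by rewrite Ut.
Qed.
End RealPrimitive.

Section Complex.
Variable R : realType.
Local Notation C := R[i].
Local Notation N := (@rn R ComplexScalars).
Local Notation ofR x := (x%:C)%C.
Local Notation "'i" := ('i%C : C).

Lemma cnM (x y : C) : N (x * y) = N x * N y. Proof. exact: (@rnM R ComplexScalars). Qed.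
Lemma cnD (x y : C) : N (x + y) <= N x + N y. Proof. exact: (@rnD R ComplexScalars). Qed.
Lemma cnN (x : C) : N (- x) = N x. Proof. exact: (@rnN R ComplexScalars). Qed.
Lemma cnB (x y : C) : N (x - y) <= N x + N y. Proof. by rewrite -(cnN y) cnD. Qed.
Lemma cn0 : N (0 : C) = 0. Proof. exact: (@rn0 R ComplexScalars). Qed.
Lemma cn1 : N (1 : C) = 1. Proof. exact: (@rn1 R ComplexScalars). Qed.
Lemma cn_ge0 (x : C) : 0 <= N x. Proof. exact: (@rn_ge0 R ComplexScalars). Qed.
Lemma cn_eq0 (x : C) : (N x == 0) = (x == 0). Proof. exact: (@rn_eq0 R ComplexScalars). Qed.
Lemma cn_real (a : R) : N (ofR a) = `|a|. Proof. exact: (@rn_emb R ComplexScalars). Qed.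
Lemma cn_le0 (x : C) : N x <= 0 -> x = 0.
Proof. by move=> h; apply/eqP; rewrite -cn_eq0 eq_le h cn_ge0. Qed.
Lemma cnE (x : C) : N x = Num.sqrt (complex.Re x ^+ 2 + complex.Im x ^+ 2).
Proof. by case: x. Qed.
Lemma cn_i : N 'i = 1.
Proof. by rewrite cnE /= expr0n expr1n add0r sqrtr1. Qed.
Lemma cnV (x : C) : N x^-1 = (N x)^-1.
Proof.
have [->|x0] := eqVneq x 0; first by rewrite invr0 cn0 invr0.
have n0 : N x != 0 by rewrite cn_eq0.
by apply: (mulfI n0); rewrite -cnM divff // cn1 divff.
Qed.

Lemma Re_le_cn (x : C) : `|complex.Re x| <= N x.
Proof. by rewrite cnE -sqrtr_sqr ler_wsqrtr // lerDl sqr_ge0. Qed.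
Lemma Im_le_cn (x : C) : `|complex.Im x| <= N x.
Proof. by rewrite cnE -sqrtr_sqr ler_wsqrtr // lerDr sqr_ge0. Qed.
Lemma cn_le (x : C) : N x <= `|complex.Re x| + `|complex.Im x|.
Proof.
rewrite {1}(complexE x); apply: le_trans (cnD _ _) _.
by rewrite cnM cn_i mul1r !cn_real.
Qed.

Definition curve_deriv (U : R -> C) (t : R) (c : C) := forall e, 0 < e ->
  exists2 d, 0 < d & forall s, `|s - t| < d ->
    N (U s - U t - ofR (s - t) * c) <= e * `|s - t|.

Lemma complex_primitive (u : R -> C) (a b : R) : a < b ->
  (forall t, a <= t <= b -> forall e, 0 < e -> exists2 d, 0 < d &
     forall s, `|s - t| < d -> N (u s - u t) < e) ->
  exists U : R -> C, forall t, a < t < b -> curve_deriv U t (u t).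
Proof.
move=> ab uc.
have [U1 U1P] : exists U : R -> R, forall t, a < t < b -> forall e, 0 < e ->
    exists2 d, 0 < d & forall s, `|s - t| < d ->
    `|U s - U t - (s - t) * complex.Re (u t)| <= e * `|s - t|.
  apply: real_primitive ab _ => t tab e e0; have [d d0 H] := uc t tab e e0.
  exists d => // s /H; apply: le_lt_trans; apply: le_trans (Re_le_cn _).
  by rewrite raddfB.
have [U2 U2P] : exists U : R -> R, forall t, a < t < b -> forall e, 0 < e ->
    exists2 d, 0 < d & forall s, `|s - t| < d ->
    `|U s - U t - (s - t) * complex.Im (u t)| <= e * `|s - t|.
  apply: real_primitive ab _ => t tab e e0; have [d d0 H] := uc t tab e e0.
  exists d => // s /H; apply: le_lt_trans; apply: le_trans (Im_le_cn _).
  by rewrite raddfB.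
exists (fun t => Complex (U1 t) (U2 t)) => t tab e e0.
have e2 : 0 < e / 2 by rewrite divr_gt0.
have [d1 d10 H1] := U1P t tab _ e2; have [d2 d20 H2] := U2P t tab _ e2.
exists (Num.min d1 d2); first by rewrite lt_min d10.
move=> s; rewrite lt_min => /andP[/H1 h1 /H2 h2].
apply: le_trans (cn_le _) _.
rewrite [e]splitr mulrDl; apply: lerD.
  by move: h1; case: (u t) => x y /=; rewrite mul0r subr0.
by move: h2; case: (u t) => x y /=; rewrite mul0r addr0.
Qed.

(** Complex differentiability of [H] as a function of s + i th, which will be the logarithm of a
    point of the plane. *)
Definition polar_deriv (H : R -> R -> C) (s th : R) (b : C) := forall e, 0 < e ->
  exists2 d, 0 < d & forall s' th', `|s' - s| < d -> `|th' - th| < d ->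
    N (H s' th' - H s th - b * (ofR (s' - s) + 'i * ofR (th' - th))) <=
      e * (`|s' - s| + `|th' - th|).

Definition affine_primitive (a b w z : C) : C := a * z + b * (z - w) ^+ 2 / 2.

(* Integrating against the exact primitive of [z |-> a + b (z - w)]. *)
Lemma edge_estimate (U k : R -> C) (z0 om a b w : C) (M t1 t2 : R) : t1 <= t2 ->
  N om = 1 ->
  (forall t, t1 <= t <= t2 -> curve_deriv U t (k t)) ->
  (forall t, t1 <= t <= t2 -> N (k t - a - b * (z0 + ofR t * om - w)) <= M) ->
  N (om * (U t2 - U t1) - (affine_primitive a b w (z0 + ofR t2 * om) -
    affine_primitive a b w (z0 + ofR t1 * om))) <= M * (t2 - t1).
Proof.
move=> t12 om1 Uk kM; set A := affine_primitive a b w.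
pose V t := om * U t - A (z0 + ofR t * om).
have -> : om * (U t2 - U t1) - (A (z0 + ofR t2 * om) - A (z0 + ofR t1 * om)) = V t2 - V t1.
  by rewrite /V; ring.
apply: (mean_value_inequality cnD cnN t12) => t tt e e0.
have e2 : 0 < e / 2 by rewrite divr_gt0.
have [d d0 H] := Uk t tt _ e2.
have b1 : 0 < N b + 1 by rewrite ltr_wpDl ?cn_ge0.
exists (Num.min d (e / 2 / (N b + 1))); first by rewrite lt_min d0 divr_gt0.
move=> s; rewrite lt_min => /andP[/H h1]; rewrite ltr_pdivlMr // => sd.
have two0 : (2 : C) != 0 by rewrite pnatr_eq0.
have -> : V s - V t = om * (U s - U t - ofR (s - t) * k t) +
   om * ofR (s - t) * (k t - a - b * (z0 + ofR t * om - w)) -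
   b * om ^+ 2 * ofR (s - t) ^+ 2 / 2.
  by rewrite /V /A /affine_primitive !rmorphB; field.
have h2 : N (om * ofR (s - t) * (k t - a - b * (z0 + ofR t * om - w))) <= `|s - t| * M.
  by rewrite !cnM om1 mul1r cn_real ler_wpM2l // kM.
have h3 : N (b * om ^+ 2 * ofR (s - t) ^+ 2 / 2) <= e / 2 * `|s - t|.
  rewrite !cnM om1 cnV (_ : N 2 = 2); last first.
    by rewrite -[2]/(2%:R) -(rmorph_nat (real_complex R)) cn_real ger0_norm.
  rewrite cn_real !mulr1.
  have := cn_ge0 b; have := normr_ge0 (s - t).
  move: (N b) (`|s - t|) sd => B S sd S0 B0.
  rewrite ler_pdivrMr //; nra.
have h1' : N (om * (U s - U t - ofR (s - t) * k t)) <= e / 2 * `|s - t|.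
  by rewrite cnM om1 mul1r.
apply: le_trans (cnB _ _) _; apply: le_trans (lerD (cnD _ _) h3) _.
have := lerD h1' h2; lra.
Qed.

(** The boundary sum [W] is additive under quartering. On a small rectangle [H] is affine up to [e']
    times the size, and affine functions have an exact primitive, so [W] is at most [e'] times the
    square of the size, an order that the fourfold subdivision preserves. *)
Lemma goursat (H hor ver : R -> R -> C) (s1 t1 p q : R) : 0 <= p -> 0 <= q ->
  (forall s t, s1 <= s <= s1 + p -> t1 <= t <= t1 + q -> exists b, polar_deriv H s t b) ->
  (forall s t, s1 <= s <= s1 + p -> t1 <= t <= t1 + q -> curve_deriv (hor t) s (H s t)) ->
  (forall s t, s1 <= s <= s1 + p -> t1 <= t <= t1 + q -> curve_deriv (ver s) t (H s t)) ->
  hor t1 (s1 + p) - hor t1 s1 + 'i * (ver (s1 + p) (t1 + q) - ver (s1 + p) t1) =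
  hor (t1 + q) (s1 + p) - hor (t1 + q) s1 + 'i * (ver s1 (t1 + q) - ver s1 t1).
Proof.
move=> p0 q0 Hd horP verP.
pose W x y a b := hor y (x + a) - hor y x + 'i * (ver (x + a) (y + b) - ver (x + a) y) -
  (hor (y + b) (x + a) - hor (y + b) x) - 'i * (ver x (y + b) - ver x y).
suff W0 : W s1 t1 p q = 0.
  by apply/subr0_eq; rewrite -[RHS]W0 /W; ring.
apply: cn_le0; apply/ler_addgt0Pr => e e0; rewrite add0r.
(* The four edges together contribute [2 * e' * (p + q) ^+ 2], which is then at most [e]. *)
pose e' := e / (2 * (p + q + 1) ^+ 2).
have pq1 : 0 < p + q + 1 by rewrite ltr_wpDl // addr_ge0.
have e'0 : 0 < e' by rewrite divr_gt0 // mulr_gt0 // exprn_gt0.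
suff HW : N (W s1 t1 p q) <= 2 * e' * (p + q) ^+ 2.
  apply: le_trans HW _; rewrite /e'.
  have -> : 2 * (e / (2 * (p + q + 1) ^+ 2)) * (p + q) ^+ 2 =
     e * ((p + q) ^+ 2 / (p + q + 1) ^+ 2) by field; rewrite gt_eqF.
  rewrite ler_piMr ?(ltW e0) // ler_pdivrMr ?exprn_gt0 // mul1r.
  rewrite ler_sqr ?nnegrE ?addr_ge0 //.
  by rewrite lerDl.
pose h n : R := 2^-1 ^+ n.
have h0 n : 0 <= h n by rewrite ltW // half_expr_gt0.
have hS n : h n = h n.+1 + h n.+1 by rewrite /h exprS; lra.
(* The derivatives are known only inside the original rectangle, so the inherited property is
   conditional on lying there. *)
pose inR n x y := [/\ s1 <= x, x + p * h n <= s1 + p, t1 <= y & y + q * h n <= t1 + q].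
pose Q n x y := inR n x y ->
  N (W x y (p * h n) (q * h n)) <= 2 * e' * ((p + q) * h n) ^+ 2.
suff Q0 : Q 0%N s1 t1.
  by move: Q0; rewrite /Q /inR /h expr0 !mulr1; apply; rewrite !lexx.
apply: (dyadic_rectangle p0 q0).
- move=> n x y Q1 Q2 Q3 Q4 [x1 x2 y1 y2].
  set a := p * h n.+1 in Q1 Q2 Q3 Q4; set b := q * h n.+1 in Q1 Q2 Q3 Q4.
  have a0 : 0 <= a by rewrite mulr_ge0.
  have b0 : 0 <= b by rewrite mulr_ge0.
  have aE : p * h n = a + a by rewrite hS mulrDr.
  have bE : q * h n = b + b by rewrite hS mulrDr.
  rewrite -/(h n) in x2 y2 *; rewrite aE in x2 *; rewrite bE in y2 *.
  have {}Q1 : N (W x y a b) <= 2 * e' * ((p + q) * h n.+1) ^+ 2.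
    by apply: Q1; split; rewrite -/(h _) -/a -/b; lra.
  have {}Q2 : N (W (x + a) y a b) <= 2 * e' * ((p + q) * h n.+1) ^+ 2.
    by apply: Q2; split; rewrite -/(h _) -/a -/b; lra.
  have {}Q3 : N (W x (y + b) a b) <= 2 * e' * ((p + q) * h n.+1) ^+ 2.
    by apply: Q3; split; rewrite -/(h _) -/a -/b; lra.
  have {}Q4 : N (W (x + a) (y + b) a b) <= 2 * e' * ((p + q) * h n.+1) ^+ 2.
    by apply: Q4; split; rewrite -/(h _) -/a -/b; lra.
  have -> : W x y (a + a) (b + b) = W x y a b + W (x + a) y a b + W x (y + b) a b +
      W (x + a) (y + b) a b by rewrite /W !addrA; ring.
  apply: le_trans (cnD _ _) _; apply: le_trans (lerD (cnD _ _) (lexx _)) _.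
  apply: le_trans (lerD (lerD (cnD _ _) (lexx _)) (lexx _)) _.
  have -> : 2 * e' * ((p + q) * h n) ^+ 2 = 4 * (2 * e' * ((p + q) * h n.+1) ^+ 2).
    by rewrite (hS n); ring.
  lra.
- move=> u v uR vR; have [b Hb] := Hd u v uR vR.
  have [d d0 HH] := Hb e' e'0; exists d => // n x y.
  rewrite -/(h n); set A := p * h n; set B := q * h n.
  move=> /andP[xu ux] /andP[yv vy] small [x1 x2 y1 y2].
  rewrite -/(h n) -/A in x2; rewrite -/(h n) -/B in y2; rewrite -/A -/B.
  have A0 : 0 <= A by rewrite mulr_ge0.
  have B0 : 0 <= B by rewrite mulr_ge0.
  have ABE : (p + q) * h n = A + B by rewrite mulrDl.
  rewrite ABE in small *.
  pose w := ofR u + 'i * ofR v.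
  pose P := affine_primitive (H u v) b w.
  have key s t : x <= s <= x + A -> y <= t <= y + B ->
      N (H s t - H u v - b * (ofR s + 'i * ofR t - w)) <= e' * (A + B).
    move=> /andP[s_1 s_2] /andP[t_1 t_2].
    have su : `|s - u| <= A by rewrite ler_norml; apply/andP; split; lra.
    have tv : `|t - v| <= B by rewrite ler_norml; apply/andP; split; lra.
    have := HH s t; have -> : ofR s + 'i * ofR t - w = ofR (s - u) + 'i * ofR (t - v).
      by rewrite /w !rmorphB; ring.
    move=> h1; apply: le_trans (h1 _ _) _; [lra|lra|].
    by rewrite ler_wpM2l ?(ltW e'0) // lerD.
  have horE t : y <= t <= y + B -> N (hor t (x + A) - hor t x -
      (P (ofR (x + A) + 'i * ofR t) - P (ofR x + 'i * ofR t))) <= e' * (A + B) * A.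
    move=> tB; have xA : x <= x + A by lra.
    have tR : t1 <= t <= t1 + q by case/andP: tB => ? ?; apply/andP; split; lra.
    have swap z : 'i * ofR t + ofR z * 1 = ofR z + 'i * ofR t by rewrite mulr1 addrC.
    have -> : e' * (A + B) * A = e' * (A + B) * (x + A - x) by ring.
    rewrite -(mul1r (hor t (x + A) - hor t x)) -!swap.
    apply: (@edge_estimate _ (H^~ t)) => //; first exact: cn1.
      by move=> s /andP[? ?]; apply: horP => //; apply/andP; split; lra.
    by move=> s sA; rewrite swap; exact: key.
  have verE s : x <= s <= x + A -> N ('i * (ver s (y + B) - ver s y) -
      (P (ofR s + 'i * ofR (y + B)) - P (ofR s + 'i * ofR y))) <= e' * (A + B) * B.
    move=> sA; have yB : y <= y + B by lra.
    have sR : s1 <= s <= s1 + p by case/andP: sA => ? ?; apply/andP; split; lra.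
    have -> : e' * (A + B) * B = e' * (A + B) * (y + B - y) by ring.
    rewrite !(mulrC 'i (ofR _)).
    apply: (@edge_estimate _ (H s)) => //; first exact: cn_i.
      by move=> t /andP[? ?]; apply: verP => //; apply/andP; split; lra.
    by move=> t tB; rewrite (mulrC (ofR t)); exact: key.
  have yy : y <= y <= y + B by rewrite lexx /= lerDl.
  have yB : y <= y + B <= y + B by rewrite lexx andbT lerDl.
  have xx : x <= x <= x + A by rewrite lexx /= lerDl.
  have xA : x <= x + A <= x + A by rewrite lexx andbT lerDl.
  have h1 := horE y yy; have h2 := verE _ xA; have h3 := horE _ yB; have h4 := verE x xx.
  move: h1 h2 h3 h4.
  set E1 := hor y (x + A) - _ - _; set E2 := 'i * (ver (x + A) _ - _) - _.
  set E3 := hor (y + B) (x + A) - _ - _; set E4 := 'i * (ver x _ - _) - _ => h1 h2 h3 h4.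
  have -> : W x y A B = E1 + E2 - E3 - E4 by rewrite /W /E1 /E2 /E3 /E4; ring.
  apply: le_trans (cnB _ _) _; apply: le_trans (lerD (cnB _ _) (lexx _)) _.
  apply: le_trans (lerD (lerD (cnD _ _) (lexx _)) (lexx _)) _.
  have -> : 2 * e' * (A + B) ^+ 2 = e' * (A + B) * A + e' * (A + B) * B +
    e' * (A + B) * A + e' * (A + B) * B by ring.
  lra.
Qed.

End Complex.

Section Cauchy.
Variable R : realType.
Local Notation C := R[i].
Local Notation N := (@rn R ComplexScalars).
Local Notation ofR x := (x%:C)%C.
Local Notation "'i" := ('i%C : C).

Definition complex_deriv (g : C -> C) (z c : C) := forall e, 0 < e ->
  exists2 d, 0 < d & forall w, N (w - z) < d -> N (g w - g z - c * (w - z)) <= e * N (w - z).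

Lemma complex_deriv_quotient (g : C -> C) (z c : C) : z != 0 -> complex_deriv g z c ->
  exists b, complex_deriv (fun w => (g w - g 0) / w) z b.
Proof.
move=> z0 gz.
pose b := (c - (g z - g 0) / z) / z; exists b => e e0.
have Nz : 0 < N z by rewrite lt_neqAle eq_sym cn_eq0 z0 cn_ge0.
pose k := N b / N z.
have k0 : 0 <= k by rewrite divr_ge0 ?cn_ge0.
pose e1 := e * N z / 4.
have e10 : 0 < e1 by rewrite divr_gt0 // mulr_gt0.
have [d d0 H] := gz e1 e10.
pose d' := Num.min (Num.min d (N z / 2)) (e * N z / 4 / (N b + 1)).
have b1 : 0 < N b + 1 by rewrite ltr_wpDl ?cn_ge0.
have d'0 : 0 < d' by rewrite !lt_min d0 !divr_gt0 // mulr_gt0.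
exists d' => // w; rewrite !lt_min => /andP[/andP[/H h wz]]; rewrite ltr_pdivlMr // => wb.
have Nw : N z / 2 <= N w.
  have := cnB w (w - z); rewrite opprB addrC subrK; lra.
have w0 : w != 0.
  by rewrite -cn_eq0 gt_eqF //; apply: lt_le_trans Nw; rewrite divr_gt0.
have -> : (g w - g 0) / w - (g z - g 0) / z - b * (w - z) =
    ((g w - g z - c * (w - z)) - b * (w - z) ^+ 2) / w.
  rewrite /b; field; by rewrite w0 z0.
rewrite cnM cnV ler_pdivrMr; last by apply: lt_le_trans Nw; rewrite divr_gt0.
apply: le_trans (cnB _ _) _; rewrite cnM expr2 (cnM (w - z)).
have D0 := cn_ge0 (w - z).
have h2 : N b * (N (w - z) * N (w - z)) <= e * N z / 4 * N (w - z).
  have B0 := cn_ge0 b; move: (N (w - z)) (N b) wb D0 B0 => D B wb D0 B0; nra.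
have h3 : e * N (w - z) * (N z / 2) <= e * N (w - z) * N w.
  by rewrite ler_wpM2l // mulr_ge0 // ltW.
rewrite /e1 in h; lra.
Qed.

(** The exponential of s + i t. *)
Definition polar (s t : R) : C := Complex (expR s * cos t) (expR s * sin t).

Lemma polarD s t s' t' : polar (s + s') (t + t') = polar s t * polar s' t'.
Proof.
rewrite /polar expRD cosD sinD; apply/eqP; rewrite eq_complex /=.
by apply/andP; split; apply/eqP; ring.
Qed.

Lemma cn_polar s t : N (polar s t) = expR s.
Proof.
by rewrite cnE /= !exprMn -mulrDr cos2Dsin2 mulr1 sqrtr_sqr ger0_norm ?expR_ge0.
Qed.

Lemma polar_neq0 s t : polar s t != 0.
Proof. by rewrite -cn_eq0 cn_polar gt_eqF // expR_gt0. Qed.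

Lemma polar_2pi s : polar s (2 * pi) = polar s 0.
Proof.
have -> : 2 * pi = pi + pi :> R by ring.
by rewrite /polar cosD sinD cospi sinpi cos0 sin0; congr Complex; ring.
Qed.

Lemma is_derive_approx (f : R -> R) (x D : R) : is_derive x (1 : R) f D -> forall e, 0 < e ->
  exists2 d, 0 < d & forall s, `|s - x| < d ->
    `|f s - f x - (s - x) * D| <= e * `|s - x|.
Proof.
move=> fD e e0; have fd : derivable f x 1 by [].
have [d d0 H] := derivable_approx fd e0; exists d => // s /H.
by rewrite derive1E derive_val.
Qed.

(** The derivative of the exponential at 0; its functional equation [polarD] carries it to all other
    points in [polar_deriv_comp]. *)
Lemma polar_deriv0 : polar_deriv polar 0 0 1.
Proof.
move=> e e0.
have [e1 [e10 e11 e18]] : exists e1 : R, [/\ 0 < e1, e1 <= 1 & e1 <= e / 8].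
  exists (Num.min 1 (e / 8)).
  by rewrite lt_min ltr01 divr_gt0 // !ge_min !lexx orbT.
have [d1 d10 H1] := is_derive_approx (is_derive_expR (0 : R)) e10.
have [d2 d20 H2] := is_derive_approx (is_derive_cos (0 : R)) e10.
have [d3 d30 H3] := is_derive_approx (is_derive_sin (0 : R)) e10.
exists (Num.min (Num.min d1 d2) (Num.min d3 e1)); first by rewrite !lt_min d10 d20 d30 e10.
move=> s t; rewrite !subr0 !lt_min => /andP[/andP[sd1 _] /andP[_ se]].
move=> /andP[/andP[_ td2] /andP[td3 te]].
have := H1 s; rewrite subr0 => /(_ sd1); rewrite expR0 mulr1 => h1.
have := H2 t; rewrite subr0 => /(_ td2); rewrite cos0 sin0 oppr0 mulr0 subr0 => h2.
have := H3 t; rewrite subr0 => /(_ td3); rewrite cos0 sin0 subr0 mulr1 => h3.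
have S0 := normr_ge0 s; have T0 := normr_ge0 t.
apply: le_trans (cn_le _) _.
have -> : complex.Re (polar s t - polar 0 0 - 1 * (ofR s + 'i * ofR t)) =
    (expR s - 1 - s) * cos t + (1 + s) * (cos t - 1).
  by rewrite /polar /= expR0 cos0; ring.
have -> : complex.Im (polar s t - polar 0 0 - 1 * (ofR s + 'i * ofR t)) =
    (expR s - 1) * sin t + (sin t - t).
  by rewrite /polar /= sin0; ring.
have a1 : `|(expR s - 1 - s) * cos t| <= e1 * `|s|.
  rewrite normrM; apply: le_trans h1; rewrite ler_piMr //; exact: cos_max.
have a2 : `|(1 + s) * (cos t - 1)| <= 2 * (e1 * `|t|).
  rewrite normrM; apply: ler_pM => //; apply: le_trans (ler_normD _ _) _.
  rewrite normr1; lra.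
have a3 : `|expR s - 1| <= 2 * `|s|.
  have := ler_normD (expR s - 1 - s) s; rewrite subrK.
  have : e1 * `|s| <= `|s| by rewrite ler_piMl.
  lra.
have a4 : `|sin t| <= 2 * `|t|.
  have := ler_normD (sin t - t) t; rewrite subrK.
  have : e1 * `|t| <= `|t| by rewrite ler_piMl.
  lra.
have a5 : `|(expR s - 1) * sin t| <= 4 * (e1 * `|t|).
  rewrite normrM; apply: le_trans (ler_pM _ _ a3 a4) _ => //.
  have : `|s| * `|t| <= e1 * `|t| by rewrite ler_wpM2r // ltW.
  lra.
have b1 : e1 * `|s| <= e / 8 * `|s| by rewrite ler_wpM2r.
have b2 : e1 * `|t| <= e / 8 * `|t| by rewrite ler_wpM2r.
have n1 := ler_normD ((expR s - 1 - s) * cos t) ((1 + s) * (cos t - 1)).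
have n2 := ler_normD ((expR s - 1) * sin t) (sin t - t).
have es : 0 <= e * `|s| by rewrite mulr_ge0 // ltW.
have et : 0 <= e * `|t| by rewrite mulr_ge0 // ltW.
lra.
Qed.

Lemma cn_cartesian (a b : R) : N (ofR a + 'i * ofR b) <= `|a| + `|b|.
Proof. by apply: le_trans (cnD _ _) _; rewrite cnM cn_i mul1r !cn_real. Qed.

Lemma polar_deriv_comp (g : C -> C) s t c : complex_deriv g (polar s t) c ->
  polar_deriv (fun s t => g (polar s t)) s t (c * polar s t).
Proof.
move=> gc e e0; set z := polar s t.
have Nz : 0 < N z by rewrite cn_polar expR_gt0.
have c1 : 0 < N c + 1 by rewrite ltr_wpDl ?cn_ge0.
pose e1 := e / 4 / N z; have e10 : 0 < e1 by rewrite !divr_gt0.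
pose e2 := Num.min 1 (e / 2 / (N c + 1) / N z).
have e20 : 0 < e2 by rewrite lt_min ltr01 !divr_gt0.
have [d1 d10 H1] := gc e1 e10; have [d2 d20 H2] := polar_deriv0 e20.
exists (Num.min d2 (d1 / (4 * N z))); first by rewrite lt_min d20 divr_gt0 // mulr_gt0.
move=> s' t'; rewrite !lt_min => /andP[sd2]; rewrite ltr_pdivlMr ?mulr_gt0 // => sd1.
move=> /andP[td2]; rewrite ltr_pdivlMr ?mulr_gt0 // => td1.
have := H2 (s' - s) (t' - t); rewrite !subr0 => /(_ sd2 td2).
set S := `|s' - s|; set T := `|t' - t|; set D := ofR (s' - s) + 'i * ofR (t' - t).
have P00 : polar 0 0 = 1 by rewrite /polar expR0 cos0 sin0 mulr1 mulr0.
rewrite P00 mul1r => h2; rewrite -/S -/T in sd1 sd2 td1 td2 h2.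
have S0 : 0 <= S := normr_ge0 _.
have T0 : 0 <= T := normr_ge0 _.
have zE : polar s' t' = z * polar (s' - s) (t' - t).
  by rewrite -polarD ![_ + (_ - _)]addrC !subrK.
set r := polar (s' - s) (t' - t) - 1 - D in h2.
have dz : polar s' t' - z = z * (D + r) by rewrite zE /r; ring.
have DS : N D <= S + T by exact: cn_cartesian.
have e21 : e2 <= 1 by rewrite ge_min lexx.
have rS : N r <= S + T.
  by apply: le_trans h2 _; rewrite ler_piMl // addr_ge0.
have dzN : N (polar s' t' - z) <= N z * (2 * (S + T)).
  rewrite dz cnM ler_wpM2l ?(ltW Nz) //; apply: le_trans (cnD _ _) _; lra.
have h1 : N (g (polar s' t') - g z - c * (polar s' t' - z)) <= e / 2 * (S + T).
  apply: le_trans (H1 _ _) _.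
    by apply: le_lt_trans dzN _; lra.
  apply: le_trans (ler_wpM2l (ltW e10) dzN) _; rewrite /e1.
  by rewrite le_eqVlt; apply/orP; left; apply/eqP; field; rewrite gt_eqF.
have -> : g (polar s' t') - g z - c * z * D =
    (g (polar s' t') - g z - c * (polar s' t' - z)) + c * (z * r).
  by rewrite dz; ring.
apply: le_trans (cnD _ _) _.
have h3 : N (c * (z * r)) <= e / 2 * (S + T).
  rewrite !cnM.
  have q1 : N r <= e / 2 / (N c + 1) / N z * (S + T).
    by apply: le_trans h2 _; rewrite ler_wpM2r ?addr_ge0 // ge_min lexx orbT.
  have q2 : N z * N r <= e / 2 / (N c + 1) * (S + T).
    have := ler_wpM2l (ltW Nz) q1.
    have -> : N z * (e / 2 / (N c + 1) / N z * (S + T)) = e / 2 / (N c + 1) * (S + T).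
      by field; rewrite !gt_eqF.
    by [].
  apply: le_trans (ler_wpM2l (cn_ge0 c) q2) _.
  have -> : N c * (e / 2 / (N c + 1) * (S + T)) = e / 2 * (S + T) * (N c / (N c + 1)).
    by field; rewrite gt_eqF.
  rewrite ler_piMr ?mulr_ge0 ?addr_ge0 ?(ltW e0) ?invr_ge0 //.
  by rewrite ler_pdivrMr // mul1r lerDl.
lra.
Qed.

Lemma polar_deriv_continuous (H : R -> R -> C) s t b : polar_deriv H s t b ->
  forall e, 0 < e -> exists2 d, 0 < d & forall s' t', `|s' - s| < d -> `|t' - t| < d ->
    N (H s' t' - H s t) < e.
Proof.
move=> Hb e e0; have [d d0 HH] := Hb 1 ltr01.
have b1 : 0 < 1 + N b by rewrite ltr_pwDl ?cn_ge0.
exists (Num.min d (e / (1 + N b) / 2)); first by rewrite lt_min d0 !divr_gt0.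
move=> s' t'; rewrite !lt_min => /andP[/HH h1 s1] /andP[/h1 {}h1 t1].
have h2 := cn_cartesian (s' - s) (t' - t).
have h3 := ler_wpM2l (cn_ge0 b) h2; rewrite -cnM in h3.
have := cnD (H s' t' - H s t - b * (ofR (s' - s) + 'i * ofR (t' - t)))
  (b * (ofR (s' - s) + 'i * ofR (t' - t))); rewrite subrK => h4.
have h5 : (1 + N b) * (`|s' - s| + `|t' - t|) < e.
  by rewrite mulrC -ltr_pdivlMr //; lra.
lra.
Qed.

(* Goursat's theorem in logarithmic polar coordinates shows that the integral over a
   circle of [(g z - g 0) / z] does not depend on the radius; let the radius tend to 0. *)
Lemma cauchy_estimate (g : C -> C) (c0 : C) (rho B : R) : 0 < rho ->
  (forall z, N z < rho -> exists c, complex_deriv g z c) ->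
  complex_deriv g 0 c0 ->
  (forall z, N z < rho -> N (g z) <= B) ->
  N c0 <= 2 * expR 1 * B / rho.
Proof.
move=> rho0 gd g0 gB.
pose H s t := (g (polar s t) - g 0) / polar s t.
(* The outer circle has radius [rho / expR 1], whence the factor [expR 1]; the factor 2 comes from
   bounding [g z - g 0] by [B + B]. *)
pose s2 := ln rho - 1.
have es s : s < ln rho -> expR s < rho by move=> h; rewrite -(lnK rho0) ltr_expR.
have Hd s t : s < ln rho -> exists b, polar_deriv H s t b.
  move=> sl; have [|c gc] := gd (polar s t); first by rewrite cn_polar es.
  have [b qb] := complex_deriv_quotient (polar_neq0 s t) gc.
  by exists (b * polar s t); exact: (polar_deriv_comp qb).
have pi0 : 0 < 2 * pi :> R by rewrite mulr_gt0 // pi_gt0.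
have Hs2 t : N (H s2 t) <= 2 * expR 1 * B / rho.
  have s2l : s2 < ln rho by rewrite /s2; lra.
  rewrite /H cnM cnV cn_polar ler_pdivrMr ?expR_gt0 //.
  have -> : expR s2 = rho / expR 1 by rewrite /s2 expRD lnK // expRN.
  have -> : 2 * expR 1 * B / rho * (rho / expR 1) = B + B.
    by field; rewrite !gt_eqF ?expR_gt0.
  apply: le_trans (cnB _ _) _; apply: lerD; apply: gB; first by rewrite cn_polar es.
  by rewrite cn0.
apply/ler_addgt0Pr => e e0.
have [d d0 gs] := g0 e e0.
pose s1 := Num.min s2 (ln d - 1).
have s12 : s1 <= s2 by rewrite ge_min lexx.
have s1d : expR s1 < d.
  rewrite -(lnK d0) ltr_expR; have : s1 <= ln d - 1 by rewrite ge_min lexx orbT.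
  lra.
have Hs1 t : N (H s1 t - c0) <= e.
  have h := gs (polar s1 t); rewrite subr0 cn_polar in h.
  have -> : H s1 t - c0 = (g (polar s1 t) - g 0 - c0 * polar s1 t) / polar s1 t.
    by rewrite /H; field; exact: polar_neq0.
  by rewrite cnM cnV cn_polar ler_pdivrMr ?expR_gt0 // h.
(* The primitives are taken on a slightly larger interval, to be differentiable at [s1] and [s2] as
   well; [s2 + 2^-1] is still below [ln rho]. *)
have /choice [hor horP] : forall t, exists U : R -> C, forall s, s1 - 1 < s < s2 + 2^-1 ->
    curve_deriv U s (H s t).
  move=> t; apply: complex_primitive; first by lra.
  move=> s /andP[_ sl] eps eps0; have [|b Hb] := Hd s t; first by rewrite /s2 in sl; lra.
  have [d' d'0 HH] := polar_deriv_continuous Hb eps0; exists d' => // s' s's.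
  by apply: HH => //; rewrite subrr normr0.
have /choice [ver verP] : forall s, exists U : R -> C, s < ln rho ->
    forall t, -1 < t < 2 * pi + 1 -> curve_deriv U t (H s t).
  move=> s; have [sl|sl] := ltP s (ln rho); last by exists (fun=> 0).
  have [|t tt eps eps0|U UP] := @complex_primitive R (H s) (-1) (2 * pi + 1).
  - lra.
  - have [b Hb] := Hd s t sl.
    have [d' d'0 HH] := polar_deriv_continuous Hb eps0; exists d' => // s' s's.
    by apply: HH => //; rewrite subrr normr0.
  - by exists U.
have s2l : s2 < ln rho by rewrite /s2; lra.
have := @goursat R H hor ver s1 0 (s2 - s1) (2 * pi).
rewrite !add0r ![s1 + (s2 - s1)]addrC !subrK => /(_ _ (ltW pi0)) G.
have {G} : 'i * (ver s2 (2 * pi) - ver s2 0) = 'i * (ver s1 (2 * pi) - ver s1 0).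
  (* The primitives at the angles 0 and 2 pi were chosen independently, but by periodicity they have
     the same derivative, so these two edges cancel. *)
  have : hor 0 s2 - hor 0 s1 = hor (2 * pi) s2 - hor (2 * pi) s1.
    apply/subr0_eq/cn_le0.
    pose V s := hor 0 s - hor (2 * pi) s.
    have -> : hor 0 s2 - hor 0 s1 - (hor (2 * pi) s2 - hor (2 * pi) s1) = V s2 - V s1.
      by rewrite /V; ring.
    have := @mean_value_inequality R _ N V s1 s2 0 (@cnD R) (@cnN R) s12.
    rewrite mul0r; apply => s /andP[ss1 ss2] eps eps0.
    have sI : s1 - 1 < s < s2 + 2^-1 by apply/andP; split; lra.
    have eps2 : 0 < eps / 2 by rewrite divr_gt0.
    have [d3 d30 H3] := horP 0 s sI _ eps2; have [d4 d40 H4] := horP (2 * pi) s sI _ eps2.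
    exists (Num.min d3 d4); first by rewrite lt_min d30.
    move=> s'; rewrite lt_min => /andP[/H3 h3 /H4 h4].
    have HH : H s (2 * pi) = H s 0 by rewrite /H polar_2pi.
    rewrite HH in h4.
    have -> : V s' - V s = (hor 0 s' - hor 0 s - ofR (s' - s) * H s 0) -
      (hor (2 * pi) s' - hor (2 * pi) s - ofR (s' - s) * H s 0) by rewrite /V; ring.
    apply: le_trans (cnB _ _) _; rewrite add0r; lra.
  move=> E; move: G; rewrite E => G.
  apply: (addrI (hor (2 * pi) s2 - hor (2 * pi) s1)); apply: G.
  - by rewrite subr_ge0.
  - by move=> s t /andP[_ ss2] _; apply: Hd; lra.
  - by move=> s t /andP[ss1 ss2] _; apply: horP; apply/andP; split; lra.
  - move=> s t /andP[ss1 ss2] /andP[tt1 tt2]; apply: verP; first by lra.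
    by apply/andP; split; lra.
have i0 : 'i != 0 :> C by rewrite -cn_eq0 cn_i oner_eq0.
move=> /(mulfI i0) E.
have tI t : 0 <= t <= 2 * pi -> -1 < t < 2 * pi + 1.
  by move=> /andP[? ?]; apply/andP; split; lra.
have big : N (ver s2 (2 * pi) - ver s2 0) <= 2 * expR 1 * B / rho * (2 * pi - 0).
  apply: (mean_value_inequality (@cnD R) (@cnN R) (ltW pi0)) => t /tI tt eps eps0.
  have [d3 d30 H3] := verP s2 s2l t tt _ eps0; exists d3 => // t' /H3 h3.
  have := cnD (ver s2 t' - ver s2 t - ofR (t' - t) * H s2 t) (ofR (t' - t) * H s2 t).
  rewrite subrK cnM cn_real => h4.
  have := ler_wpM2l (normr_ge0 (t' - t)) (Hs2 t); lra.
have small : N (ver s1 (2 * pi) - ofR (2 * pi) * c0 - (ver s1 0 - ofR 0 * c0)) <=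
    e * (2 * pi - 0).
  apply: (@mean_value_inequality R _ N (fun t => ver s1 t - ofR t * c0)
    0 (2 * pi) e (@cnD R) (@cnN R) (ltW pi0)).
  move=> t /tI tt eps eps0.
  have s1l : s1 < ln rho by lra.
  have [d3 d30 H3] := verP s1 s1l t tt _ eps0; exists d3 => // t' /H3 h3.
  have -> : ver s1 t' - ofR t' * c0 - (ver s1 t - ofR t * c0) =
     (ver s1 t' - ver s1 t - ofR (t' - t) * H s1 t) + ofR (t' - t) * (H s1 t - c0).
    by rewrite !rmorphB; ring.
  apply: le_trans (cnD _ _) _; rewrite cnM cn_real.
  have := ler_wpM2l (normr_ge0 (t' - t)) (Hs1 t); lra.
have c0E : ofR (2 * pi) * c0 = (ver s2 (2 * pi) - ver s2 0) -
    (ver s1 (2 * pi) - ofR (2 * pi) * c0 - (ver s1 0 - ofR 0 * c0)).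
  by rewrite E rmorph0; ring.
rewrite !subr0 in big small.
have : 2 * pi * N c0 <= (2 * expR 1 * B / rho + e) * (2 * pi).
  have -> : 2 * pi * N c0 = N (ofR (2 * pi) * c0) by rewrite cnM cn_real gtr0_norm.
  rewrite c0E; apply: le_trans (cnB _ _) _.
  by apply: le_trans (lerD big small) _; rewrite -mulrDl.
by rewrite (mulrC (2 * pi)) ler_pM2r.
Qed.

End Cauchy.

(** * Local surjectivity *)

Section Grid.
Variables (k N : nat).
Implicit Types (x b : 'I_k -> nat) (s t : 'I_k) (S : {set 'I_k}) (l : seq 'I_k).
Local Notation B := 'F_2.

Definition upd x s c : 'I_k -> nat := fun i => if i == s then c else x i.
Definition step x s := upd x s (x s).+1.

Lemma updC x s t c d : s != t -> upd (upd x s c) t d = upd (upd x t d) s c.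
Proof.
move=> st; apply: funext => i; rewrite /upd.
by case: (eqVneq i t) => [->|//]; rewrite eq_sym (negPf st).
Qed.

Lemma step_upd x s c : step (upd x s c) s = upd x s c.+1.
Proof. by apply: funext => i; rewrite /step /upd eqxx; case: eqP. Qed.

Lemma stepC x s t : step (step x s) t = step (step x t) s.
Proof.
apply: funext => i; rewrite /step /upd.
have [->|it] := eqVneq i t; first by have [->|//] := eqVneq t s.
by have [e|//] := eqVneq i s; rewrite -e (negPf it).
Qed.

Lemma addFF (u : B) : u + u = 0.
Proof. by apply: addrr_pchar2; exact: pchar_Fp. Qed.

Lemma oppF (u : B) : - u = u.
Proof. by apply/eqP; rewrite eq_sym -addr_eq0 addFF. Qed.

(** Each unordered pair is counted twice, hence contributes 0 mod 2. *)
Lemma sum_symmetric_pairs (T : finType) (A : {set T}) (h : T -> T -> B) :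
  (forall s t : T, h s t = h t s) ->
  \sum_(s in A) \sum_(t in A :\ s) h s t = 0.
Proof.
move=> hC; pose lt (p q : T) := (enum_rank p < enum_rank q)%N.
rewrite (eq_bigr (fun p => \sum_(q in A | lt p q) h p q + \sum_(q in A | lt q p) h p q)).
  rewrite big_split /= [X in _ + X](exchange_big_dep (mem A)) /=; last by move=> ? ? _ /andP[].
  rewrite -big_split /= big1 // => p pA.
  rewrite [X in _ + X](eq_bigl (fun q => (q \in A) && lt p q)); last first.
    by move=> q; rewrite pA.
  rewrite -[RHS](addFF (\sum_(q in A | lt p q) h p q)); congr (_ + _).
  by apply: eq_bigr => q _.
move=> p pA; rewrite (bigID (lt p)) /=; congr (_ + _); apply: eq_bigl => q.
  rewrite !inE /lt; have [->|//] := eqVneq q p; by rewrite ltnn !andbF.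
rewrite !inE /lt -leqNgt leq_eqVlt andbC.
have [->|ts] := eqVneq q p; first by rewrite ltnn !andbF.
rewrite (inj_eq val_inj) (inj_eq enum_rank_inj) (negPf ts) /=.
by rewrite andbC.
Qed.

Variable a : 'I_k -> ('I_k -> nat) -> B.

(* The cubical cup product of the coboundaries of the functions [a j], [j] in [l],
   evaluated on the cube with lowest vertex [x] and directions [S]. *)
Fixpoint cup l S x : B :=
  if l is j :: l' then
    \sum_(s in S) (a j (step x s) + a j x) * cup l' (S :\ s) (step x s)
  else 1.

Lemma setD1C S s t : S :\ s :\ t = S :\ t :\ s.
Proof. by apply/setP => i; rewrite !inE andbCA. Qed.

(** A cup product of coboundaries is a cocycle: the sums over upper and lower faces agree mod 2. In
    the induction, what remains is symmetric in two directions [s], [t] and cancels in pairs. *)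
Lemma cup_closed l S x :
  \sum_(s in S) cup l (S :\ s) (step x s) = \sum_(s in S) cup l (S :\ s) x.
Proof.
elim: l S x => [|j l IH] S x /=; first by [].
pose W s t := cup l (S :\ s :\ t) (step (step x s) t).
have -> : \sum_(s in S) \sum_(t in S :\ s)
    (a j (step x t) + a j x) * cup l (S :\ s :\ t) (step x t) =
  \sum_(s in S) \sum_(t in S :\ s) (a j (step x s) + a j x) * W s t.
  rewrite (exchange_big_dep (mem S)) /=; last by move=> s t _; rewrite !inE => /andP[].
  apply: eq_bigr => t tS.
  rewrite (eq_bigl (mem (S :\ t))); last first.
    by move=> s /=; rewrite !inE tS andbT eq_sym andbC.
  rewrite -!mulr_sumr; congr (_ * _).
  by rewrite /W [RHS]IH; apply: eq_bigr => s _; rewrite setD1C.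
apply/eqP; rewrite -subr_eq0 oppF -big_split /=; apply/eqP.
rewrite -[RHS](@sum_symmetric_pairs _ S (fun s t => (a j (step (step x s) t) + a j x) * W s t)).
  apply: eq_bigr => s _; rewrite -big_split /=; apply: eq_bigr => t _.
  rewrite -/(W s t) -mulrDl; congr (_ * _).
  by rewrite addrA -(addrA (a j _)) addFF addr0.
by move=> s t; rewrite /W setD1C stepC.
Qed.

Fixpoint box l (g : ('I_k -> nat) -> B) b : B :=
  if l is s :: l' then \sum_(i < N) box l' g (upd b s i) else g b.

Lemma eq_box l g h b : g =1 h -> box l g b = box l h b.
Proof.
by move=> gh; elim: l b => [|s l IH] b //=; apply: eq_bigr => i _.
Qed.

Lemma box_sum (I : Type) (r : seq I) (Q : pred I) l (G : I -> ('I_k -> nat) -> B) b :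
  box l (fun x => \sum_(i <- r | Q i) G i x) b = \sum_(i <- r | Q i) box l (G i) b.
Proof.
elim: l b => [|s l IH] b //=.
by under eq_bigr do rewrite IH; rewrite exchange_big.
Qed.

Lemma box_upd l g b s c : s \notin l ->
  box l g (upd b s c) = box l (fun x => g (upd x s c)) b.
Proof.
elim: l b => [|t l IH] b //=; rewrite inE negb_or => /andP[st sl].
by apply: eq_bigr => i _; rewrite updC // IH.
Qed.

Lemma box_rem l g b s : s \in l -> box l g b = box (s :: rem s l) g b.
Proof.
elim: l b => [|t l IH] b //=; rewrite inE; have [->|ts] := eqVneq s t => //= sl.
transitivity (\sum_(i < N) box (s :: rem s l) g (upd b t i)).
  by apply: eq_bigr => i _; exact: IH.
rewrite /= exchange_big; apply: eq_bigr => i _; apply: eq_bigr => j _.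
by rewrite updC // eq_sym.
Qed.

(** Discrete Stokes formula in direction [s]: mod 2 the inner terms cancel and the two end faces
    remain. *)
Lemma box_telescope l g b s : uniq l -> s \in l ->
  box l (fun x => g (step x s) + g x) b =
  box (rem s l) (fun x => g (upd x s N) + g (upd x s 0)) b.
Proof.
move=> ul sl; rewrite (box_rem _ _ sl) /=.
have sr : s \notin rem s l by rewrite mem_rem_uniq // !inE eqxx.
under eq_bigr do rewrite box_upd //.
rewrite -box_sum; apply: eq_box => x.
under eq_bigr do rewrite step_upd.
elim: N => [|n IH]; first by rewrite big_ord0 addFF.
rewrite big_ord_recr /= IH.
by rewrite addrC -addrA (addrA (g (upd x s n))) addFF add0r.
Qed.

Hypothesis a_low : forall j x, x j = 0%N -> a j x = 0.
Hypothesis a_high : forall j x, x j = N -> a j x = 1.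

(** On a face where coordinate [s] stays 0 or stays [N], the label [a s] is constant, so its
    coboundary, one of the factors, vanishes. *)
Lemma cup_face l S x s : s \in l -> s \notin S -> (x s = 0 \/ x s = N)%N ->
  cup l S x = 0.
Proof.
elim: l S x => [|j l IH] S x //=; rewrite inE => sl sS xs.
rewrite big1 // => t tS; have st : s != t by apply: contraNneq sS => ->.
have xts : step x t s = x s by rewrite /step /upd (negPf st).
case/predU1P: sl => [<-|sl].
  suff -> : a s (step x t) = a s x by rewrite addFF mul0r.
  by case: xs => xs; [rewrite !a_low ?xts|rewrite !a_high ?xts].
rewrite (IH _ (step x t)) ?mulr0 ?xts //.
by rewrite !inE negb_and negbK sS orbT.
Qed.

(** By [cup_closed], the product is the coboundary of [a j] times the product over [l], so only
    boundary faces count. Those in directions other than [j] vanish by [cup_face], the lower one in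
    direction [j] has [a j = 0], and the upper one, with [a j = 1], is the same sum in one dimension
    less. *)
Lemma box_cup l b : uniq l -> box l (cup l [set s in l]) b = 1.
Proof.
elim: l b => [//|j l IH] b /andP[jl ul].
pose S := [set s in j :: l]; rewrite -/S.
have SjE : S :\ j = [set s in l].
  by apply/setP => i; rewrite !inE; have [->|] := eqVneq i j; rewrite //= (negPf jl).
pose g s x := a j x * cup l (S :\ s) x.
have jul : uniq (j :: l) by rewrite /= jl.
have gE x : \sum_(s in S) (a j (step x s) + a j x) * cup l (S :\ s) (step x s) =
    \sum_(s in S) (g s (step x s) + g s x).
  under eq_bigr do rewrite mulrDl.
  rewrite !big_split /=; congr (_ + _).
  by rewrite -!mulr_sumr cup_closed.
pose H s := box (j :: l) (fun x => g s (step x s) + g s x) b.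
rewrite (@eq_box (j :: l) _ _ b gE) box_sum -[LHS]/(\sum_(s in S) H s).
rewrite (bigD1 j) /=; last by rewrite !inE eqxx.
rewrite [X in _ + X]big1 ?addr0 => [|s /andP[sS sj]]; rewrite /H.
  rewrite (@box_telescope (j :: l)) ?inE ?eqxx // /= eqxx.
  rewrite -[RHS](IH (upd b j N) ul) box_upd //.
  apply: eq_box => x; rewrite /g a_high ?a_low /upd ?eqxx // mul1r mul0r addr0.
  by rewrite SjE.
have sl : s \in l by move: sS; rewrite !inE (negPf sj).
rewrite (@box_telescope (j :: l)) ?inE ?sl ?orbT //.
rewrite (@eq_box _ _ (fun=> \sum_(i < 0) (0 : B))) ?box_sum ?big_ord0 // => x.
have g0 c : (c = 0 \/ c = N)%N -> g s (upd x s c) = 0.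
  by move=> c0N; rewrite /g (@cup_face _ _ _ s) ?mulr0 ?inE ?eqxx // /upd eqxx.
by rewrite !g0 ?addr0; [|left|right].
Qed.

Lemma box_neq0 l g b : box l g b != 0 -> exists x, [/\ g x != 0,
  forall i, i \in l -> (x i < N)%N & forall i, i \notin l -> x i = b i].
Proof.
elim: l b => [|s l IH] b /= gb; first by exists b; split.
have [i gi] : exists i : 'I_N, box l g (upd b s i) != 0.
  apply/existsP; apply: contraNT gb => /existsPn h.
  by rewrite big1 // => i _; have := h i; rewrite negbK => /eqP.
have [x [gx xl xb]] := IH _ gi; exists x; split => // t; rewrite inE.
  case/predU1P => [->|]; last exact: xl.
  have [sl|sl] := boolP (s \in l); first exact: xl.
  by rewrite xb // /upd eqxx.
by rewrite negb_or => /andP[ts tl]; rewrite xb // /upd (negPf ts).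
Qed.

Lemma cup_neq0 l S x : cup l S x != 0 -> forall j, j \in l -> exists y y',
  [/\ forall i, (x i <= y i <= x i + (i \in S))%N,
      forall i, (x i <= y' i <= x i + (i \in S))%N & a j y != a j y'].
Proof.
elim: l S x => [|t l IH] S x //= h j.
have [s sS hs] : exists2 s, s \in S &
    (a t (step x s) + a t x) * cup l (S :\ s) (step x s) != 0.
  apply/exists_inP; apply: contraNT h => /exists_inPn h.
  by rewrite big1 // => i iS; have := h i iS; rewrite negbK => /eqP.
have [h1 h2] : a t (step x s) + a t x != 0 /\ cup l (S :\ s) (step x s) != 0.
  by split; apply: contraNneq hs => ->; rewrite ?mul0r ?mulr0.
rewrite inE => /predU1P [->|jl].
  exists (step x s), x; split=> [i|i|].
  - rewrite /step /upd; have [->|_] := eqVneq i s; last by rewrite leqnn leq_addr.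
    by rewrite sS leqnSn addn1 leqnn.
  - by rewrite leqnn leq_addr.
  - by apply: contraNneq h1 => ->; rewrite addFF.
have [y [y' [yx y'x ay]]] := IH _ _ h2 j jl; exists y, y'; split => // i.
  have := yx i; rewrite !inE /step /upd; have [->|_] //= := eqVneq i s.
  by rewrite sS addn0 addn1 => /andP[/ltnW -> ->].
have := y'x i; rewrite !inE /step /upd; have [->|_] //= := eqVneq i s.
by rewrite sS addn0 addn1 => /andP[/ltnW -> ->].
Qed.

(** A cubical relative of Sperner's lemma: the total is odd, so some unit cube has a nonzero cup
    product, and there every label must change along some edge. *)
Lemma grid_crossing : exists x, (forall i, (x i < N)%N) /\
  forall j, exists y y', [/\ forall i, (x i <= y i <= (x i).+1)%N,
      forall i, (x i <= y' i <= (x i).+1)%N & a j y != a j y'].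
Proof.
have := box_cup (fun=> 0%N) (enum_uniq 'I_k).
move=> /(congr1 (fun u : B => u != 0)); rewrite oner_eq0 => /box_neq0 [x [xc xN _]].
exists x; split=> [i|j]; first by rewrite xN ?mem_enum.
have [|y [y' [yx y'x ay]]] := cup_neq0 xc (j := j); first by rewrite mem_enum.
exists y, y'; split => // i.
  by have := yx i; rewrite inE mem_enum /= addn1.
by have := y'x i; rewrite inE mem_enum /= addn1.
Qed.

End Grid.

(** * From the grid to continuous maps *)

Section RealSurj.
Variable R : realType.
Local Notation F := (rc_scalar R RealScalars).

Lemma vn_le_cube k (w : 'rV[F]_k) (s : R) : (forall i, `|w 0 i : R| <= s) ->
  vn w <= k%:R * s.
Proof.
by move=> ws; rewrite -[k in k%:R]mul1n; apply: vn_le => i j; rewrite ord1; exact: ws.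
Qed.

(* Poincare-Miranda for maps close to the identity. *)
Lemma near_id_surj k (g : 'rV[F]_k -> 'rV[F]_k) (s : R) (y : 'rV[F]_k) : 0 < s ->
  (forall w : 'rV[F]_k, (forall i, `|w 0 i : R| <= s) -> vn (g w - w) <= s / 4) ->
  (forall w : 'rV[F]_k, (forall i, `|w 0 i : R| <= s) -> forall e : R, 0 < e ->
     exists2 d : R, 0 < d & forall w', vn (w' - w) < d -> vn (g w' - g w) < e) ->
  vn y < s / 2 ->
  exists2 w : 'rV[F]_k, (forall i, `|w 0 i : R| <= s) & g w = y.
Proof.
move=> s0 gw gc ys.
(* Grid points of mesh [2 * s / M.+1]; [minn] keeps arbitrary indices in the cube. *)
pose p M (x : 'I_k -> nat) : 'rV[F]_k :=
  \row_i ((- s + 2 * s * ((minn (x i) M.+1)%:R / M.+1%:R)) : R).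
have pE M x i : (p M x 0 i : R) = - s + 2 * s * ((minn (x i) M.+1)%:R / M.+1%:R).
  by rewrite mxE.
have M0 (M : nat) : 0 < M.+1%:R :> R by [].
have cube M x i : `|p M x 0 i : R| <= s.
  rewrite pE ler_norml; set t := _ / _.
  have t0 : 0 <= t by rewrite divr_ge0.
  have t1 : t <= 1 by rewrite ler_pdivrMr // mul1r ler_nat geq_minr.
  by apply/andP; split; nra.
have entry (v : 'rV[F]_k) i : `|v 0 i : R| <= vn v := rn_le_vn v 0 i.
have gB (w : 'rV[F]_k) i : (forall i, `|w 0 i : R| <= s) ->
    `|(g w 0 i : R) - (w 0 i : R)| <= s / 4.
  by move=> ws; apply: le_trans (gw w ws); have := entry (g w - w) i; rewrite !mxE.
have yB i : `|y 0 i : R| < s / 2 by apply: le_lt_trans ys; exact: entry.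
(* The label records the sign of the j-th coordinate of g - y. On the face at -s that coordinate is
   negative and on the face at s positive, since [g] moves points by at most s / 4 and [y] is below
   s / 2. *)
pose a M j x : 'F_2 := if (y 0 j : R) <= (g (p M x) 0 j : R) then 1 else 0.
have aux1 (G Y : R) : `|Y| < s / 2 -> `|G - - s| <= s / 4 -> Y <= G -> False.
  by rewrite ler_norml ltr_norml => /andP[? ?] /andP[? ?] ?; lra.
have aux2 (G Y : R) : `|Y| < s / 2 -> `|G - (- s + 2 * s * 1)| <= s / 4 -> G < Y -> False.
  by rewrite ler_norml ltr_norml => /andP[? ?] /andP[? ?] ?; lra.
have aux3 (A B G Y e : R) : `|A - G| < e -> `|B - G| < e -> A <= Y -> Y <= B -> `|G - Y| <= e.
  by rewrite !ltr_norml ler_norml => /andP[? ?] /andP[? ?] ? ?; apply/andP; split; lra.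
have a_low M j x : x j = 0%N -> a M j x = 0.
  move=> xj; rewrite /a; case: ifP => // h.
  have := gB (p M x) j (cube M x); rewrite pE xj min0n mul0r mulr0 addr0.
  by move=> h'; case: (aux1 _ _ (yB j) h' h).
have a_high M j x : x j = M.+1 -> a M j x = 1.
  move=> xj; rewrite /a; case: ifP => // /negbT; rewrite -ltNge => h.
  have := gB (p M x) j (cube M x); rewrite pE xj minnn divff ?gt_eqF //.
  by move=> h'; case: (aux2 _ _ (yB j) h' h).
have /choice [u uP] : forall M, exists u : 'rV[F]_k, (forall i, `|u 0 i : R| <= s) /\
    forall j, exists q q' : 'rV[F]_k, [/\ vn (q - u) <= k%:R * (2 * s / M.+1%:R),
      vn (q' - u) <= k%:R * (2 * s / M.+1%:R), (g q 0 j : R) <= (y 0 j : R) &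
      (y 0 j : R) <= (g q' 0 j : R)].
  move=> M; have [x [xM xa]] := grid_crossing (a_low M) (a_high M).
  exists (p M x); split => [i|j]; first exact: cube.
  have close z : (forall i, (x i <= z i <= (x i).+1)%N) ->
      vn (p M z - p M x) <= k%:R * (2 * s / M.+1%:R).
    move=> zx; apply: vn_le_cube => i.
    have -> : ((p M z - p M x) 0 i : R) = (p M z 0 i : R) - (p M x 0 i : R) by rewrite !mxE.
    rewrite !pE; have /andP[z1 z2] := zx i.
    rewrite (minn_idPl (ltnW (xM i))) (minn_idPl (leq_trans z2 (xM i))).
    have -> : - s + 2 * s * ((z i)%:R / M.+1%:R) - (- s + 2 * s * ((x i)%:R / M.+1%:R)) =
       2 * s / M.+1%:R * ((z i)%:R - (x i)%:R) by ring.
    have c0 : 0 <= 2 * s / M.+1%:R by rewrite divr_ge0 // mulr_ge0 // ltW.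
    rewrite normrM ger0_norm // ler_piMr // -natrB // normr_nat.
    by rewrite -[1]/1%:R ler_nat leq_subLR addn1.
  have [q [q' [/close qx /close q'x]]] := xa j.
  rewrite /a; case: ifP => h1; case: ifP => h2; rewrite ?eqxx // => _.
    exists (p M q'), (p M q); split => //.
    by move/negbT: h2; rewrite -ltNge => /ltW.
  exists (p M q), (p M q'); split => //.
  by move/negbT: h1; rewrite -ltNge => /ltW.
pose C := [set v : 'rV[R]_k | forall i, v ord0 i \in `[(- s), s]].
have Cc : compact C.
  apply: (@rV_compact _ _ (fun=> `[(- s), s]%classic)).
  by move=> _; apply: segment_compact.
have inC (v : 'rV[R]_k) : C v <-> forall i, `|v 0 i| <= s.
  by split=> H i; have := H i; rewrite in_itv /= ler_norml.
have uC : ((u : nat -> 'rV[R]_k) @ \oo) C.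
  by exists 0%N => // M _; apply/inC; have [] := uP M.
(* A cluster point of the crossing cubes of finer and finer grids. Each coordinate of g - y takes
   both signs arbitrarily near [w], so it vanishes at [w] by continuity. *)
have [w [/inC ws wc]] := Cc _ _ uC.
exists w => //; apply/rowP => j.
suff H e : 0 < e -> `|(g w 0 j : R) - (y 0 j : R)| <= e.
  by apply/eqP; rewrite -subr_eq0 -normr_le0; apply/ler_addgt0Pr => e /H; rewrite add0r.
move=> e0; have [d d0 gd] := gc w ws e e0.
have d2 : 0 < d / 2 by rewrite divr_gt0.
pose M0' := Num.bound (k%:R * (2 * s) / (d / 2)).
have [v [[M /= M0M uMv] vw]] : ((u : nat -> 'rV[R]_k) @` [set M | (M0' <= M)%N]) `&`
    [set v : 'rV[R]_k | @vn R RealScalars 1 k (v - w) < d / 2] !=set0.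
  apply: wc; first by exists M0' => // M /= MM; exists M.
  by apply/(@nbhs_vnP R RealScalars); exists (d / 2).
rewrite -uMv /= in vw; have [uMs Mj] := uP M.
have [q [q' [qu q'u gq gq']]] := Mj j.
have mesh : k%:R * (2 * s / M.+1%:R) < d / 2.
  have hb : k%:R * (2 * s) / (d / 2) < M.+1%:R.
    apply: (@lt_le_trans _ _ M0'%:R); last by rewrite ler_nat (leq_trans M0M).
    by apply: archi_boundP; rewrite divr_ge0 ?(ltW d2) // mulr_ge0 // mulr_ge0 // ltW.
  by rewrite mulrA ltr_pdivrMr // -ltr_pdivrMl // [ltLHS]mulrC.
have near_w p' : vn (p' - u M) <= k%:R * (2 * s / M.+1%:R) -> vn (p' - w) < d.
  move=> pu; apply: le_lt_trans (vn_dist_trans (u M) p' w) _.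
  by rewrite [ltRHS]splitr; apply: ltrD; [exact: le_lt_trans pu mesh|exact: vw].
have entry_lt p' : vn (g p' - g w) < e -> `|(g p' 0 j : R) - (g w 0 j : R)| < e.
  by move=> h; apply: le_lt_trans h; have := entry (g p' - g w) j; rewrite !mxE.
exact: (aux3 _ _ _ _ _ (entry_lt _ (gd _ (near_w _ qu))) (entry_lt _ (gd _ (near_w _ q'u))) gq gq').
Qed.

(** Differentiability of [psi] gives no strict estimate at [z], so contraction is out of reach. The
    derivative at [z] alone makes [g] close to the identity on a small cube, and on [L]
    differentiability gives continuity: enough for [near_id_surj]. *)
Lemma real_local_surj k (L : set 'rV[F]_k) (psi : 'rV[F]_k -> 'rV[F]_k) z A :
  open L -> differentiable_on L psi -> L z -> diff_at psi z A -> A \in unitmx ->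
  forall rho : R, 0 < rho -> exists2 d : R, 0 < d & forall y, vn (y - psi z) < d ->
    exists w, [/\ vn (w - z) < rho, L w & psi w = y].
Proof.
move=> oL psiL Lz psid Au rho rho0; pose B := invmx A.
have B0 := vn_ge0 B; have B1 : 0 < vn B + 1 by lra.
pose g w := (psi (z + w) - psi z) *m B.
have k1 : 0 < k.+1%:R :> R by [].
(* A vector of the cube has l1 norm at most [k.+1%:R * s], so this precision yields the bound
   [s / 4]; the successor covers k = 0. *)
pose e : R := (4 * k.+1%:R)^-1 / (vn B + 1).
have e0 : 0 < e by rewrite divr_gt0 // invr_gt0 mulr_gt0.
have [d0 d00 H0] := psid e e0.
have [d1 d10 H1] := (open_vnP L).1 oL z Lz.
pose mn := Num.min (Num.min d0 d1) rho.
have mn0 : 0 < mn by rewrite !lt_min d00 d10.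
pose s := mn / k.+1%:R / 2.
have s0 : 0 < s by rewrite !divr_gt0.
have small (w : 'rV[F]_k) : (forall i, `|w 0 i : R| <= s) -> vn w < mn.
  move=> /vn_le_cube h; apply: le_lt_trans h _.
  apply: (@le_lt_trans _ _ (k.+1%:R * s)); first by rewrite ler_wpM2r ?ler_nat ?ltW.
  by rewrite /s mulrA (mulrC k.+1%:R) divfK ?gt_eqF //; lra.
have gw (w : 'rV[F]_k) : (forall i, `|w 0 i : R| <= s) -> vn (g w - w) <= s / 4.
  move=> ws; have := small w ws; rewrite !lt_min => /andP[/andP[wd0 _] _].
  have -> : g w - w = (psi (z + w) - psi z - w *m A) *m B.
    by rewrite [in RHS]mulmxBl mulmxK.
  have := H0 (z + w); rewrite addrAC subrr add0r => /(_ wd0) h.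
  apply: le_trans (vnM _ _) _; apply: le_trans (ler_wpM2r B0 h) _.
  have kw : vn w <= k.+1%:R * s.
    apply: le_trans (vn_le_cube ws) _; rewrite ler_wpM2r ?ler_nat ?ltW //.
  apply: le_trans (_ : e * (k.+1%:R * s) * (vn B + 1) <= _).
    apply: ler_pM => //; first by rewrite mulr_ge0 ?vn_ge0 ?ltW.
      by rewrite ler_wpM2l // ltW.
    by rewrite lerDl.
  rewrite mulrAC /e divfK ?gt_eqF // invfM -mulrA mulKf ?gt_eqF // mulrC.
  exact: lexx.
have gc (w : 'rV[F]_k) : (forall i, `|w 0 i : R| <= s) -> forall e : R, 0 < e ->
     exists2 d : R, 0 < d & forall w', vn (w' - w) < d -> vn (g w' - g w) < e.
  move=> ws eps eps0; have := small w ws; rewrite !lt_min => /andP[/andP[_ wd1] _].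
  have Lw : L (z + w) by apply: H1; rewrite addrAC subrr add0r.
  have eB : 0 < eps / (vn B + 1) by rewrite divr_gt0.
  have [d dd Hd] := diff_at_continuous (differentiable_diff_at (psiL _ Lw)) eB.
  exists d => // w' w'd.
  have -> : g w' - g w = (psi (z + w') - psi (z + w)) *m B.
    by rewrite /g -mulmxBl opprB addrA subrK.
  have := Hd (z + w'); rewrite opprD addrACA subrr add0r => /(_ w'd).
  rewrite ltr_pdivlMr // => h; apply: le_lt_trans (vnM _ _) _; apply: le_lt_trans h.
  by rewrite ler_wpM2l ?vn_ge0 // lerDl.
exists (s / 2 / (vn B + 1)); first by rewrite !divr_gt0.
move=> y; rewrite ltr_pdivlMr // => yd.
have [|w ws gwy] := near_id_surj (y := (y - psi z) *m B) s0 gw gc.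
  apply: le_lt_trans (vnM _ _) _; apply: le_lt_trans yd.
  by rewrite ler_wpM2l ?vn_ge0 // lerDl.
have := small w ws; rewrite !lt_min => /andP[/andP[_ wd1] wr].
exists (z + w); split.
- by rewrite addrAC subrr add0r.
- by apply: H1; rewrite addrAC subrr add0r.
- by move: gwy => /(can_inj (mulmxKV Au)) /addIr.
Qed.

End RealSurj.

Lemma line_remainder (F : fieldType) p q (X Y P U V A : 'M[F]_(p, q)) s i j :
  (X - (P + s *: U) - A) i j - (Y - P - A) i j - (V - U) i j * s = (X - Y - s *: V) i j.
Proof. by rewrite !mxE; ring. Qed.

(* Along a complex line, the Cauchy estimate turns the bound on the remainder of [f] at
   [a], valid in a whole ball, into a bound on the variation of the Jacobian. *)
Lemma complex_strict_at (R : realType) m n (D : set 'rV[rc_scalar R ComplexScalars]_m)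
    (f : 'rV[rc_scalar R ComplexScalars]_m -> 'rV[rc_scalar R ComplexScalars]_n) a :
  open D -> differentiable_on D f -> D a -> strict_at f a ('J f a).
Proof.
move=> oD fD Da e e0; set J := 'J f a.
have ex0 := expR_gt0 (1 : R).
have n0 : 0 <= (1 * n)%:R :> R by [].
(* Cauchy's estimate contributes [2 * expR 1], the ratio [d / rho] below another factor 2, and the
   entries are summed. *)
pose k := (1 * n)%:R * (4 * expR 1) + 1 : R.
have k0 : 0 < k by rewrite ltr_wpDl // mulr_ge0 // mulr_ge0 // ltW.
pose e1 := e / k; have e10 : 0 < e1 by rewrite divr_gt0.
have [d1 d10 H1] := (open_vnP D).1 oD a Da.
have [d2 d20 H2] := differentiable_diff_at (fD a Da) e10.
have [d [d0 dd1 dd2]] : exists d, [/\ 0 < d, d <= d1 & d <= d2].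
  by exists (Num.min d1 d2); rewrite lt_min d10 d20 !ge_min !lexx orbT.
exists (d / 4); first by rewrite divr_gt0.
move=> x y xd yd; apply: segment_mean_value xd yd _ => p pd.
have Dp : D p by apply: H1; lra.
exists ('J f p); first exact/differentiable_diff_at/fD.
set v := x - y.
have [->|v0] := eqVneq v 0; first by rewrite mul0mx !vn0 mulr0.
have {v0}v0 : 0 < vn v.
  by rewrite ltNge; apply: contra v0 => v0; apply/eqP; exact: vn0_eq0.
(* Then [t *: v] is shorter than d / 2, and since [p] is within d / 4 of [a] the line stays in the
   ball of radius [d]. *)
pose rho := d / (2 * vn v); have rho0 : 0 < rho by rewrite divr_gt0 // mulr_gt0.
pose q t := p + t *: v.
have q0 : q 0 = p by rewrite /q scale0r addr0.
have qB w t : q w - q t = (w - t) *: v by rewrite /q opprD addrACA subrr add0r scalerBl.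
have qd t : rn t < rho -> vn (q t - a) < d.
  rewrite ltr_pdivlMr ?mulr_gt0 // => tr.
  have -> : q t - a = (p - a) + t *: v by rewrite /q addrAC.
  by apply: le_lt_trans (vnD _ _) _; rewrite vnZ; lra.
have Ej i j : rn ((v *m ('J f p - J)) i j) <= 2 * expR 1 * (e1 * d) / rho.
  (* An entry of the remainder of [f] at [a] along the line: it is at most [e1 * d] there, and its
     derivative at 0 is the entry to be bounded. *)
  pose g (t : R[i]) : R[i] := ((f (q t) - q t *m J) - (f a - a *m J)) i j.
  have gd (t : R[i]) : rn (K := ComplexScalars) t < rho ->
      @complex_deriv R g t ((v *m ('J f (q t) - J)) i j).
    move=> tr e' e'0.
    have Dq : D (q t) by apply: H1; have := qd t tr; lra.
    have [|d' d'0 H] := differentiable_diff_at (fD _ Dq) (e := e' / vn v).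
      by rewrite divr_gt0.
    exists (d' / vn v) => [|w]; first by rewrite divr_gt0.
    rewrite ltr_pdivlMr // => wt.
    have := H (q w); rewrite qB vnZ => /(_ wt).
    rewrite mulrCA divfK ?gt_eqF // => h.
    rewrite [leRHS]mulrC; apply: le_trans h; apply: le_trans (rn_le_vn _ i j).
    rewrite le_eqVlt; apply/orP; left; apply/eqP; congr rn.
    rewrite -scalemxAl /g mulmxBr.
    have -> : q w = q t + (w - t) *: v by rewrite -qB addrC subrK.
    rewrite mulmxDl -scalemxAl; exact: line_remainder.
  have g0 : @complex_deriv R g 0 ((v *m ('J f p - J)) i j).
    by have := gd 0; rewrite q0; apply; rewrite rn0.
  apply: (cauchy_estimate rho0 _ g0) => t tr; first by eexists; exact: gd tr.
  have tq := qd t tr; have /H2 h : vn (q t - a) < d2 by lra.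
  have -> : g t = (f (q t) - f a - (q t - a) *m J) i j.
    by rewrite /g mulmxBl !mxE; ring.
  apply: le_trans (rn_le_vn _ i j) _; apply: le_trans h _.
  by rewrite ler_pM2l // ltW.
apply: le_trans (vn_le Ej) _.
have -> : 2 * expR 1 * (e1 * d) / rho = 4 * expR 1 * e1 * vn v.
  by rewrite /rho; field; rewrite !gt_eqF.
rewrite mulrA ler_pM2r //.
have -> : (1 * n)%:R * (4 * expR 1 * e1) = e * ((k - 1) / k).
  by rewrite [k - 1]addrK /e1; field; rewrite gt_eqF.
by rewrite ler_piMr ?(ltW e0) // ler_pdivrMr // mul1r gerBl.
Qed.

Lemma smooth_differentiable (R : realType) (K : rc_kind) m n (D : set 'rV[rc_scalar R K]_m)
    (f : 'rV[rc_scalar R K]_m -> 'rV[rc_scalar R K]_n) :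
  smooth D f -> differentiable_on D f.
Proof. by move: D f; case: K => D f //= []. Qed.

Lemma smooth_strict_at (R : realType) (K : rc_kind) m n (D : set 'rV[rc_scalar R K]_m)
    (f : 'rV[rc_scalar R K]_m -> 'rV[rc_scalar R K]_n) a :
  open D -> smooth D f -> D a -> strict_at f a ('J f a).
Proof.
by move: D f a; case: K => D f a; [exact: real_strict_at|exact: complex_strict_at].
Qed.

(** A holomorphic [psi] is strictly differentiable, so the contraction argument applies. *)
Lemma complex_local_surj (R : realType) k (L : set 'rV[rc_scalar R ComplexScalars]_k)
    (psi : 'rV[rc_scalar R ComplexScalars]_k -> 'rV[rc_scalar R ComplexScalars]_k) z A :
  open L -> differentiable_on L psi -> L z -> diff_at psi z A -> A \in unitmx ->
  forall rho : R, 0 < rho -> exists2 d : R, 0 < d & forall y, vn (y - psi z) < d ->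
    exists w, [/\ vn (w - z) < rho, L w & psi w = y].
Proof.
move=> oL psiL Lz psid Au rho rho0.
have [r r0 Lr] := (open_vnP L).1 oL z Lz.
have psis : strict_at psi z A.
  have -> : A = 'J psi z by have [_ ->] := diff_at_differentiable psid.
  exact: complex_strict_at oL psiL Lz.
have [|d d0 H] := strict_local_surj psis Au (rho := Num.min rho r).
  by rewrite lt_min rho0.
exists d => // y /H [w]; rewrite lt_min => /andP[wr /Lr Lw] wy.
by exists w.
Qed.

Lemma differentiable_local_surj (R : realType) (K : rc_kind) k (L : set 'rV[rc_scalar R K]_k)
    (psi : 'rV[rc_scalar R K]_k -> 'rV[rc_scalar R K]_k) z A :
  open L -> differentiable_on L psi -> L z -> diff_at psi z A -> A \in unitmx ->
  forall rho : R, 0 < rho -> exists2 d : R, 0 < d & forall y, vn (y - psi z) < d ->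
    exists w, [/\ vn (w - z) < rho, L w & psi w = y].
Proof.
by move: L psi z A; case: K => L psi z A; [exact: real_local_surj|exact: complex_local_surj].
Qed.

(** * Straightening the zero set *)

(** Stated with an equation on [k], to absorb the dependent height of [row_base]. *)
Lemma row_free_basis (F : fieldType) m n k (A : 'M[F]_(m, n)) : k = \rank A ->
  exists B : 'M[F]_(k, n), row_free B /\ (B :=: A)%MS.
Proof.
by move=> ->; exists (row_base A); split; [exact: row_base_free|exact: eq_row_base].
Qed.

Section Chart.
Variables (R : realType) (K : rc_kind).
Local Notation F := (rc_scalar R K).
Variables (m n : nat) (D : set 'rV[F]_m) (f : 'rV[F]_m -> 'rV[F]_n).
Variables (a : 'rV[F]_m) (eps rho : R).
Variables (J : 'M[F]_(m, n)) (P : 'M[F]_(n, m)).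
Hypothesis JE : 'J f a = J.
Hypothesis pinvJ : J *m P *m J = J.
Hypothesis fD : differentiable_on D f.
Hypothesis fa : f a = 0.
Hypothesis rho0 : 0 < rho.
Hypothesis epsP : eps * vn P <= 2^-1.
Hypothesis ballD : forall x, vn (x - a) < rho -> D x.
Hypothesis fstrict : forall x y, vn (x - a) < rho -> vn (y - a) < rho ->
  vn (f x - f y - (x - y) *m J) <= eps * vn (x - y).

(* [J *m P] projects onto a complement of the kernel of [J], so [straighten] has
   derivative 1 at [a] and maps the zeros of [f] into that kernel. *)
Definition straighten (x : 'rV[F]_m) := x - a + (f x - (x - a) *m J) *m P.

Lemma straightenB x y : straighten x - straighten y =
  (x - y) + (f x - f y - (x - y) *m J) *m P.
Proof.
have -> : x - y = (x - a) - (y - a) by rewrite opprB addrA subrK.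
rewrite /straighten !mulmxBl.
by apply/rowP => i; rewrite !mxE; ring.
Qed.

Lemma straighten_a : straighten a = 0.
Proof. by rewrite /straighten fa !subrr mul0mx subr0 mul0mx addr0. Qed.

(** By [epsP] the nonlinear part has Lipschitz constant 1/2, so distances shrink at most by half;
    this gives injectivity and a Lipschitz inverse. *)
Lemma straighten_expand x y : vn (x - a) < rho -> vn (y - a) < rho ->
  vn (x - y) <= 2 * vn (straighten x - straighten y).
Proof.
move=> xr yr; rewrite straightenB; set E := _ - _ - _.
have h1 : vn E <= eps * vn (x - y) by exact: fstrict.
have h2 := vnM E P.
have h3 : vn E * vn P <= 2^-1 * vn (x - y).
  apply: le_trans (ler_wpM2r (vn_ge0 _) h1) _.
  by rewrite mulrAC ler_wpM2r ?vn_ge0.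
have := vnB (x - y + E *m P) (E *m P); rewrite addrK; lra.
Qed.

Lemma straighten_lipschitz x : vn (x - a) < rho ->
  vn (straighten x) <= 2 * vn (x - a).
Proof.
move=> xr; rewrite -[straighten x]subr0 -straighten_a straightenB; set E := _ - _ - _.
have h1 : vn E <= eps * vn (x - a) by apply: fstrict => //; rewrite subrr vn0.
have h2 := vnM E P.
have h3 : vn E * vn P <= 2^-1 * vn (x - a).
  apply: le_trans (ler_wpM2r (vn_ge0 _) h1) _.
  by rewrite mulrAC ler_wpM2r ?vn_ge0.
have := vnD (x - a) (E *m P); have := vn_ge0 (x - a); lra.
Qed.

Lemma straighten_surj y : vn y < rho / 2 ->
  exists2 x, vn (x - a) < rho & straighten x = y.
Proof.
move=> yr; apply: (contraction_surj (e := fun x => (f x - (x - a) *m J) *m P)) => //.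
  move=> x x' xr x'r.
  have -> : (f x - (x - a) *m J) *m P - (f x' - (x' - a) *m J) *m P =
      (f x - f x' - (x - x') *m J) *m P.
    have -> : x - x' = (x - a) - (x' - a) by rewrite opprB addrA subrK.
    rewrite !mulmxBl.
    by apply/rowP => i; rewrite !mxE; ring.
  apply: le_trans (vnM _ _) _.
  apply: le_trans (ler_wpM2r (vn_ge0 _) (fstrict xr x'r)) _.
  by rewrite mulrAC ler_wpM2r ?vn_ge0.
by rewrite fa subrr mul0mx subrr mul0mx.
Qed.

(** The inverse of [straighten], to be used for [vn y < rho / 2], where [straighten_surj] provides a
    preimage in the ball. *)
Definition unstraighten y := xget a [set x | vn (x - a) < rho /\ straighten x = y].

Lemma unstraightenP y : vn y < rho / 2 ->
  vn (unstraighten y - a) < rho /\ straighten (unstraighten y) = y.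
Proof.
move=> /straighten_surj [x xr xy].
exact: (xgetPex a (ex_intro [set x | vn (x - a) < rho /\ straighten x = y] x (conj xr xy))).
Qed.

Lemma straighten_inj x y : vn (x - a) < rho -> vn (y - a) < rho ->
  straighten x = straighten y -> x = y.
Proof.
move=> xr yr xy; apply/subr0_eq/vn0_eq0.
by have := straighten_expand xr yr; rewrite xy subrr vn0 mulr0.
Qed.

Lemma straightenK x : vn (x - a) < rho -> vn (straighten x) < rho / 2 ->
  unstraighten (straighten x) = x.
Proof. by move=> xr /unstraightenP [h1 h2]; exact: straighten_inj. Qed.

Lemma diff_at_straighten x : D x ->
  diff_at straighten x (1%:M + ('J f x - J) *m P).
Proof.
move=> Dx e e0.
have P1 : 0 < vn P + 1 by have := vn_ge0 P; lra.
have eP : 0 < e / (vn P + 1) by rewrite divr_gt0.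
have [d d0 H] := differentiable_diff_at (fD Dx) eP.
exists d => // y /H h.
have -> : straighten y - straighten x - (y - x) *m (1%:M + ('J f x - J) *m P) =
    (f y - f x - (y - x) *m 'J f x) *m P.
  rewrite straightenB mulmxDr mulmx1 mulmxA !mulmxBl !mulmxBr !mulmxBl.
  by apply/rowP => i; rewrite !mxE; ring.
apply: le_trans (vnM _ _) _; apply: le_trans (ler_wpM2r (vn_ge0 _) h) _.
rewrite mulrAC ler_wpM2r ?vn_ge0 // mulrAC ler_pdivrMr // ler_wpM2l ?ltW //.
by rewrite ltrDl.
Qed.

Lemma jacobian_near x : vn (x - a) < rho ->
  forall v : 'rV[F]_m, vn (v *m ('J f x - J)) <= eps * vn v.
Proof.
move=> xr; apply: (@approx_deriv_le _ _ _ _ f x _ _ eps (rho - vn (x - a))).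
- by rewrite subr_gt0.
- move=> y yx; apply: fstrict => //.
  by have := vn_dist_trans x y a; lra.
- exact/differentiable_diff_at/fD/ballD.
Qed.

Lemma straighten_jacobian_unit x : vn (x - a) < rho ->
  1%:M + ('J f x - J) *m P \in unitmx.
Proof.
move=> xr; apply: (@small_perturbation_unit _ _ _ _ 2^-1) => [|v]; first lra.
rewrite mulmxA; apply: le_trans (vnM _ _) _.
apply: le_trans (ler_wpM2r (vn_ge0 _) (jacobian_near xr v)) _.
by rewrite mulrAC ler_wpM2r ?vn_ge0.
Qed.

Lemma rank_projector_compl : (\rank (1%:M - J *m P)%R + \rank J <= m)%N.
Proof. by apply: mulmx0_rank_max; rewrite mulmxBl mul1mx pinvJ subrr. Qed.

(** The invertible matrix [T] is the sum of 1 - J P, of rank at most m - rank J, and of a multiple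
    of the Jacobian at [x], which must supply the rest. *)
Lemma rank_jacobian_near x : vn (x - a) < rho -> (\rank J <= \rank ('J f x))%N.
Proof.
move=> xr; have := straighten_jacobian_unit xr; set T := _ + _ => Tu.
have TE : T = (1%:M - J *m P) + 'J f x *m P.
  by rewrite /T mulmxBl addrA addrAC.
have h1 := mxrank_add (1%:M - J *m P) ('J f x *m P).
rewrite -TE (mxrank_unit Tu) in h1.
have h2 := rank_projector_compl; have h3 := mxrankM_maxl ('J f x) P.
rewrite -(leq_add2l (\rank (1%:M - J *m P)%R)).
apply: leq_trans h2 _; apply: leq_trans h1 _.
by rewrite leq_add2l.
Qed.

Lemma diff_at_unstraighten y : vn y < rho / 2 ->
  diff_at unstraighten y
    (invmx (1%:M + ('J f (unstraighten y) - J) *m P)).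
Proof.
move=> yr; have [xr xy] := unstraightenP yr; set x := unstraighten y in xr xy *.
rewrite -{1}xy.
apply: (@diff_at_inverse _ _ _ straighten _ x _ (rho / 2 - vn y) 2).
- exact: straighten_jacobian_unit.
- exact/diff_at_straighten/ballD.
- by rewrite subr_gt0.
- move=> y'; rewrite xy => y'y.
  have y'r : vn y' < rho / 2.
    by have := vnD (y' - y) y; rewrite subrK; lra.
  have [x'r x'y] := unstraightenP y'r; split => //.
  by rewrite -{2}x'y -xy; exact: straighten_expand.
Qed.

Lemma straighten_zero x : f x = 0 -> straighten x *m J = 0.
Proof.
move=> fx; rewrite /straighten fx sub0r mulNmx mulmxBl.
by rewrite -2!(mulmxA (x - a)) pinvJ subrr.
Qed.

(** Here semiregularity is used. In coordinates on ker J, straightening after [phi] is a map [psi]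
    between spaces of the same dimension [k], with invertible derivative at [z]. It is locally onto,
    so each small [y] in ker J is the straightening of a zero [phi w]. *)
Lemma zeros_unstraighten k (L : set 'rV[F]_k) phi z : local_param D f a L phi z ->
  k = (m - \rank J)%N ->
  exists2 d, 0 < d & forall y, vn y < d -> y *m J = 0 -> zeros D f (unstraighten y).
Proof.
move=> lp kE.
have [U [oU Ua UD UZ]] := local_param_image lp.
have kk : k = \rank (kermx J) by rewrite mxrank_ker.
have [B [Bf BJ]] := row_free_basis kk.
have BJ0 : B *m J = 0 by apply/sub_kermxP; rewrite BJ.
have BV : B *m pinvmx B = 1%:M by exact: mulmxVp.
have kB (y : 'rV[F]_m) : y *m J = 0 -> y *m pinvmx B *m B = y.
  by move=> yJ; apply: mulmxKpV; rewrite BJ; apply/sub_kermxP.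
have phiZ w : L w -> zeros D f (phi w).
  by move=> Lw; have : (phi @` L) (phi w) by [exists w]; rewrite -UZ => -[].
have phid w : L w -> diff_at phi w ('J phi w).
  by move=> Lw; exact/differentiable_diff_at/(local_param_differentiable lp).
have Lz := local_param_base lp; have phiz := local_param_val lp.
have oL := local_param_open lp.
pose psi w := straighten (phi w) *m pinvmx B.
have psid w : L w -> diff_at psi w ('J phi w *m
    (1%:M + ('J f (phi w) - J) *m P) *m pinvmx B).
  move=> Lw; have [Dw _] := phiZ w Lw.
  apply: (diff_at_comp (f := straighten \o phi) (g := fun y => y *m pinvmx B)).
    by apply: diff_at_comp; [exact: phid|exact: diff_at_straighten].
  exact: diff_at_linear.
have psiz : psi z = 0 by rewrite /psi phiz straighten_a mul0mx.
(* Since [f] vanishes along [phi], the derivative of [phi] at [z] takes its values in ker J. *)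
have JJ : 'J phi z *m J = 0.
  have [Dz _] := phiZ z Lz.
  have h := diff_at_comp (phid z Lz) (differentiable_diff_at (fD Dz)).
  rewrite phiz JE in h.
  have [e e0 eL] := (open_vnP L).1 oL z Lz.
  have h' : diff_at (f \o phi) z 0.
    apply: (@diff_at_near _ _ _ _ (fun=> 0) _ _ _ e) => //; last exact: diff_at_cst.
    by move=> y /eL Ly /=; have [_ ->] := phiZ y Ly.
  exact: diff_at_unique h h'.
have Au : 'J phi z *m pinvmx B \in unitmx.
  rewrite -row_free_unit /row_free eqn_leq rank_leq_row /=.
  have rphi : \rank ('J phi z) = k by have := local_param_rank lp; rewrite mxrank_tr.
  rewrite -[X in (X <= _)%N]rphi.
  have E : 'J phi z = 'J phi z *m pinvmx B *m B.
    by rewrite mulmxKpV // BJ; apply/sub_kermxP.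
  by rewrite {1}E; exact: mxrankM_maxl.
have [d1 d10 H1] := diff_at_continuous (phid z Lz) rho0.
have psiL : differentiable_on L psi.
  by move=> w Lw; exact: (diff_at_differentiable (psid w Lw)).1.
have psidz : diff_at psi z ('J phi z *m pinvmx B).
  by have := psid z Lz; rewrite phiz JE subrr mul0mx addr0 mulmx1.
have [d2 d20 H2] := differentiable_local_surj oL psiL Lz psidz Au d10.
have B1 : 0 < vn (pinvmx B) + 1 by have := vn_ge0 (pinvmx B); lra.
exists (Num.min (rho / 2) (d2 / (vn (pinvmx B) + 1))).
  by rewrite lt_min !divr_gt0.
move=> y; rewrite lt_min => /andP[yr yd] yJ.
have [] := H2 (y *m pinvmx B).
  rewrite psiz subr0; apply: le_lt_trans (vnM _ _) _.
  rewrite ltr_pdivlMr // in yd; apply: le_lt_trans yd.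
  by rewrite ler_wpM2l ?vn_ge0 // lerDl.
move=> w [/H1]; rewrite phiz => wr Lw psiw.
have [Dw fw] := phiZ w Lw.
have Gw : straighten (phi w) = y.
  by rewrite -(kB _ (straighten_zero fw)) -/(psi w) psiw kB.
by rewrite -Gw straightenK ?Gw //.
Qed.

(** The parametrization [z *m B] followed by [unstraighten] has rank [k] on its whole domain. The
    same [phi] and [L] therefore prove that the nearby zeros have dimension [k] and that they share
    the branch of [a]. *)
Lemma zero_chart k d : (0 < k)%N -> k = (m - \rank J)%N -> 0 < d ->
  (forall y, vn y < d -> y *m J = 0 -> zeros D f (unstraighten y)) ->
  exists2 d', 0 < d' & forall y, vn y < d' -> y *m J = 0 ->
    semiregular_zero D f (unstraighten y) /\ same_branch D f a (unstraighten y).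
Proof.
move=> k0 kE d0 HZ.
have kk : k = \rank (kermx J) by rewrite mxrank_ker.
have rJ : (\rank J <= m)%N by exact: rank_leq_row.
have [B [Bf BJ]] := row_free_basis kk.
have BJ0 : B *m J = 0 by apply/sub_kermxP; rewrite BJ.
have BV : B *m pinvmx B = 1%:M by exact: mulmxVp.
have kB (y : 'rV[F]_m) : y *m J = 0 -> y *m pinvmx B *m B = y.
  by move=> yJ; apply: mulmxKpV; rewrite BJ; apply/sub_kermxP.
have B1 : 0 < vn B + 1 by have := vn_ge0 B; lra.
pose dl := Num.min d (rho / 2) / (vn B + 1).
have dl0 : 0 < dl by rewrite divr_gt0 // lt_min d0 divr_gt0.
pose L := [set z : 'rV[F]_k | vn z < dl].
pose phi z := unstraighten (z *m B).
have LB z : L z -> vn (z *m B) < d /\ vn (z *m B) < rho / 2.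
  move=> zd; apply/andP; rewrite -lt_min; apply: le_lt_trans (vnM _ _) _.
  move: zd; rewrite /L /= ltr_pdivlMr //; apply: le_lt_trans.
  by rewrite ler_wpM2l ?vn_ge0 // lerDl.
have phiP z : L z -> vn (phi z - a) < rho /\ straighten (phi z) = z *m B.
  by move=> /LB [_ /unstraightenP].
have phiZ z : L z -> zeros D f (phi z).
  by move=> /LB [zd _]; apply: HZ => //; rewrite -mulmxA BJ0 mulmx0.
have oL : open L.
  apply/open_vnP => z zd; exists (dl - vn z); first by rewrite subr_gt0.
  by move=> y yz; rewrite /L /=; have := vnD (y - z) z; rewrite subrK; lra.
have phid z : L z -> diff_at phi z (B *m
    invmx (1%:M + ('J f (phi z) - J) *m P)).
  move=> Lz; apply: (diff_at_comp (f := fun z => z *m B)); first exact: diff_at_linear.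
  by apply: diff_at_unstraighten; have [] := LB z Lz.
have Jphi z : L z -> 'J phi z = B *m invmx (1%:M + ('J f (phi z) - J) *m P).
  by move=> /phid /diff_at_differentiable [].
have rphi z : L z -> \rank ('J phi z) = k.
  move=> Lz; rewrite Jphi // mxrankMfree; first by apply/eqP.
  rewrite row_free_unit unitmx_inv; apply: straighten_jacobian_unit.
  by have [] := phiP z Lz.
have lp z : L z -> local_param D f (phi z) L phi z.
  move=> Lz; split => //.
  - exact: connected_vn_ball.
  - by move=> w /phid /diff_at_differentiable [].
  - move=> w w' /[!inE] Lw Lw' ww'.
    apply: (row_free_inj Bf).
    by rewrite -(phiP w Lw).2 -(phiP w' Lw').2 ww'.
  - by rewrite /jac mxrank_tr rphi.
  (* The points whose kernel coordinates lie in [L]: a zero among them has its straightening in ker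
     J, so it is recovered from these coordinates. *)
  exists [set x | vn (x - a) < rho /\ L (straighten x *m pinvmx B)]; split.
  - apply/open_vnP => x [xr Lx].
    have h : diff_at (fun y => straighten y *m pinvmx B) x
        ((1%:M + ('J f x - J) *m P) *m pinvmx B).
      apply: (diff_at_comp (g := fun y => y *m pinvmx B)); last exact: diff_at_linear.
      exact/diff_at_straighten/ballD.
    have [e e0 eL] := (open_vnP L).1 oL _ Lx.
    have [e' e'0 H] := diff_at_continuous h e0.
    exists (Num.min e' (rho - vn (x - a))); first by rewrite lt_min e'0 subr_gt0.
    move=> y; rewrite lt_min => /andP[/H /eL yL yr]; split => //.
    by have := vn_dist_trans x y a; lra.
  - have [zr zB] := phiP z Lz; split => //.
    by rewrite zB -mulmxA BV mulmx1.
  - by move=> x [xr _]; exact: ballD.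
  - apply/seteqP; split=> [x [[xr Lx] [_ fx]]|_ [w Lw <-]].
      exists (straighten x *m pinvmx B) => //.
      have [_ lr] := LB _ Lx; rewrite /phi kB ?straightenK ?straighten_zero //.
      by rewrite -(kB (straighten x)) ?straighten_zero.
    have [wr wB] := phiP w Lw; split; last exact: phiZ.
    by split => //; rewrite wB -mulmxA BV mulmx1.
have Bp1 : 0 < vn (pinvmx B) + 1 by have := vn_ge0 (pinvmx B); lra.
exists (dl / (vn (pinvmx B) + 1)); first by rewrite divr_gt0.
move=> y yd yJ; pose z := y *m pinvmx B.
have Lz : L z.
  rewrite ltr_pdivlMr // in yd; apply: le_lt_trans (vnM _ _) _.
  by apply: le_lt_trans yd; rewrite ler_wpM2l ?vn_ge0 // lerDl.
have -> : unstraighten y = phi z by rewrite /phi /z kB.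
have [zr zB] := phiP z Lz.
split; last first.
  have L0 : L 0 by rewrite /L /= vn0.
  have phi0 : phi 0 = a.
    by rewrite /phi mul0mx -straighten_a straightenK ?subrr ?straighten_a ?vn0 ?divr_gt0.
  apply: (@same_branch_local _ _ _ _ _ a (phi z) k L L phi 0) => //.
  - by rewrite -{1}phi0; exact: lp.
  - by move=> w Lw; rewrite /jac mxrank_tr rphi.
split; first exact: phiZ.
exists k; first by right; exists L, phi, z; exact: lp.
rewrite /jac mxrank_tr.
(* This bounds the rank of the Jacobian at [phi z] from above; [rank_jacobian_near] gives the
   opposite bound. *)
have JJ : 'J phi z *m 'J f (phi z) = 0.
  have [Dz _] := phiZ z Lz.
  have h1 := phid z Lz; rewrite -Jphi // in h1.
  have h := diff_at_comp h1 (differentiable_diff_at (fD Dz)).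
  have [e e0 eL] := (open_vnP L).1 oL z Lz.
  have h' : diff_at (f \o phi) z 0.
    apply: (@diff_at_near _ _ _ _ (fun=> 0) _ _ _ e) => //; last exact: diff_at_cst.
    by move=> w /eL Lw /=; have [_ ->] := phiZ w Lw.
  exact: diff_at_unique h h'.
have := mulmx0_rank_max JJ; rewrite rphi //.
have := rank_jacobian_near zr; move: kE rJ => -> rJ h1 h2.
apply/eqP; rewrite eqn_leq h2 /=.
by rewrite -{1}(subnK rJ) leq_add2l.
Qed.

End Chart.

(** * Vanishing of the truncated Newton step *)

Section Final.
Variables (R : realType) (K : rc_kind).
Local Notation F := (rc_scalar R K).

Lemma vn_from_action m n (A : 'M[F]_(m, n)) (e : R) :
  (forall v : 'rV[F]_m, vn (v *m A) <= e * vn v) -> vn A <= m%:R * e.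
Proof.
move=> H; rewrite {1}/vn.
have row1 i : \sum_j rn (A i j) = vn (row i A).
  by rewrite /vn big_ord1; apply: eq_bigr => j _; rewrite mxE.
have d1 (i : 'I_m) : vn (delta_mx 0 i : 'rV[F]_m) = 1.
  rewrite /vn big_ord1 (bigD1 i) //= big1 => [|j ji].
    by rewrite mxE !eqxx rn1 addr0.
  by rewrite mxE (negPf ji) andbF rn0.
apply: (@le_trans _ _ (\sum_(i < m) e)).
  by apply: ler_sum => i _; rewrite row1 rowE; have := H (delta_mx 0 i); rewrite d1 mulr1.
by rewrite sumr_const card_ord mulr_natl.
Qed.

(* [h] is the displacement from a zero, [E] the linearization error of [f] along [h],
   [Q] the orthogonal projection onto the range of the truncation [Ar] of [A]. *)
Lemma displacement_eq0 m n (h y : 'rV[F]_m) (E : 'rV[F]_n) (J A Ar : 'M[F]_(m, n)) P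
    (Q : 'M[F]_n) (e C : R) :
  J *m P *m J = J -> h + E *m P = y *m J *m P ->
  vn E <= e * vn h -> vn (A - J) <= m%:R * e ->
  A *m Q = Ar -> vn Q <= C -> vn (A - Ar) <= C * (m%:R * e) ->
  (h *m J + E) *m Q = 0 -> 0 <= e -> 0 <= C ->
  e * (vn P * (C + m%:R + 2 * C * m%:R) + vn P * vn J * vn P + vn P) < 1 -> h = 0.
Proof.
move=> JPJ hE Eh AJ AQ QC AAr hQ e0 C0 small.
have hJ : h *m J + E *m P *m J = y *m J by rewrite -mulmxDl hE -!mulmxA (mulmxA J) JPJ.
(* The vector h + E P lies in the image of the idempotent J P, which therefore fixes it. *)
have h1 : h = h *m J *m P + E *m P *m J *m P - E *m P.
  by apply/eqP; rewrite -subr_eq opprK hE -mulmxDl hJ.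
(* By [hQ], h J Q = - E Q; every other term contains [A - J] or [A - Ar], so h J is small compared
   with [h]. *)
have h2 : h *m J = - (E *m Q) - h *m (A - J) + h *m (A - Ar) + h *m (A - J) *m Q.
  have := hQ; rewrite mulmxDl => /eqP; rewrite addr_eq0 => /eqP <-.
  rewrite (mulmxBr h A Ar) -AQ mulmxBr mulmxBl -!mulmxA.
  by apply/rowP => i; rewrite !mxE; ring.
have H0 := vn_ge0 h; have P0 := vn_ge0 P; have J0 := vn_ge0 J.
have me : 0 <= m%:R * e by rewrite mulr_ge0.
have b1 : vn (h *m J) <= e * (C + m%:R + 2 * C * m%:R) * vn h.
  have t1 : vn (E *m Q) <= e * vn h * C.
    by apply: le_trans (vnM _ _) _; apply: ler_pM; rewrite ?vn_ge0.
  have t2 : vn (h *m (A - J)) <= vn h * (m%:R * e).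
    by apply: le_trans (vnM _ _) _; rewrite ler_wpM2l.
  have t3 : vn (h *m (A - Ar)) <= vn h * (C * (m%:R * e)).
    by apply: le_trans (vnM _ _) _; rewrite ler_wpM2l.
  have t4 : vn (h *m (A - J) *m Q) <= vn h * (m%:R * e) * C.
    by apply: le_trans (vnM _ _) _; apply: ler_pM; rewrite ?vn_ge0.
  have s1 := vnD (- (E *m Q) - h *m (A - J) + h *m (A - Ar)) (h *m (A - J) *m Q).
  have s2 := vnD (- (E *m Q) - h *m (A - J)) (h *m (A - Ar)).
  have s3 := vnB (- (E *m Q)) (h *m (A - J)); rewrite vnN in s3.
  rewrite {1}h2.
  have -> : e * (C + m%:R + 2 * C * m%:R) * vn h =
    e * vn h * C + vn h * (m%:R * e) + vn h * (C * (m%:R * e)) + vn h * (m%:R * e) * C by ring.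
  lra.
have b2 : vn (h *m J *m P) <= e * (C + m%:R + 2 * C * m%:R) * vn h * vn P.
  by apply: le_trans (vnM _ _) _; rewrite ler_wpM2r.
have b3 : vn (E *m P) <= e * vn h * vn P.
  by apply: le_trans (vnM _ _) _; rewrite ler_wpM2r.
have b4 : vn (E *m P *m J *m P) <= e * vn h * vn P * vn J * vn P.
  apply: le_trans (vnM _ _) _; rewrite ler_wpM2r //.
  by apply: le_trans (vnM _ _) _; rewrite ler_wpM2r.
have s1 := vnB (h *m J *m P + E *m P *m J *m P) (E *m P); rewrite -h1 in s1.
have s2 := vnD (h *m J *m P) (E *m P *m J *m P).
apply: vn0_eq0; rewrite leNgt; apply/negP => hpos.
have : vn h <= e * (vn P * (C + m%:R + 2 * C * m%:R) + vn P * vn J * vn P + vn P) * vn h.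
  have -> : e * (vn P * (C + m%:R + 2 * C * m%:R) + vn P * vn J * vn P + vn P) * vn h =
    e * (C + m%:R + 2 * C * m%:R) * vn h * vn P + e * vn h * vn P * vn J * vn P +
    e * vn h * vn P by ring.
  lra.
by rewrite ler_pMl // leNgt small.
Qed.
End Final.

Theorem lemma3p4 (R : realType) (K : rc_kind) (m n : nat)
    (Omega : set 'rV[rc_scalar R K]_m)
    (f : 'rV[rc_scalar R K]_m -> 'rV[rc_scalar R K]_n)
    (xstar : 'rV[rc_scalar R K]_m) (r : nat) :
  open Omega ->
  smooth Omega f ->
  semiregular_zero Omega f xstar ->
  r = \rank (jac f xstar) ->
  exists Omegastar : set 'rV[rc_scalar R K]_m,
    [/\ open Omegastar, Omegastar xstar, Omegastar `<=` Omega &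
        forall x, Omegastar x ->
          (mp_inverse (rank_proj r (jac f x)) *m (f x)^T = 0 <->
           semiregular_zero Omega f x /\ same_branch Omega f xstar x)].
Proof.
move=> oO fs [[Oa fa] [k dimk km]] rE.
set a := xstar in Oa fa dimk km rE *.
have fD := smooth_differentiable fs.
pose J := 'J f a.
have [P JPJ] : exists P, J *m P *m J = J by exists (pinvmx J); apply: mulmxKpV.
have rJ : \rank (jac f a) = \rank J by rewrite /jac mxrank_tr.
rewrite rJ in km.
have kE : k = (m - \rank J)%N.
  by apply/eqP; rewrite -(eqn_add2r (\rank J)) km subnK ?rank_leq_row.
have [C C0 HC] := rank_proj_approx (esym rE).
(* The coefficient of [e] in [displacement_eq0]. The choice of [eps] below makes [eps * q < 1] and
   also [eps * vn P] at most 1/2, as the chart requires. *)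
pose q := vn P * (C + m%:R + 2 * C * m%:R) + vn P * vn J * vn P + vn P.
have P0 := vn_ge0 P; have J0 := vn_ge0 J.
have q1 : 0 <= vn P * (C + m%:R + 2 * C * m%:R) + vn P * vn J * vn P.
  by rewrite addr_ge0 ?mulr_ge0 ?addr_ge0 ?mulr_ge0.
have q0 : 0 < q + 1 by rewrite ltr_wpDl // addr_ge0.
pose eps := 2^-1 / (q + 1).
have eps0 : 0 < eps by rewrite divr_gt0 // invr_gt0.
have epsq : eps * q < 1.
  by rewrite mulrAC ltr_pdivrMr // mul1r /q; move: q1 P0; rewrite /q; lra.
have epsP : eps * vn P <= 2^-1.
  by rewrite mulrAC ler_pdivrMr // ler_wpM2l ?invr_ge0 // /q; lra.
have [d1 d10 fstr] := smooth_strict_at oO fs Oa eps0.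
have [d2 d20 OD] := (open_vnP Omega).1 oO a Oa.
pose rho := Num.min d1 d2.
have rho0 : 0 < rho by rewrite lt_min d10.
have ballD x : vn (x - a) < rho -> Omega x by rewrite lt_min => /andP[_ /OD].
have fstrict x y : vn (x - a) < rho -> vn (y - a) < rho ->
    vn (f x - f y - (x - y) *m J) <= eps * vn (x - y).
  by rewrite !lt_min => /andP[xd _] /andP[yd _]; exact: fstr.
pose G := straighten f a J P; pose Gi := unstraighten f a rho J P.
have GiP y : vn y < rho / 2 -> vn (Gi y - a) < rho /\ G (Gi y) = y.
  exact: (unstraightenP fa epsP fstrict).
have [d d0 chart] : exists2 d, 0 < d & forall y, vn y < d -> y *m J = 0 ->
    semiregular_zero Omega f (Gi y) /\ same_branch Omega f a (Gi y).
  case: dimk => [[k0 ia]|[L [phi [z lp]]]].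
    (* In dimension 0 the Jacobian has trivial kernel, and the only point of the chart is [a]. *)
    exists 1 => // y _ yJ.
    have y0 : y = 0.
      apply: (row_free_inj (A := J)); last by rewrite yJ mul0mx.
      by rewrite /row_free; apply/eqP; apply: etrans km; rewrite k0.
    have -> : Gi y = a.
      rewrite y0 /Gi -[0](straighten_a J P fa).
      apply: (straightenK fa epsP fstrict); first by rewrite subrr vn0.
      by rewrite straighten_a // vn0 divr_gt0.
    split; last exact: same_branch_isolated.
    split => //; exists k; first by left.
    by rewrite rJ.
  have k0 := local_param_gt0 lp.
  have [d' d'0 HZ] := zeros_unstraighten (erefl J) JPJ fD fa rho0 epsP fstrict lp kE.
  exact: (zero_chart JPJ fD fa rho0 epsP ballD fstrict k0 kE d'0 HZ).
(* The projector onto ker J along the image of J P. The radius [rho1] below ensures that the kernel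
   component of [G x] lies in the domain of the chart; its factor 2 is the Lipschitz constant of [G]
   at [a]. *)
pose N := 1%:M - J *m P.
have N1 : 0 < vn N + 1 by have := vn_ge0 N; lra.
pose rho1 := Num.min rho (Num.min d (rho / 2) / (2 * (vn N + 1))).
have rho10 : 0 < rho1.
  by rewrite lt_min rho0 divr_gt0 ?mulr_gt0 // lt_min d0 divr_gt0.
exists [set x | vn (x - a) < rho1]; split.
- apply/open_vnP => x xr; exists (rho1 - vn (x - a)); first by rewrite subr_gt0.
  by move=> y yx; rewrite /=; have := vn_dist_trans x y a; lra.
- by rewrite /= subrr vn0.
- by move=> x; rewrite /= lt_min => /andP[/ballD].
move=> x; rewrite /= lt_min => /andP[xr]; rewrite ltr_pdivlMr ?mulr_gt0 // => xr'.
split; last by move=> [[[_ ->] _] _]; rewrite trmx0 mulmx0.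
move=> Xf.
have GN : vn (G x *m N) < Num.min d (rho / 2).
  apply: le_lt_trans xr'; apply: le_trans (vnM _ _) _.
  have Gx : vn (G x) <= 2 * vn (x - a) by exact: (straighten_lipschitz fa rho0 epsP fstrict).
  apply: le_trans (ler_wpM2r (vn_ge0 _) Gx) _.
  rewrite mulrCA mulrA ler_wpM2l ?mulr_ge0 ?vn_ge0 // lerDl.
  by [].
move: GN; rewrite lt_min => /andP[GNd GNr].
have NJ : N *m J = 0 by rewrite mulmxBl mul1mx JPJ subrr.
have [wr Gw] := GiP _ GNr.
have GNJ : G x *m N *m J = 0 by rewrite -mulmxA NJ mulmx0.
have [sw bw] := chart _ GNd GNJ.
set w := Gi _ in wr Gw sw bw.
(* [w] is the zero with the same kernel component as [x], so G x - G w = G x J P: the displacement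
   has no free part in the kernel. *)
suff -> : x = w by split; [apply: sw|apply: bw].
apply/subr0_eq.
have [[Ow fw] _] := sw.
have [QA QC AAr] := HC (jac f x).
set Ar := rank_proj r _ in QA QC AAr Xf.
set X := mp_inverse Ar in QA QC Xf.
have AJ : vn ('J f x - J) <= m%:R * eps.
  by apply: vn_from_action; exact: (jacobian_near fD ballD fstrict xr).
apply: (@displacement_eq0 _ _ m n _ (G x) (f x - f w - (x - w) *m J) J ('J f x) Ar^T P
   (Ar *m X)^T eps C) => //.
- have := straightenB f a J P x w; rewrite -/(G x) -/(G w) Gw => <-.
  by rewrite mulmxBr mulmx1 opprB addrC subrK mulmxA.
- exact: fstrict.
- by rewrite -{1}['J f x]trmxK -trmx_mul -/(jac f x) QA.
- by rewrite vn_tr.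
- have -> : 'J f x - Ar^T = (jac f x - Ar)^T by rewrite linearB /= trmxK.
  rewrite vn_tr; apply: le_trans AAr _; rewrite ler_wpM2l //.
  have -> : jac f x - jac f a = ('J f x - J)^T by rewrite linearB.
  by rewrite vn_tr.
- rewrite addrC subrK fw subr0; apply: trmx_inj.
  by rewrite trmx_mul trmxK -mulmxA Xf mulmx0 trmx0.
- exact: ltW.
Qed.
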